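(* Let $N$ be a compact $2k$-dimensional differentiable manifold such that $H^{2i}(N;{\bf R})=0$ for some $i\in\{1,\dots,k\}$. Then $N$ cannot be immersed in any Kaehlerian manifold as a proper slant submanifold.
   Context: $N$ has no boundary. An immersed submanifold $N$ of a Kaehlerian manifold $(M,g,J)$ is slant if, for nonzero $X\in T_xN$, the angle between $JX$ and $T_xN$ is a constant $\theta$ independent of $x\in N$ and of $X$; it is proper slant if moreover $\theta\neq0,\pi/2$. *)

(* Defs.v *)
From mathcomp Require Import all_boot all_order all_algebra.
From mathcomp Require Import all_classical all_reals all_analysis.

Set Implicit Arguments.
Unset Strict Implicit.
Unset Printing Implicit Defensive.

Import Order.TTheory GRing.Theory Num.Theory.
Import numFieldNormedType.Exports.

Local Open Scope classical_set_scope.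
Local Open Scope ring_scope.

(* Conventions.  Manifolds are C^oo, Hausdorff, second countable and without
   boundary, but not necessarily connected.  Vectors are row vectors, so a
   linear map is a matrix acting on the right; in particular
   [jacobian f x : 'M_(n, m)] sends v to v *m jacobian f x = 'D_v f x.
   A tensor field is the family of its expressions in all charts of the
   (maximal) atlas, each being a function on R^n of which only the values on
   the image of the chart are meaningful. *)

Section Smooth.
Context {R : realType} {V W : normedModType R}.

Fixpoint Ck_on (k : nat) (U : set V) (f : V -> W) : Prop :=
  match k with
  | 0 => forall x, U x -> {for x, continuous f}
  | k'.+1 => (forall x, U x -> differentiable f x) /\
             (forall v : V, Ck_on k' U (fun x => 'D_v f x))
  end.

(* Used for open U only. *)
Definition smooth_on (U : set V) (f : V -> W) : Prop :=
  forall k, Ck_on k U f.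

End Smooth.

Section Manifolds.
Variable R : realType.

(* [cinv] is the inverse homeomorphism; its values outside the image of the
   chart, like those of [cmap] outside [cdom], are irrelevant. *)
Record chart (n : nat) (T : topologicalType) := Chart {
  cdom : set T;
  cmap : T -> 'rV[R]_n;
  cinv : 'rV[R]_n -> T;
  cdom_open : open cdom;
  cim_open : open (cmap @` cdom);
  cmapK : {in cdom, cancel cmap cinv};
  cmap_continuous : {in cdom, continuous cmap};
  cinv_continuous : {in cmap @` cdom, continuous cinv}
}.

Definition cim n (T : topologicalType) (c : chart n T) : set 'rV[R]_n :=
  cmap c @` cdom c.

(* The expression of a map between (subsets of) manifolds in two charts, and
   the open subset of R^n on which it is meaningful. *)
Definition locrep n m (S T : topologicalType) (f : S -> T)
    (c : chart n S) (d : chart m T) : 'rV[R]_n -> 'rV[R]_m :=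
  fun x => cmap d (f (cinv c x)).

Definition locdom n m (S T : topologicalType) (f : S -> T)
    (c : chart n S) (d : chart m T) : set 'rV[R]_n :=
  cmap c @` (cdom c `&` f @^-1` cdom d).

Definition transition n (T : topologicalType) (c d : chart n T) :
  'rV[R]_n -> 'rV[R]_n := locrep id c d.

Definition overlap n (T : topologicalType) (c d : chart n T) :
  set 'rV[R]_n := locdom id c d.

Definition compatible n (T : topologicalType) (c d : chart n T) : Prop :=
  smooth_on (overlap c d) (transition c d) /\
  smooth_on (overlap d c) (transition d c).

Record smoothManifold (n : nat) := SmoothManifold {
  carrier :> topologicalType;
  atlas : set (chart n carrier);
  mfd_hausdorff : hausdorff_space carrier;
  mfd_second_countable : @second_countable carrier;
  atlas_cover : forall p : carrier, exists2 c, atlas c & cdom c p;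
  atlas_compatible : forall c d, atlas c -> atlas d -> compatible c d;
  atlas_maximal : forall c, (forall d, atlas d -> compatible c d) -> atlas c
}.

Definition smooth_map n m (N : smoothManifold n) (M : smoothManifold m)
    (f : N -> M) : Prop :=
  continuous f /\
  forall c d, atlas c -> atlas d -> smooth_on (locdom f c d) (locrep f c d).

Definition immersion n m (N : smoothManifold n) (M : smoothManifold m)
    (f : N -> M) : Prop :=
  smooth_map f /\
  forall c d, atlas c -> atlas d -> forall x, locdom f c d x ->
    row_free (jacobian (locrep f c d) x).

End Manifolds.

Section DeRham.
Context {R : realType} {n : nat}.

(* p tangent vectors of R^n are the rows of a p x n matrix; multilinearity and
   alternation are expressed as in [determinant_multilinear] and
   [determinant_alternate]. *)
Definition multilinear_rows p (a : 'M[R]_(p, n) -> R) : Prop :=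
  forall (A B C : 'M[R]_(p, n)) (i : 'I_p) (b c : R),
    row i A = b *: row i B + c *: row i C ->
    row' i A = row' i B -> row' i A = row' i C ->
    a A = b * a B + c * a C.

Definition alternating_rows p (a : 'M[R]_(p, n) -> R) : Prop :=
  forall (A : 'M[R]_(p, n)) (i j : 'I_p),
    i != j -> row i A = row j A -> a A = 0.

Definition preform (M : smoothManifold R n) (p : nat) :=
  chart R n M -> 'rV[R]_n -> 'M[R]_(p, n) -> R.

(* Smooth differential p-forms. *)
Definition is_form (M : smoothManifold R n) p (w : preform M p) : Prop :=
  [/\ forall c, atlas c -> forall x, cim c x ->
        multilinear_rows (w c x) /\ alternating_rows (w c x),
      forall c, atlas c -> forall A, smooth_on (cim c) (fun x => w c x A) &
      forall c d, atlas c -> atlas d -> forall x, overlap c d x -> forall A,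
        w c x A = w d (transition c d x) (A *m jacobian (transition c d) x)].

(* d a (v_0, ..., v_p) = sum_i (-1)^i D_{v_i} a (v_0, ..., ^v_i, ..., v_p) *)
Definition dext p (a : 'rV[R]_n -> 'M[R]_(p, n) -> R) :
    'rV[R]_n -> 'M[R]_(p.+1, n) -> R :=
  fun x A => \sum_(i < p.+1)
    (-1) ^+ i * 'D_(row i A) (fun y => a y (row' i A)) x.

Definition closed_form (M : smoothManifold R n) p (w : preform M p) : Prop :=
  forall c, atlas c -> forall x, cim c x -> forall A, dext (w c) x A = 0.

Definition exact_form (M : smoothManifold R n) (p : nat) :
    preform M p -> Prop :=
  match p with
  | 0 => fun w => forall c, atlas c -> forall x, cim c x ->
           forall A, w c x A = 0
  | q.+1 => fun w => exists2 h : preform M q, is_form h &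
           forall c, atlas c -> forall x, cim c x ->
             forall A, w c x A = dext (h c) x A
  end.

(* H^p(M; R) = 0, i.e. closed p-forms modulo exact p-forms is trivial. *)
Definition deRham_trivial (M : smoothManifold R n) (p : nat) : Prop :=
  forall w : preform M p, is_form w -> closed_form w -> exact_form w.

End DeRham.

Section Metric.
Context {R : realType} {n : nat}.

Definition inner (G : 'M[R]_n) (u v : 'rV[R]_n) : R := (u *m G *m v^T) 0 0.

Definition inorm (G : 'M[R]_n) (u : 'rV[R]_n) : R := Num.sqrt (inner G u u).

(* theta is the angle between the nonzero vector u and the subspace spanned by
   the rows of W, i.e. between u and its orthogonal projection t onto it:
   cos theta = |t| / |u| with 0 <= theta <= pi / 2. *)
Definition is_angle (G : 'M[R]_n) k (u : 'rV[R]_n) (W : 'M[R]_(k, n))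
    (theta : R) : Prop :=
  exists t : 'rV[R]_n,
    [/\ (t <= W)%MS,
        forall w : 'rV[R]_n, (w <= W)%MS -> inner G (u - t) w = 0 &
        theta = acos (inorm G t / inorm G u)].

Definition mxfield (M : smoothManifold R n) :=
  chart R n M -> 'rV[R]_n -> 'M[R]_n.

Definition riemannian_metric (M : smoothManifold R n) (g : mxfield M) : Prop :=
  [/\ forall c, atlas c -> smooth_on (cim c) (g c),
      forall c d, atlas c -> atlas d -> forall x, overlap c d x ->
        forall u v, inner (g c x) u v =
          inner (g d (transition c d x)) (u *m jacobian (transition c d) x)
                                         (v *m jacobian (transition c d) x),
      forall c, atlas c -> forall x, cim c x -> (g c x)^T = g c x &
      forall c, atlas c -> forall x, cim c x -> forall u, u != 0 ->
        0 < inner (g c x) u u].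

Definition almost_complex (M : smoothManifold R n) (J : mxfield M) : Prop :=
  [/\ forall c, atlas c -> smooth_on (cim c) (J c),
      forall c d, atlas c -> atlas d -> forall x, overlap c d x ->
        J c x *m jacobian (transition c d) x =
        jacobian (transition c d) x *m J d (transition c d x) &
      forall c, atlas c -> forall x, cim c x -> J c x *m J c x = - 1%:M].

Definition hermitian (M : smoothManifold R n) (g J : mxfield M) : Prop :=
  forall c, atlas c -> forall x, cim c x -> forall u v,
    inner (g c x) (u *m J c x) (v *m J c x) = inner (g c x) u v.

(* (X, Y) |-> g(X, J Y) *)
Definition fundamental_form (M : smoothManifold R n) (g J : mxfield M) :
    preform M 2 :=
  fun c x A => inner (g c x) (row 0 A) (row 1 A *m J c x).

End Metric.

Section Kaehler.
Variables (R : realType) (m : nat).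

(* Multiplication by i on C^m = R^m x R^m, (a, b) = a + i b: it maps (a, b) to
   (- b, a). *)
Definition std_complex : 'M[R]_(m + m) := block_mx 0 1%:M (- 1%:M) 0.

(* J comes from a structure of complex manifold: the charts in which J is
   constantly multiplication by i form a holomorphic atlas, since their
   transition maps satisfy the Cauchy-Riemann equations. *)
Definition complex_structure (M : smoothManifold R (m + m)) (J : mxfield M) :
    Prop :=
  almost_complex J /\
  forall p : M, exists c : chart R (m + m) M,
    [/\ atlas c, cdom c p & forall x, cim c x -> J c x = std_complex].

Definition kaehlerian (M : smoothManifold R (m + m)) (g J : mxfield M) : Prop :=
  [/\ riemannian_metric g, complex_structure J, hermitian g J &
      closed_form (fundamental_form g J)].

End Kaehler.

Section Slant.
Context {R : realType} {n m : nat}.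
Variables (N : smoothManifold R n) (M : smoothManifold R m).
Variables (g J : mxfield M) (f : N -> M).

(* The tangent space f_* T_pN is the row space of the Jacobian of f. *)
Definition slant_with_angle (theta : R) : Prop :=
  forall (p : N) c d, atlas c -> atlas d -> cdom c p -> cdom d (f p) ->
    let df := jacobian (locrep f c d) (cmap c p) in
    let y := cmap d (f p) in
    forall X : 'rV[R]_n, X != 0 ->
      is_angle (g d y) (X *m df *m J d y) df theta.

Definition proper_slant : Prop :=
  exists theta : R,
    [/\ slant_with_angle theta, theta != 0 & theta != pi / 2].

End Slant.

(* Main.v *)
Require Import Defs.
From mathcomp Require Import all_boot all_order all_algebra.
From mathcomp Require Import all_fingroup.
From mathcomp Require Import all_classical all_reals all_analysis.
From mathcomp Require Import ring lra zify.

Local Open Scope classical_set_scope.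
Local Open Scope ring_scope.

(* Let omega be the fundamental form of M. The slant angle being different from
   pi/2, the tangential part of J X never vanishes, so Omega = f^* omega is a
   closed nondegenerate 2-form on N and Omega^k vanishes nowhere. If Omega^i is
   exact, say d eta, then Omega^k = d (Omega^(k-i) /\ eta), which contradicts
   Stokes' theorem on the compact manifold N. Stokes' theorem is proved with
   lattice sums: they are asymptotically invariant under changes of charts
   because a local diffeomorphism is homotopic to an affine map, and homotopies
   change the sums by a telescoping divergence. *)

(** Of Stokes' theorem only one consequence is used: an exact top form on a compact manifold has a
    zero. This spares orientations. The constant function 1 would then have sums that tend to 0,
    being sums of divergences, and that stay above a positive constant. A general linear map does
    not preserve the lattice. Signed permutations do; a triangular matrix is joined to a diagonal of
    signs through invertible matrices, and an LUP decomposition yields all invertible matrices.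
    Forms are functions on lists of vectors of every length, so that contraction by the head of the
    list makes each identity of exterior calculus an induction on the list; the matrix forms of the
    statement are translated only at both ends. Bump functions are powers of a positive part, of
    finite class only: class C^2 suffices for what is differentiated. *)

Section Preliminaries.
Set Implicit Arguments.
Unset Strict Implicit.
Unset Printing Implicit Defensive.
Import Order.TTheory GRing.Theory Num.Theory.
Import numFieldNormedType.Exports.

(** * Maps of class C^k *)

Section CkCalculus.
Context {R : realType}.

Section General.
Context {V W : normedModType R}.
Implicit Types (f g : V -> W) (U : set V).

Lemma near_eq_differentiable f g x :
  (\near x, f x = g x) -> differentiable f x -> differentiable g x.
Proof.
move=> fg df.
have gfx : g x = f x by apply/esym; exact: (nbhs_singleton fg).
have dg : g \o shift x = cst (g x) + 'd f x +o_ (0 : V) id.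
  apply/eqaddoP => e e0.
  have [_ /eqaddoP h0] := (diff_locallyP x f).1 df; have h1 := h0 e e0.
  have fg0 : \forall y \near (0 : V), f (y + x) = g (y + x).
    by move: fg; rewrite (near_shift 0 x) subr0.
  near=> y.
  have -> : (g \o shift x - (cst (g x) + 'd f x)) y =
            (f \o shift x - (cst (f x) + 'd f x)) y.
    by rewrite !fctE /= gfx; congr (_ - _); apply/esym; near: y.
  by near: y.
have E := diff_unique (diff_continuous df) dg.
by apply/diff_locallyP; rewrite E; split => //; exact: diff_continuous.
Unshelve. all: by end_near. Qed.

(** At every order [Ck_on] quantifies over the points of [U] separately, while the derivatives are
    global functions. Regularity is thus a pointwise notion, expressed by [[set x]], and local
    models can be glued point by point. *)
Lemma Ck_onP k U f :
  Ck_on k U f <-> forall x, U x -> Ck_on k [set x] f.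
Proof.
elim: k f => [|k IH] f /=.
  by split=> [h x Ux _ -> | h x Ux]; [exact: h | exact: (h x Ux x)].
split=> [[h1 h2] x Ux | h].
  by split=> [_ -> | v]; [exact: h1 | move/IH: (h2 v) => /(_ x Ux)].
split=> [x Ux | v]; first by have [/(_ x erefl)] := h x Ux.
by apply/IH => x Ux; have [_] := h x Ux.
Qed.

Lemma Ck_on_sub k U U' f : U' `<=` U -> Ck_on k U f -> Ck_on k U' f.
Proof. by move=> UU' /Ck_onP h; apply/Ck_onP => x /UU'; exact: h. Qed.

(** Two functions equal near [x] are also equal near every point close to [x], so their directional
    derivatives are again equal near [x] and the induction on the order proceeds. *)
Lemma Ck_near_ext k f g x :
  (\near x, f x = g x) -> Ck_on k [set x] f -> Ck_on k [set x] g.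
Proof.
elim: k f g => [|k IH] f g fg.
  move=> /(_ x erefl) fx _ ->; rewrite /prop_for /continuous_at -(nbhs_singleton fg).
  by apply: cvg_trans fx; apply: near_eq_cvg; rewrite -near_nbhs; apply: filterS fg => y <-.
move=> [h1 h2]; split=> [_ -> | v].
  by apply: near_eq_differentiable fg _; exact: h1.
apply: IH (h2 v); apply: filterS (nbhs_interior fg) => y yfg.
exact: near_eq_derive.
Unshelve. all: by end_near. Qed.

Lemma Ck_on_ext k U f g : open U -> {in U, f =1 g} ->
  Ck_on k U f -> Ck_on k U g.
Proof.
move=> oU fg /Ck_onP h; apply/Ck_onP => x Ux; apply: Ck_near_ext (h x Ux).
by apply: filterS (open_nbhs_nbhs (conj oU Ux)) => y Uy; apply: fg; rewrite inE.
Qed.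

Lemma Ck_onSP k U f : Ck_on k.+1 U f ->
  (forall x, U x -> differentiable f x) /\ (forall v, Ck_on k U ('D_v f)).
Proof. by []. Qed.

Lemma Ck_onS k U f : Ck_on k.+1 U f -> Ck_on k U f.
Proof.
elim: k f => [|k IH] f.
  by case=> h _ x Ux; apply: differentiable_continuous; exact: h.
by case=> h1 h2; split=> // v; apply: IH; exact: h2.
Qed.

Lemma Ck_on_le k l U f : (k <= l)%N -> Ck_on l U f -> Ck_on k U f.
Proof.
move=> /subnK <-; elim: (l - k)%N => [//|m IH]; rewrite addSn => /Ck_onS; exact: IH.
Qed.

Lemma Ck_on_continuous k U f x : Ck_on k U f -> U x -> {for x, continuous f}.
Proof. by move=> /(Ck_on_le (leq0n k)); apply. Qed.

Lemma Ck_cst k U (a : W) : Ck_on k U (fun _ : V => a).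
Proof.
elim: k a => [|k IH] a /=; first by move=> x _; exact: cst_continuous.
split=> [x _|v]; first exact: differentiable_cst.
have -> : 'D_v (fun _ : V => a) = fun=> 0 by apply/funext => x; rewrite derive_cst.
exact: IH.
Qed.

Lemma Ck_add k U f g : open U -> Ck_on k U f -> Ck_on k U g ->
  Ck_on k U (fun x => f x + g x).
Proof.
move=> oU; elim: k f g => [|k IH] f g /=.
  by move=> hf hg x Ux; apply: continuousD; [exact: hf|exact: hg].
move=> [df hf] [dg hg]; split=> [x Ux|v].
  by apply: differentiableD; [exact: df|exact: dg].
apply: Ck_on_ext oU _ (IH _ _ (hf v) (hg v)) => x /set_mem Ux.
by rewrite -[fun x => _ + _]/(f + g) deriveD //; apply: diff_derivable; auto.
Qed.

Lemma Ck_sum k U I (r : seq I) (P : pred I) (F : I -> V -> W) : open U ->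
  (forall i, P i -> Ck_on k U (F i)) ->
  Ck_on k U (fun x => \sum_(i <- r | P i) F i x).
Proof.
move=> oU h; elim: r => [|i r IH].
  by apply: Ck_on_ext oU _ (Ck_cst k U 0) => x _; rewrite big_nil.
have [Pi|Pi] := boolP (P i).
  apply: Ck_on_ext oU _ (Ck_add oU (h i Pi) IH) => x _.
  by rewrite big_cons Pi.
by apply: Ck_on_ext oU _ IH => x _; rewrite big_cons (negbTE Pi).
Qed.

Lemma Ck_scalel k U (c : V -> R) (w : W) : open U ->
  Ck_on k U c -> Ck_on k U (fun x => c x *: w).
Proof.
move=> oU; elim: k c => [|k IH] c /=.
  by move=> h x Ux; apply: continuousZl; exact: h.
move=> [h1 h2]; split=> [x Ux|v].
  by apply: differentiableZl; exact: h1.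
apply: Ck_on_ext oU _ (IH _ (h2 v)) => x /set_mem Ux.
by rewrite !deriveE ?diffZl //; [exact: h1|apply: differentiableZl|]; exact: h1.
Qed.

End General.

Section Scalar.
Context {V : normedModType R}.
Implicit Types (f g : V -> R) (U : set V).

Lemma Ck_mul k U f g : open U -> Ck_on k U f -> Ck_on k U g ->
  Ck_on k U (fun x => f x * g x).
Proof.
move=> oU; elim: k f g => [|k IH] f g hf hg.
  by move=> x Ux; apply: continuousM; [exact: hf|exact: hg].
have [df hf'] := Ck_onSP hf; have [dg hg'] := Ck_onSP hg; split=> [x Ux|v].
  by apply: differentiableM; [exact: df|exact: dg].
apply: (@Ck_on_ext _ _ k U (fun x => f x * 'D_v g x + g x * 'D_v f x)) => //.
  move=> x /set_mem Ux.
  by rewrite -[fun x => f x * g x]/(f * g) deriveM //; apply: diff_derivable; auto.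
by apply: Ck_add => //; apply: IH => //; exact: Ck_onS.
Qed.

Lemma Ck_opp k U f : open U -> Ck_on k U f -> Ck_on k U (fun x => - f x).
Proof.
move=> oU h; apply: (@Ck_on_ext _ _ k U (fun x => (-1) * f x)) => //.
  by move=> x _; rewrite mulN1r.
by apply: Ck_mul => //; exact: Ck_cst.
Qed.

Lemma Ck_sub k U f g : open U -> Ck_on k U f -> Ck_on k U g ->
  Ck_on k U (fun x => f x - g x).
Proof. by move=> oU hf hg; apply: Ck_add => //; exact: Ck_opp. Qed.

Lemma Ck_prod k U I (r : seq I) (P : pred I) (F : I -> V -> R) : open U ->
  (forall i, P i -> Ck_on k U (F i)) ->
  Ck_on k U (fun x => \prod_(i <- r | P i) F i x).
Proof.
move=> oU h; elim: r => [|i r IH].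
  by apply: Ck_on_ext oU _ (Ck_cst k U (1 : R)) => x _; rewrite big_nil.
have [Pi|Pi] := boolP (P i).
  apply: Ck_on_ext oU _ (Ck_mul oU (h i Pi) IH) => x _.
  by rewrite big_cons Pi.
by apply: Ck_on_ext oU _ IH => x _; rewrite big_cons (negbTE Pi).
Qed.

(** The derivative -f^-2 f' contains 1/f undifferentiated, so the induction hypothesis of order k
    closes the step to k + 1. *)
Lemma Ck_inv k U f : open U -> (forall x, U x -> f x != 0) ->
  Ck_on k U f -> Ck_on k U (fun x => (f x)^-1).
Proof.
move=> oU f0; elim: k f f0 => [|k IH] f f0 hf.
  by move=> x Ux; apply: cvgV; [exact: f0|exact: hf].
have [df hf'] := Ck_onSP hf; split=> [x Ux|v].
  by apply: differentiableV; [exact: df|exact: f0].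
apply: (@Ck_on_ext _ _ k U (fun x => - ((f x)^-1 * (f x)^-1) * 'D_v f x)) => //.
  move=> x /set_mem Ux.
  rewrite [RHS]deriveE; last by apply: differentiableV; auto.
  rewrite diffV; [|by auto|by auto].
  rewrite deriveE; last by auto.
  by rewrite -[RHS]/(_ * _) -exprVn expr2.
have hi : Ck_on k U (fun x => (f x)^-1) by apply: IH => //; exact: Ck_onS.
by apply: Ck_mul (hf' v) => //; apply: Ck_opp => //; exact: Ck_mul.
Qed.

End Scalar.

Section Coordinates.
Context {V : normedModType R} {m n : nat}.
Implicit Types (f : V -> 'M[R]_(m, n)) (U : set V).

Lemma differentiable_mxP f x :
  differentiable f x <-> forall i j, differentiable (fun y => f y i j) x.
Proof.
split=> [h i j|h].
  exact: (differentiable_comp h (differentiable_coord _ i j)).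
have -> : f = fun y => \sum_i \sum_j f y i j *: delta_mx i j.
  by apply/funext => y; exact: matrix_sum_delta.
have -> : (fun y => \sum_i \sum_j f y i j *: delta_mx i j) =
  \sum_i \sum_j (fun y => f y i j *: delta_mx i j : 'M[R]_(m, n)).
  apply/funext => y; rewrite fct_sumE; apply: eq_bigr => i _.
  by rewrite fct_sumE.
by apply: differentiable_sum => i; apply: differentiable_sum => j; exact: differentiableZl.
Qed.

Lemma derive_coord f x v i j : derivable f x v ->
  'D_v (fun y => f y i j) x = 'D_v f x i j.
Proof. by move=> h; rewrite derive_mx // mxE. Qed.

Lemma Ck_mxP k U f : open U ->
  Ck_on k U f <-> forall i j, Ck_on k U (fun y => f y i j).
Proof.
move=> oU; elim: k f => [|k IH] f.
  split=> [h i j x Ux|h x Ux].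
    by apply: (@continuous_comp _ _ _ f (fun M : 'M[R]_(m, n) => M i j : R));
      [exact: h|exact: coord_continuous].
  have -> : f = fun y => \sum_i \sum_j f y i j *: delta_mx i j.
    by apply/funext => y; exact: matrix_sum_delta.
  have : Ck_on 0 U (fun y => \sum_i \sum_j f y i j *: delta_mx i j : 'M[R]_(m, n)).
    by apply: Ck_sum => // i _; apply: Ck_sum => // j _; exact: Ck_scalel.
  by apply.
split=> [[h1 h2] i j|h].
  split=> [x Ux|v]; first by move/differentiable_mxP: (h1 x Ux); apply.
  apply: Ck_on_ext oU _ ((IH _).1 (h2 v) i j) => x /set_mem Ux.
  by rewrite -derive_coord //; apply: diff_derivable; exact: h1.
have df x : U x -> differentiable f x.
  by move=> Ux; apply/differentiable_mxP => i j; have [/(_ x Ux)] := h i j.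
split=> // v; apply/IH => i j; have [_ /(_ v)] := h i j.
apply: Ck_on_ext oU _ => x /set_mem Ux.
by rewrite derive_coord //; apply: diff_derivable; exact: df.
Qed.

End Coordinates.

Section Linear.

Lemma Ck_coord k m n U i j : Ck_on k U (fun M : 'M[R]_(m, n) => M i j).
Proof.
case: k => [|k]; first by move=> x _; exact: coord_continuous.
split=> [x _|v]; first exact: differentiable_coord.
rewrite (_ : (fun x => _) = fun=> v i j); first exact: Ck_cst.
apply/funext => x; rewrite (@derive_coord _ m n id) ?derive_id //.
Qed.

End Linear.

Section Composition.
Context {V : normedModType R} {m : nat}.

(** The chain rule in coordinates: it writes the derivative of a composite as a sum of products with
    factors of the same kind, the form needed to prove [Ck_comp] by induction on the order. *)
Lemma derive_comp (W : normedModType R) (f : V -> 'rV[R]_m) (g : 'rV[R]_m -> W) x v :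
  differentiable f x -> differentiable g (f x) ->
  'D_v (fun y => g (f y)) x = \sum_j 'D_v f x 0 j *: 'D_(delta_mx 0 j) g (f x).
Proof.
move=> df dg; have dgf := differentiable_comp df dg.
rewrite -[fun y => _]/(g \o f) deriveE // diff_comp // /=.
rewrite -(deriveE _ df) [X in 'd g _ X]row_sum_delta linear_sum.
by apply: eq_bigr => j _; rewrite linearZ /= -deriveE.
Qed.

Lemma derive_comp_scalar (f : V -> 'rV[R]_m) (g : 'rV[R]_m -> R) x v :
  differentiable f x -> differentiable g (f x) ->
  'D_v (fun y => g (f y)) x = \sum_j 'D_v f x 0 j * 'D_(delta_mx 0 j) g (f x).
Proof. exact: derive_comp. Qed.

Lemma Ck_comp k U O (f : V -> 'rV[R]_m) (g : 'rV[R]_m -> R) : open U ->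
  Ck_on k U f -> Ck_on k O g -> (forall x, U x -> O (f x)) ->
  Ck_on k U (fun x => g (f x)).
Proof.
move=> oU + + UO; elim: k g => [|k IH] g hf hg.
  move=> x Ux; apply: continuous_comp; first exact: hf.
  by apply: hg; exact: UO.
have [df hf'] := Ck_onSP hf; have [dg hg'] := Ck_onSP hg; split=> [x Ux|v].
  by apply: differentiable_comp; [exact: df|apply: dg; exact: UO].
apply: (@Ck_on_ext _ _ k U
  (fun x => \sum_j 'D_v f x 0 j * 'D_(delta_mx 0 j) g (f x))) => //.
  by move=> x /set_mem Ux; rewrite derive_comp_scalar //; [exact: df|apply: dg; exact: UO].
apply: Ck_sum => // j _; apply: Ck_mul => //.
  by move: (hf' v) => /(Ck_mxP k _ oU); apply.
by apply: (IH ('D_(delta_mx 0 j) g)) => //; exact: Ck_onS.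
Qed.

End Composition.

Section Jacobian.

Lemma row_jacobian n m (f : 'rV[R]_n -> 'rV[R]_m) x i : differentiable f x ->
  row i (jacobian f x) = 'D_(delta_mx 0 i) f x.
Proof. by move=> df; rewrite (deriveEjacobian _ df) rowE. Qed.

Lemma jacobian_coord n m (f : 'rV[R]_n -> 'rV[R]_m) x i j : differentiable f x ->
  jacobian f x i j = 'D_(delta_mx 0 i) (fun y => f y 0 j) x.
Proof.
move=> df; rewrite (@derive_coord _ 1 m f); last exact: diff_derivable.
by rewrite -(row_jacobian i df) [RHS]mxE.
Qed.

Lemma Ck_jacobian n m k U (f : 'rV[R]_n -> 'rV[R]_m) i j : open U ->
  Ck_on k.+1 U f -> Ck_on k U (fun x => jacobian f x i j).
Proof.
move=> oU hf; have [df _] := hf.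
have /(_ 0 j)[_ /(_ (delta_mx 0 i))] := (Ck_mxP k.+1 f oU).1 hf.
apply: Ck_on_ext oU _ => x /set_mem Ux.
by rewrite jacobian_coord //; exact: df.
Qed.

Lemma jacobian_comp n m l (f : 'rV[R]_n -> 'rV[R]_m) (g : 'rV[R]_m -> 'rV[R]_l) x :
  differentiable f x -> differentiable g (f x) ->
  jacobian (fun y => g (f y)) x = jacobian f x *m jacobian g (f x).
Proof.
move=> df dg; apply/row_matrixP => i; have dgf := differentiable_comp df dg.
rewrite row_mul (row_jacobian i df) (row_jacobian i dgf) -(deriveEjacobian _ dg).
by rewrite (deriveE _ dgf) (deriveE _ dg) (deriveE _ df) (diff_comp df dg).
Qed.

Lemma near_eq_jacobian n m (f g : 'rV[R]_n -> 'rV[R]_m) x :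
  (\near x, f x = g x) -> differentiable f x -> jacobian f x = jacobian g x.
Proof.
move=> fg df; have dg := near_eq_differentiable fg df.
apply/row_matrixP => i; have e := row_jacobian i df.
by rewrite (near_eq_derive _ fg) in e; apply: etrans e _; apply/esym; exact: row_jacobian.
Qed.

Lemma jacobian_id n (x : 'rV[R]_n) : jacobian id x = 1%:M.
Proof.
apply/row_matrixP => i; by rewrite row_jacobian // derive_id row1.
Qed.

End Jacobian.

End CkCalculus.

(** * Symmetry of second derivatives *)

Section SecondDerivatives.
Context {R : realType} {V : normedModType R}.
Implicit Types (f : V -> R) (U : set V).

Lemma is_derive_line f x u (s : R) : differentiable f (x + s *: u) ->
  is_derive s 1 (fun t : R => f (x + t *: u)) ('D_u f (x + s *: u)).
Proof.
move=> df; have dl : is_diff s (fun t : R => x + t *: u) (fun t => t *: u).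
  have -> : (fun t : R => x + t *: u) = cst x + *:%R ^~ u by [].
  by apply: is_diff_eq; apply/funext => t; rewrite !fctE add0r.
have dfl : differentiable (f \o (fun t : R => x + t *: u)) s.
  by apply: differentiable_comp => //; case: dl.
apply: DeriveDef; first exact/derivable1_diffP.
rewrite -[LHS]/('D_1 (f \o (fun t : R => x + t *: u)) s) (deriveE (1 : R) dfl).
rewrite (diff_comp (@ex_diff _ _ _ _ _ _ _ dl) df) /= (@diff_val _ _ _ _ _ _ _ dl).
by rewrite scale1r -deriveE.
Qed.

Lemma MVT_line f x u (h : R) : 0 < h ->
  (forall s, 0 <= s <= h -> differentiable f (x + s *: u)) ->
  exists2 s, 0 <= s <= h & f (x + h *: u) - f x = h * 'D_u f (x + s *: u).
Proof.
move=> h0 df; pose F (t : R) := f (x + t *: u).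
have dF s : 0 <= s <= h -> is_derive s 1 F ('D_u f (x + s *: u)).
  by move=> hs; apply: is_derive_line; exact: df.
have cF : {within `[0, h], continuous F}.
  apply: derivable_within_continuous => s; rewrite in_itv /= => hs.
  by have [] := dF s hs.
have dF' s : s \in `]0, h[%R -> is_derive s 1 F ('D_u f (x + s *: u)).
  by rewrite in_itv /= => /andP[s0 sh]; apply: dF; rewrite !ltW.
have [s] := MVT h0 dF' cF; rewrite in_itv /= => /andP[s0 sh] E.
exists s; first by rewrite !ltW.
by move: E; rewrite /F scale0r addr0 subr0 mulrC.
Qed.

(** The mean value theorem twice: along [u] for y |-> f(y + h v) - f(y), then along [v] for
    ['D_u f]. The left-hand side is symmetric in [u] and [v], which is what [derive_sym]
    exploits. *)
Lemma second_difference f x u v (h r : R) : 0 < h -> h * (`|u| + `|v|) < r ->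
  (forall y, `|y - x| < r -> differentiable f y) ->
  (forall y, `|y - x| < r -> differentiable ('D_u f) y) ->
  exists2 y, `|y - x| < r &
    f (x + h *: u + h *: v) - f (x + h *: u) - (f (x + h *: v) - f x) =
    h ^+ 2 * 'D_v ('D_u f) y.
Proof.
move=> h0 hr df ddf.
have inball s t : 0 <= s <= h -> 0 <= t <= h -> `|x + s *: u + t *: v - x| < r.
  move=> /andP[s0 sh] /andP[t0 th]; apply: le_lt_trans hr.
  rewrite [X in `|X|](_ : _ = s *: u + t *: v) ?mulrDr; last first.
    by rewrite -[x + _ + _]addrA addrAC subrr add0r.
  apply: le_trans (ler_normD _ _) _; rewrite !normrZ !ger0_norm //.
  by apply: lerD; apply: ler_wpM2r.
have hh : 0 <= h <= h by rewrite lexx ltW.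
have h00 : 0 <= (0 : R) <= h by rewrite lexx ltW.
pose F y := f (y + h *: v) - f y.
have shiftd y : differentiable f (y + h *: v) -> is_diff y (fun z => f (z + h *: v)) ('d f (y + h *: v)).
  move=> dfy; have ds : is_diff y (fun z => z + h *: v) id.
    have -> : (fun z => z + h *: v) = id + cst (h *: v) by [].
    by apply: is_diff_eq; apply/funext => t; rewrite !fctE addr0.
  have ds' := @ex_diff _ _ _ _ _ _ _ ds.
  apply: DiffDef; first exact: differentiable_comp.
  by apply: etrans (diff_comp ds' dfy) _; rewrite (@diff_val _ _ _ _ _ _ _ ds).
have dF s : 0 <= s <= h -> differentiable F (x + s *: u) /\
    'D_u F (x + s *: u) = 'D_u f (x + s *: u + h *: v) - 'D_u f (x + s *: u).
  move=> hs; have d1 : differentiable f (x + s *: u).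
    by apply: df; have := inball s 0 hs h00; rewrite scale0r addr0.
  have d2 : differentiable f (x + s *: u + h *: v) by apply: df; exact: inball.
  have e2 := shiftd _ d2.
  have dFs : differentiable F (x + s *: u) by apply: differentiableB => //; exact: ex_diff.
  split=> //; have e2' := @ex_diff _ _ _ _ _ _ _ e2.
  rewrite (deriveE _ dFs) (deriveE _ d1) (deriveE _ d2).
  have -> : 'd F (x + s *: u) u = ('d (fun z => f (z + h *: v)) (x + s *: u) \- 'd f (x + s *: u)) u.
    by rewrite -(diffB e2' d1).
  by rewrite /= (@diff_val _ _ _ _ _ _ _ e2).
have [s hs E] : exists2 s, 0 <= s <= h &
    F (x + h *: u) - F x = h * 'D_u F (x + s *: u).
  by apply: MVT_line => // s hs; have [] := dF s hs.
have [t ht E'] : exists2 t, 0 <= t <= h &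
    'D_u f (x + s *: u + h *: v) - 'D_u f (x + s *: u) =
    h * 'D_v ('D_u f) (x + s *: u + t *: v).
  by apply: MVT_line => // t ht; apply: ddf; exact: inball.
exists (x + s *: u + t *: v); first exact: inball.
by rewrite -/(F _) -/(F _) E (dF s hs).2 E' mulrA expr2.
Qed.

Lemma continuous_eq_of_close (F G : V -> R) x :
  {for x, continuous F} -> {for x, continuous G} ->
  (forall r, 0 < r -> exists y z, [/\ `|y - x| < r, `|z - x| < r & F y = G z]) ->
  F x = G x.
Proof.
move=> cF cG h; apply/eqP; rewrite -subr_eq0 -normr_le0.
apply/ler_addgt0Pr => e e0; rewrite add0r.
have e2 : 0 < e / 2 by rewrite divr_gt0.
have /nbhs_normP[r1 /= r10 h1] : \forall y \near x, `|F x - F y| < e / 2.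
  by move/cvgrPdist_lt: cF; apply.
have /nbhs_normP[r2 /= r20 h2] : \forall y \near x, `|G x - G y| < e / 2.
  by move/cvgrPdist_lt: cG; apply.
have [|y [z [yx zx E]]] := h (Num.min r1 r2); first by rewrite lt_min r10.
have a1 : `|F x - F y| < e / 2.
  by apply: h1; rewrite /= distrC; move: yx; rewrite lt_min => /andP[].
have a2 : `|G x - G z| < e / 2.
  by apply: h2; rewrite /= distrC; move: zx; rewrite lt_min => /andP[].
rewrite (splitr e); apply: le_trans (ler_distD (F y) _ _) _.
by apply: lerD; [|rewrite E distrC]; exact: ltW.
Qed.

(** Schwarz's theorem. One second difference, divided by h^2, is a value of either mixed derivative
    near [x]; letting the ball shrink, continuity identifies the two at [x]. *)
Lemma derive_sym f U x u v : open U -> Ck_on 2 U f -> U x ->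
  'D_u ('D_v f) x = 'D_v ('D_u f) x.
Proof.
move=> oU hf Ux; have [df hf'] := Ck_onSP hf.
have c1 := Ck_onSP (hf' u); have c2 := Ck_onSP (hf' v).
apply: (continuous_eq_of_close (c2.2 u x Ux) (c1.2 v x Ux)).
have /nbhs_normP[r0 /= r00 hU] : \forall y \near x, U y by exact: open_nbhs_nbhs.
have hU' y : `|y - x| < r0 -> U y by move=> yr; apply: hU; rewrite /= distrC.
move=> r1 r10; pose r := Num.min r0 r1; have rp : 0 < r by rewrite lt_min r00.
have hUr y : `|y - x| < r -> U y by rewrite lt_min => /andP[/hU'].
pose h := r / (2 * (`|u| + `|v| + 1)).
have q0 : 0 < `|u| + `|v| + 1 by rewrite ltr_wpDl // addr_ge0.
have h0 : 0 < h by rewrite divr_gt0 // mulr_gt0.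
have hlt : h * (`|u| + `|v|) < r.
  have hq : h * (2 * (`|u| + `|v| + 1)) = r by rewrite /h divfK // gt_eqF // mulr_gt0.
  rewrite -hq ltr_pM2l // mulrDr mulr1 mulr_natl mulr2n -addrA ltrDl.
  by rewrite ltr_wpDl // addr_ge0.
have [y yr Ey] : exists2 y, `|y - x| < r &
    f (x + h *: u + h *: v) - f (x + h *: u) - (f (x + h *: v) - f x) =
    h ^+ 2 * 'D_v ('D_u f) y.
  apply: second_difference hlt _ _ => // y /hUr Uy; [exact: df|exact: c1.1].
have [z zr Ez] : exists2 z, `|z - x| < r &
    f (x + h *: v + h *: u) - f (x + h *: v) - (f (x + h *: u) - f x) =
    h ^+ 2 * 'D_u ('D_v f) z.
  apply: second_difference _ _ _ => //; first by rewrite addrC.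
  by move=> z /hUr Uz; exact: df.
  by move=> z /hUr Uz; exact: c2.1.
have hr1 (w : V) : `|w - x| < r -> `|w - x| < r1 by rewrite lt_min => /andP[].
refine (ex_intro _ z (ex_intro _ y (And3 (hr1 z zr) (hr1 y yr) _))).
apply: (@mulfI _ (h ^+ 2)); first by rewrite expf_neq0 // gt_eqF.
apply: etrans (esym Ez) (etrans _ Ey); rewrite (addrAC x (h *: v)).
move: (f (x + _ + _)) (f (x + _)) (f (x + _)) (f x) => a b c d; clear.
by ring.
Qed.

End SecondDerivatives.

(** * Extension by zero and bump functions of finite class *)

Section CutOff.
Context {R : realType}.

(** [U] and the complement of [K] are open and cover the space; the extension is [f] on the first
    and 0 on the second. *)
Lemma Ck_zero_ext (V W : normedModType R) k (U K : set V) (f : V -> W) :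
  open U -> closed K -> K `<=` U -> (forall x, U x -> ~ K x -> f x = 0) ->
  Ck_on k U f -> Ck_on k setT (fun x => if x \in U then f x else 0).
Proof.
move=> oU cK KU f0 hf; apply/Ck_onP => x _.
have [Ux|nUx] := pselect (U x).
  apply: (@Ck_near_ext _ _ _ k f); last by move/Ck_onP: hf; apply.
  by apply: filterS (open_nbhs_nbhs (conj oU Ux)) => y Uy; rewrite mem_set.
apply: (@Ck_near_ext _ _ _ k (fun=> 0)); last exact: Ck_cst.
have nKx : (~` K) x by move=> /KU.
have oK : open (~` K) by exact: closed_openC.
apply: filterS (open_nbhs_nbhs (conj oK nKx)) => y nKy.
by case: ifPn => // /set_mem Uy; rewrite f0.
Qed.

(** The positive part of [t]. Its power of exponent k + 1 is of class C^k, which replaces exp(-1/t)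
    in bump functions. *)
Definition relu (t : R) : R := (t + `|t|) / 2.

Lemma relu_ge0 t : 0 <= relu t.
Proof. by rewrite /relu; have := ler_norm (- t); rewrite normrN; lra. Qed.

Lemma relu_gt0 t : 0 < t -> relu t = t.
Proof. by move=> t0; rewrite /relu gtr0_norm //; field. Qed.

Lemma relu_le0 t : t <= 0 -> relu t = 0.
Proof. by move=> t0; rewrite /relu ler0_norm //; field. Qed.

Lemma relu_continuous : continuous relu.
Proof.
move=> t; apply: cvgM; last exact: cvg_cst.
by apply: cvgD; [exact: cvg_id|apply: cvg_norm; exact: cvg_id].
Qed.

Lemma is_derive_relu k (t : R) :
  is_derive t 1 (fun s => relu s ^+ k.+2) (k.+2%:R * relu t ^+ k.+1).
Proof.
have [t0|t0|->] := ltgtP t 0.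
  apply: (@near_eq_is_derive _ _ _ (cst 0)).
    by apply: filterS (lt_nbhsl t0) => s s0; rewrite relu_le0 ?expr0n // ltW.
  by rewrite relu_le0 ?ltW // expr0n /= mulr0; exact: is_derive_cst.
  apply: (@near_eq_is_derive _ _ _ (fun s : R => s ^+ k.+2)).
    by apply: filterS (lt_nbhsr t0) => s s0; rewrite relu_gt0.
  rewrite relu_gt0 //; have := @is_deriveX _ _ id k.+2 t 1 1 (is_derive_id _ _).
  by rewrite exprfctE [_%:A]mulr1.
(* At the corner the difference quotient is computed by hand: for h != 0 it equals [relu h ^+ k.+1],
   which tends to 0. *)
have E : (fun h : R => h^-1 *: (relu (h *: 1 + 0) ^+ k.+2 - relu 0 ^+ k.+2)) @ 0^' --> (0 : R).
  have c0 : (fun h => relu h ^+ k.+1) @ (0 : R)^' --> (0 : R).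
    have h : (fun h => relu h ^+ k.+1) @ (0 : R) --> relu 0 ^+ k.+1.
      have := continuous_comp (relu_continuous (x := 0)) (@exprn_continuous R k.+1 (relu 0)).
      by [].
    move: h; rewrite relu_le0 // expr0n /=; apply: cvg_trans.
    by apply: cvg_app; exact: nbhs_dnbhs.
  apply: cvg_trans c0; apply: near_eq_cvg; apply: filterS (nbhs_dnbhs_neq (0 : R)) => h h0.
  rewrite addr0 [h *: 1]mulr1 (relu_le0 (lexx 0)) [0 ^+ _]expr0n subr0.
  have [h1|h1|h1] := ltgtP h 0; last by rewrite h1 eqxx in h0.
    by rewrite relu_le0 ?ltW // !expr0n /= scaler0.
  by rewrite relu_gt0 // [RHS](_ : _ = h^-1 * h ^+ k.+2) // [h ^+ k.+2]exprS mulKf.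
rewrite (relu_le0 (lexx 0)) expr0n /= mulr0.
by apply: DeriveDef; [apply/cvg_ex; exists 0|apply: cvg_lim].
Qed.

Lemma Ck_relu (V : normedModType R) k (U : set V) (f : V -> R) : open U ->
  Ck_on k U f -> Ck_on k U (fun x => relu (f x) ^+ k.+1).
Proof.
move=> oU; elim: k => [|k IH] hf.
  move=> x Ux; rewrite /=.
  have -> : (fun x => relu (f x) ^+ 1) = relu \o f by apply/funext => y; rewrite expr1.
  by apply: (continuous_comp (hf x Ux)); exact: relu_continuous.
have [df hf'] := Ck_onSP hf.
have dr t : differentiable (fun s => relu s ^+ k.+2) t.
  by apply/derivable1_diffP; case: (is_derive_relu k t).
split=> [x Ux|v].
  exact: (differentiable_comp (df x Ux) (dr (f x))).
apply: (@Ck_on_ext _ _ _ k U (fun x => 'D_v f x * (k.+2%:R * relu (f x) ^+ k.+1))) => //.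
  move=> x /set_mem Ux; have dfx := df x Ux.
  have E := deriveE v (differentiable_comp dfx (dr (f x))).
  rewrite (diff_comp dfx (dr (f x))) /= -(deriveE v dfx) in E.
  apply/esym; apply: etrans E _; have [_ <-] := is_derive_relu k (f x).
  by rewrite (deriveE (1 : R) (dr (f x))) -[X in 'd _ _ X]mulr1 [X in 'd _ _ X]/(_ *: _) linearZ.
apply: Ck_mul => //; apply: Ck_mul => //; first exact: Ck_cst.
by apply: IH; exact: Ck_onS.
Qed.

Definition ball_bump n k (a : 'rV[R]_n) (r : R) (x : 'rV[R]_n) : R :=
  relu (r ^+ 2 - \sum_j (x 0 j - a 0 j) ^+ 2) ^+ k.+1.

Lemma Ck_ball_bump n k (a : 'rV[R]_n) r U : Ck_on k U (ball_bump k a r).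
Proof.
apply: (@Ck_on_sub _ _ _ k setT) => //; apply: Ck_relu; first exact: openT.
apply: Ck_sub; [exact: openT|exact: Ck_cst|].
apply: Ck_sum => [|j _]; first exact: openT.
have h : Ck_on k setT (fun x : 'rV[R]_n => x 0 j - a 0 j).
  by apply: Ck_sub; [exact: openT|exact: Ck_coord|exact: Ck_cst].
by apply: Ck_mul => //; exact: openT.
Qed.

Lemma ball_bump_ge0 n k (a : 'rV[R]_n) r x : 0 <= ball_bump k a r x.
Proof. by rewrite exprn_ge0 // relu_ge0. Qed.

Lemma ball_bump_gt0 n k (a : 'rV[R]_n) r : 0 < r -> 0 < ball_bump k a r a.
Proof.
move=> r0; rewrite /ball_bump big1 => [|j _]; last by rewrite subrr expr0n.
by rewrite subr0 exprn_gt0 // relu_gt0 exprn_gt0.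
Qed.

Lemma mx_norm_ge m n (x : 'M[R]_(m, n)) i j : `|x i j| <= `|x|.
Proof.
by rewrite [leRHS]/Num.Def.normr /= mx_normrE; exact: (le_bigmax _ (fun i => `|x i.1 i.2|) (i, j)).
Qed.

Lemma mx_norm_le m n (x : 'M[R]_(m, n)) b : 0 <= b ->
  (forall i j, `|x i j| <= b) -> `|x| <= b.
Proof.
move=> b0 h; rewrite [leLHS]/Num.Def.normr /= mx_normrE.
by apply: bigmax_le => // i _; exact: h.
Qed.

(** The norm of row vectors is the maximum norm, hence at most the Euclidean distance that occurs in
    the bump: one coordinate of size at least [r] suffices. *)
Lemma ball_bump_eq0 n k (a : 'rV[R]_n) r x : 0 < r -> r <= `|x - a| -> ball_bump k a r x = 0.
Proof.
move=> r0 rx; rewrite /ball_bump relu_le0 ?expr0n // subr_le0.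
have [j rj] : exists j, r <= `|x 0 j - a 0 j|.
  apply: contrapT => /forallNP h.
  suff : `|x - a| < r by rewrite ltNge rx.
  rewrite [ltLHS]/Num.Def.normr /= mx_normrE; apply: bigmax_lt => // -[i j] _ /=.
  by rewrite ord1 !mxE ltNge; apply/negP; exact: h.
rewrite (bigD1 j) //=; apply: (@le_trans _ _ ((x 0 j - a 0 j) ^+ 2)).
  by rewrite -[leRHS]real_normK ?num_real // lerXn2r // nnegrE ltW.
by rewrite lerDl; apply: sumr_ge0 => i _; exact: sqr_ge0.
Qed.

End CutOff.

(** * Alternating forms *)

Section Wedge.
Variables (R : realFieldType) (V : lmodType R).
Implicit Types (a b : seq V -> R) (u v : V -> R) (B : V -> V -> R) (s t : seq V).

(* A form is a function on lists of vectors, of all lengths at once, so that no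
   degree occurs in types. The recursion is
   x _| (u /\ a) = u(x) a - u /\ (x _| a). *)
Fixpoint wedge u a s : R :=
  if s is x :: t then u x * a t - wedge u (fun t => a (x :: t)) t else 0.

(* B /\ a for a 2-form B: x _| (B /\ a) = (x _| B) /\ a + B /\ (x _| a). *)
Fixpoint wedge2 B a s : R :=
  if s is x :: t then wedge (B x) a t + wedge2 B (fun t => a (x :: t)) t else 0.

Lemma eq_wedge u v a b s : u =1 v -> a =1 b -> wedge u a s = wedge v b s.
Proof.
move=> uv; elim: s a b => //= x s IH a b ab.
by rewrite uv ab; congr (_ - _); apply: IH => t; exact: ab.
Qed.

Lemma eq_wedge2 B C a b s : (forall x y, B x y = C x y) -> a =1 b ->
  wedge2 B a s = wedge2 C b s.
Proof.
move=> BC; elim: s a b => //= x s IH a b ab.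
by congr (_ + _); [apply: eq_wedge => // y; exact: BC|apply: IH => t; exact: ab].
Qed.

Lemma wedgeDr u a b c s :
  wedge u (fun t => c * a t + b t) s = c * wedge u a s + wedge u b s.
Proof.
elim: s a b => [|x s IH] a b /=; first by rewrite mulr0 addr0.
by rewrite IH; ring.
Qed.

Lemma wedgeDl u v a c s :
  wedge (fun x => c * u x + v x) a s = c * wedge u a s + wedge v a s.
Proof.
elim: s a => [|x s IH] a /=; first by rewrite mulr0 addr0.
by rewrite IH; ring.
Qed.

Lemma wedge0r u s : wedge u (fun=> 0) s = 0.
Proof. by elim: s => //= x s ->; rewrite mulr0 subr0. Qed.

Lemma wedge0l u a s : (forall x, x \in s -> u x = 0) -> wedge u a s = 0.
Proof.
elim: s a => //= x s IH a h; rewrite h ?mem_head // mul0r IH ?subr0 // => y ys.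
by rewrite h // inE ys orbT.
Qed.

Lemma wedgeZr u a c s : wedge u (fun t => c * a t) s = c * wedge u a s.
Proof.
rewrite -[RHS]addr0 -(wedge0r u s) -wedgeDr; apply: eq_wedge => // t.
by rewrite addr0.
Qed.

Lemma wedgeNr u a s : wedge u (fun t => - a t) s = - wedge u a s.
Proof. by rewrite -mulN1r -wedgeZr; apply: eq_wedge => // t; rewrite mulN1r. Qed.

Lemma wedge2Dr B a b c s :
  wedge2 B (fun t => c * a t + b t) s = c * wedge2 B a s + wedge2 B b s.
Proof.
elim: s a b => [|x s IH] a b /=; first by rewrite mulr0 addr0.
by rewrite IH wedgeDr; ring.
Qed.

Lemma wedge20r B s : wedge2 B (fun=> 0) s = 0.
Proof. by elim: s => //= x s ->; rewrite wedge0r addr0. Qed.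

Lemma wedge2Zr B a c s : wedge2 B (fun t => c * a t) s = c * wedge2 B a s.
Proof.
rewrite -[RHS]addr0 -(wedge20r B s) -wedge2Dr; apply: eq_wedge2 => // t.
by rewrite addr0.
Qed.

(** Contracting u /\ v /\ a with x gives u(x) v /\ a - v(x) u /\ a + u /\ v /\ (x _| a): exchanging
    u and v negates the first two terms together, and the last one is the induction hypothesis. *)
Lemma wedge_anti u v a s : wedge u (wedge v a) s = - wedge v (wedge u a) s.
Proof.
elim: s a => [|x s IH] a /=; first by rewrite oppr0.
have E w z : wedge w (fun t => z x * a t - wedge z (fun t => a (x :: t)) t) s =
    z x * wedge w a s - wedge w (wedge z (fun t => a (x :: t))) s.
  rewrite -wedgeNr -wedgeDr; apply: eq_wedge => // t.
by rewrite !E IH; ring.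
Qed.

Lemma wedge2_wedge B u a s : wedge2 B (wedge u a) s = wedge u (wedge2 B a) s.
Proof.
elim: s a => [|x s IH] a //=.
have -> : wedge2 B (fun t => u x * a t - wedge u (fun t => a (x :: t)) t) s =
    u x * wedge2 B a s - wedge2 B (wedge u (fun t => a (x :: t))) s.
  rewrite (eq_wedge2 (C := B)
    (b := fun t => u x * a t + (-1) * wedge u (fun t => a (x :: t)) t)) //.
    by rewrite wedge2Dr wedge2Zr mulN1r.
  by move=> t; rewrite mulN1r.
have -> : wedge u (fun t => wedge (B x) a t + wedge2 B (fun t => a (x :: t)) t) s =
    wedge u (wedge (B x) a) s + wedge u (wedge2 B (fun t => a (x :: t))) s.
  rewrite -[X in X + _]mul1r -wedgeDr; apply: eq_wedge => // t; first by rewrite mul1r.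
by rewrite IH wedge_anti; ring.
Qed.

Definition seq_linear a := forall s1 s2 c x y,
  a (s1 ++ (c *: x + y) :: s2) = c * a (s1 ++ x :: s2) + a (s1 ++ y :: s2).

Definition seq_antisym a := forall s1 s2 x y,
  a (s1 ++ x :: y :: s2) = - a (s1 ++ y :: x :: s2).

Lemma seq_linear_cons a x : seq_linear a -> seq_linear (fun t => a (x :: t)).
Proof. by move=> h s1; exact: (h (x :: s1)). Qed.

Lemma seq_antisym_cons a x : seq_antisym a -> seq_antisym (fun t => a (x :: t)).
Proof. by move=> h s1; exact: (h (x :: s1)). Qed.

Lemma wedge_linear u a : (forall c x y, u (c *: x + y) = c * u x + u y) ->
  seq_linear a -> seq_linear (wedge u a).
Proof.
move=> hu ha s1; elim: s1 a ha => [|z s1 IH] a ha s2 c x y /=.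
  rewrite hu (eq_wedge (v := u) (b := fun t => c * a (x :: t) + a (y :: t))) //.
    by rewrite wedgeDr; ring.
  by move=> t; exact: (ha [::]).
by rewrite ha IH; [ring|exact: seq_linear_cons].
Qed.

Lemma wedge_antisym u a : seq_antisym a -> seq_antisym (wedge u a).
Proof.
move=> ha s1; elim: s1 a ha => [|z s1 IH] a ha s2 x y /=.
  rewrite (eq_wedge (v := u) (b := fun t => - a (y :: x :: t))) //.
    by rewrite wedgeNr; ring.
  by move=> t; exact: (ha [::]).
by rewrite ha IH; [ring|exact: seq_antisym_cons].
Qed.

Lemma wedge2_linear B a :
  (forall c x y z, B (c *: x + y) z = c * B x z + B y z) ->
  (forall c x y z, B z (c *: x + y) = c * B z x + B z y) ->
  seq_linear a -> seq_linear (wedge2 B a).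
Proof.
move=> hl hr ha s1; elim: s1 a ha => [|z s1 IH] a ha s2 c x y /=.
  rewrite (eq_wedge (v := fun z => c * B x z + B y z) (b := a)) //.
  rewrite (eq_wedge2 (C := B) (b := fun t => c * a (x :: t) + a (y :: t))) //.
    by rewrite wedgeDl wedge2Dr; ring.
  by move=> t; exact: (ha [::]).
have hw : seq_linear (wedge (B z) a) by apply: wedge_linear.
by rewrite hw IH; [ring|exact: seq_linear_cons].
Qed.

Lemma wedge2_antisym B a : (forall x y, B x y = - B y x) ->
  seq_antisym a -> seq_antisym (wedge2 B a).
Proof.
move=> hB ha s1; elim: s1 a ha => [|z s1 IH] a ha s2 x y /=.
  rewrite (eq_wedge2 (C := B) (b := fun t => (-1) * a (y :: x :: t))) //.
    by rewrite wedge2Zr hB; ring.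
  by move=> t; rewrite mulN1r; exact: (ha [::]).
have hw : seq_antisym (wedge (B z) a) by exact: wedge_antisym.
by rewrite hw IH; [ring|exact: seq_antisym_cons].
Qed.

(** A form on lists has no degree of its own, so degree [p] is recorded by vanishing on all other
    lengths. Linearity and antisymmetry alone allow sums of forms of different degrees. *)
Definition seq_homog p a := forall s, size s != p -> a s = 0.

Lemma wedge_homog p u a : seq_homog p a -> seq_homog p.+1 (wedge u a).
Proof.
move=> ha s; elim: s p a ha => //= x s IH p a ha hs.
rewrite ha // mulr0 sub0r; case: p ha hs => [|p] ha hs.
  rewrite (eq_wedge (v := u) (b := fun=> 0)) ?wedge0r ?oppr0 // => t.
  exact: ha.
by rewrite (IH p) ?oppr0 // => t ht; exact: ha.
Qed.

Lemma wedge2_homog p B a : seq_homog p a -> seq_homog p.+2 (wedge2 B a).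
Proof.
move=> ha s; elim: s p a ha => //= x s IH p a ha hs.
rewrite (wedge_homog (p := p)) // add0r; case: p ha hs => [|p] ha hs.
  rewrite (eq_wedge2 (C := B) (b := fun=> 0)) ?wedge20r // => t.
  exact: ha.
by rewrite (IH p) // => t ht; exact: ha.
Qed.

Definition seq_one s : R := (s == [::])%:R.

Definition wpow B l := iter l (wedge2 B) seq_one.

Lemma wpow_homog B l : seq_homog (2 * l)%N (wpow B l).
Proof.
elim: l => [|l IH]; first by move=> [].
by rewrite mulnS; exact: wedge2_homog.
Qed.

Lemma iter_wedge2_linear B a l :
  (forall c x y z, B (c *: x + y) z = c * B x z + B y z) ->
  (forall c x y z, B z (c *: x + y) = c * B z x + B z y) ->
  seq_linear a -> seq_linear (iter l (wedge2 B) a).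
Proof. by move=> h1 h2 ha; elim: l => //= l; exact: wedge2_linear. Qed.

Lemma iter_wedge2_antisym B a l : (forall x y, B x y = - B y x) ->
  seq_antisym a -> seq_antisym (iter l (wedge2 B) a).
Proof. by move=> h1 ha; elim: l => //= l; exact: wedge2_antisym. Qed.

Lemma seq_one_linear : seq_linear seq_one.
Proof. by case=> [|z s1] s2 c x y; rewrite /seq_one /= mulr0 addr0. Qed.

Lemma seq_one_antisym : seq_antisym seq_one.
Proof. by case=> [|z s1] s2 x y; rewrite /seq_one /= oppr0. Qed.

(** Contraction by [x] is a derivation on the powers of [B], and the 1-form x _| B moves past the
    even factors without sign, so the l + 1 terms coincide. *)
Lemma wpow_cons B l x s :
  wpow B l.+1 (x :: s) = l.+1%:R * wedge (B x) (wpow B l) s.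
Proof.
elim: l s => [|l IH] s.
  rewrite /wpow /= mul1r (eq_wedge2 (C := B) (b := fun=> 0)) ?wedge20r ?addr0 //.
rewrite {1}/wpow iterS -/(wpow B l.+1) /=.
rewrite (eq_wedge2 (C := B) (b := fun t => l.+1%:R * wedge (B x) (wpow B l) t)) //.
rewrite wedge2Zr wedge2_wedge -[X in X + _]mul1r.
by rewrite -[wedge2 B (wpow B l)]/(wpow B l.+1) -mulrDl addrC natr1.
Qed.

End Wedge.

Section Naturality.
Variables (R : realFieldType) (V W : lmodType R) (g : V -> W).

Lemma wedge_map u a s :
  wedge (fun x => u (g x)) (fun t => a (map g t)) s = wedge u a (map g s).
Proof. by elim: s a => //= x s IH a; rewrite -(IH (fun t => a (g x :: t))). Qed.

Lemma wedge2_map B a s :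
  wedge2 (fun x y => B (g x) (g y)) (fun t => a (map g t)) s = wedge2 B a (map g s).
Proof.
elim: s a => //= x s IH a.
by rewrite -(IH (fun t => a (g x :: t))) wedge_map.
Qed.

Lemma iter_wedge2_map B a l s :
  iter l (wedge2 (fun x y => B (g x) (g y))) (fun t => a (map g t)) s =
  iter l (wedge2 B) a (map g s).
Proof.
elim: l s => //= l IH s; rewrite -wedge2_map; exact: eq_wedge2.
Qed.

End Naturality.

Section Nondegenerate.
Variables (R : realFieldType) (n : nat) (B : 'rV[R]_n -> 'rV[R]_n -> R).
Hypothesis B_linear : forall c x y z, B z (c *: x + y) = c * B z x + B z y.
Hypothesis B_linearl : forall c x y z, B (c *: x + y) z = c * B x z + B y z.
Hypothesis B_nondeg : forall x, x != 0 -> exists y, B x y != 0.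

Lemma bilinear_coord x y : B x y = \sum_j y 0 j * B x (delta_mx 0 j).
Proof.
have B0 : B x 0 = 0.
  by have := B_linear 1 0 0 x; rewrite scale1r addr0 mul1r => /eqP; rewrite -subr_eq subrr eq_sym => /eqP.
rewrite {1}(row_sum_delta y); elim/big_rec2: _ => [//|j r z _ IH].
by rewrite B_linear IH.
Qed.

(** Nondegeneracy says that the Gram matrix [G] has trivial kernel; the representing vector is c^T
    G^-1. *)
Lemma riesz (c : 'cV[R]_n) : exists x, forall y, B x y = (y *m c) 0 0.
Proof.
pose G : 'M[R]_n := \matrix_(i, j) B (delta_mx 0 i) (delta_mx 0 j).
have BG x y : B x y = (x *m G *m y^T) 0 0.
  rewrite bilinear_coord mxE; apply: eq_bigr => j _; rewrite mulrC [in RHS]mxE; congr (_ * _).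
    have B0 : B 0 (delta_mx 0 j) = 0.
      by have := B_linearl 1 0 0 (delta_mx 0 j); rewrite scale1r addr0 mul1r => /eqP; rewrite -subr_eq subrr eq_sym => /eqP.
    rewrite {1}(row_sum_delta x); elim/big_rec2: _ => [//|i r z _ IH].
    by rewrite B_linearl IH mxE.
  by rewrite mxE.
have uG : G \in unitmx.
  rewrite -row_free_unit -kermx_eq0; apply/eqP/row_matrixP => i; rewrite row0.
  apply/eqP; apply: contraT => /B_nondeg[y]; rewrite BG.
  have /sub_kermxP -> : (row i (kermx G) <= kermx G)%MS by exact: row_sub.
  by rewrite mul0mx mxE eqxx.
exists (c^T *m invmx G) => y; rewrite BG mulmxKV //.
by rewrite -trmx_mul [in LHS]mxE.
Qed.

(* If B^(l+1) = 0 and s is a list of 2l vectors, take a linear form u = B(z, .)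
   vanishing on s but not at x: evaluating (l+1) u /\ B^l = z _| B^(l+1) at
   x :: s gives B^l(s) = 0. *)
Lemma wpow_nonzero l : (2 * l <= n)%N -> exists s, wpow B l s != 0.
Proof.
move=> ln; apply: contrapT => /forallNP h0.
have {}h0 s : wpow B l s = 0 by apply/eqP; apply/negPn/negP; exact: h0.
elim: l ln h0 => [|l IH] ln h0.
  by have := h0 [::]; rewrite /wpow /seq_one /= => /eqP; rewrite oner_eq0.
apply: IH => [|s]; first by apply: leq_trans ln; rewrite leq_mul2l leqnSn.
have [ss|] := eqVneq (size s) (2 * l)%N; last exact: wpow_homog.
pose A : 'M[R]_(size s, n) := \matrix_i nth 0 s i.
have : kermx A^T != 0.
  rewrite kermx_eq0 /row_free mxrank_tr; apply/negP => /eqP rA.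
  by have := rank_leq_row A; rewrite rA ss leqNgt (leq_trans _ ln) // mulnS.
move=> /rowV0Pn[c /sub_kermxP cA c0].
have uA x : x \in s -> (x *m c^T) 0 0 = 0.
  move=> /(nthP 0)[i si <-]; have /matrixP/(_ 0 (Ordinal si)) := cA.
  rewrite -[c *m A^T]trmxK trmx_mul trmxK mxE.
  by rewrite [RHS]mxE => <-; rewrite !mxE; apply: eq_bigr => j _; rewrite !mxE.
have [x ux] : exists x : 'rV[R]_n, (x *m c^T) 0 0 != 0.
  have /rV0Pn[j cj] := c0; exists (delta_mx 0 j).
  by rewrite -rowE !mxE.
have [z Bz] := riesz c^T.
have := h0 (z :: x :: s); rewrite wpow_cons => /eqP.
rewrite mulf_eq0 pnatr_eq0 /= wedge0l; last by move=> y ys; rewrite Bz uA.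
by rewrite subr0 mulf_eq0 Bz (negbTE ux) /= => /eqP.
Qed.

End Nondegenerate.

(** * Forms on matrices, determinants, and the passage between matrices and lists *)

Section TopForms.
Context {R : realType}.

Section AnyDegree.
Variables (p n : nat) (F : 'M[R]_(p, n) -> R).
Hypotheses (Fl : multilinear_rows F) (Fa : alternating_rows F).

Definition set_row (A : 'M[R]_(p, n)) i v := \matrix_k (if k == i then v else row k A).

Lemma multilinear_set_row A i b c v w :
  F (set_row A i (b *: v + c *: w)) = b * F (set_row A i v) + c * F (set_row A i w).
Proof.
apply: (Fl (i := i)); first by rewrite !rowK eqxx.
all: by apply/row_matrixP => k; rewrite !row_rowsub !rowK eq_sym (negbTE (neq_lift _ _)).
Qed.

Lemma multilinear_set_row0 A i : F (set_row A i 0) = 0.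
Proof.
by have := multilinear_set_row A i 0 0 0 0; rewrite !scale0r addr0 !mul0r addr0.
Qed.

Lemma multilinear_set_row_sum A i I (r : seq I) (c : I -> R) (v : I -> 'rV[R]_n) :
  F (set_row A i (\sum_(j <- r) c j *: v j)) = \sum_(j <- r) c j * F (set_row A i (v j)).
Proof.
elim: r => [|j r IH]; first by rewrite !big_nil multilinear_set_row0.
by rewrite !big_cons -IH -[X in set_row A i (_ + X)]scale1r multilinear_set_row mul1r.
Qed.

(** Polarization: with the sum of rows [i] and [j] in both places [F] vanishes, and in the expansion
    the two terms with equal rows vanish too. *)
Lemma alternating_xrow A i j : i != j -> F (xrow i j A) = - F A.
Proof.
move=> ij; pose S v w := set_row (set_row A i v) j w.
have Sl b c v w x : F (S (b *: v + c *: w) x) = b * F (S v x) + c * F (S w x).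
  have e u : S u x = set_row (set_row A j x) i u.
    apply/row_matrixP => k; rewrite !rowK; case: eqP => [->|]; last by case: eqP.
    by rewrite eq_sym (negbTE ij).
  by rewrite !e multilinear_set_row.
have Sr b c v w x : F (S x (b *: v + c *: w)) = b * F (S x v) + c * F (S x w).
  exact: multilinear_set_row.
have S0 v : F (S v v) = 0.
  by apply: (Fa ij); rewrite !rowK eqxx (negbTE ij) eqxx.
have := S0 (1 *: row i A + 1 *: row j A).
rewrite Sl !Sr !S0 !mul1r add0r addr0 => /eqP; rewrite addr_eq0 => /eqP E.
have EA : A = S (row i A) (row j A).
  apply/row_matrixP => k; rewrite !rowK; case: eqP => [-> //|_].
  by case: eqP => [->|].
rewrite {2}EA E opprK; congr F; apply/row_matrixP => k; rewrite !rowK.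
apply/rowP => l; rewrite !mxE; case: tpermP => [->|->|].
  by rewrite (negbTE ij) eqxx mxE.
  by rewrite eqxx mxE.
by move=> /eqP/negbTE ki /eqP/negbTE kj; rewrite kj ki mxE.
Qed.

Lemma alternating_row_perm A (s : 'S_p) : F (row_perm s A) = (-1) ^+ s * F A.
Proof.
have [ts -> dts] := prod_tpermP s; rewrite odd_perm_prod //.
elim: ts dts => [|t ts IH] /=; first by rewrite big_nil row_perm1 mul1r.
move=> /andP[dt /IH {}IH]; rewrite big_cons row_permM.
rewrite -[row_perm (tperm _ _) _]/(xrow t.1 t.2 _) alternating_xrow // IH.
by rewrite signrN mulNr.
Qed.

End AnyDegree.

(** Induction on the number of rows: the first row is expanded in the canonical basis, the others by
    the induction hypothesis for the form with that row fixed; [glue] reassembles the index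
    functions. *)
Lemma multilinear_expand p n (F : 'M[R]_(p, n) -> R) A : multilinear_rows F ->
  F A = \sum_(J : {ffun 'I_p -> 'I_n})
    (\prod_i A i (J i)) * F (\matrix_i delta_mx 0 (J i)).
Proof.
elim: p F A => [|p IH] F A Fl.
  rewrite (bigD1 [ffun i : 'I_0 => False_rect _ (notF (ltn_ord i))]) //=.
  rewrite big_ord0 mul1r [X in _ + X]big1 ?addr0.
    by congr F; apply/matrixP => -[].
  by move=> J /eqP []; apply/ffunP => -[].
pose cons v (B : 'M[R]_(p, n)) : 'M[R]_(p.+1, n) :=
  \matrix_i (if unlift ord0 i is Some j then row j B else v).
have cons_set v B w : cons v B = set_row (cons w B) ord0 v.
  apply/row_matrixP => i; rewrite !rowK; case: unliftP => [j|] ->.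
    by rewrite eq_sym (negbTE (neq_lift _ _)).
  by rewrite eqxx.
have Fl' v : multilinear_rows (fun B => F (cons v B)).
  move=> B C D i b c e1 e2 e3; apply: (Fl _ _ _ (lift ord0 i)).
    by rewrite !rowK liftK.
    apply/row_matrixP => k; rewrite !row_rowsub !rowK; case: unliftP => // j ej.
    have ji : j != i by apply: contraTneq isT => eji; move: (neq_lift (lift ord0 i) k); rewrite ej eji eqxx.
    by apply/rowP => l; rewrite !mxE; exact: (row'_eq e2).
  apply/row_matrixP => k; rewrite !row_rowsub !rowK; case: unliftP => // j ej.
  have ji : j != i by apply: contraTneq isT => eji; move: (neq_lift (lift ord0 i) k); rewrite ej eji eqxx.
  by apply/rowP => l; rewrite !mxE; exact: (row'_eq e3).
have EA : A = cons (row ord0 A) (row' ord0 A).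
  apply/row_matrixP => i; rewrite rowK; case: unliftP => [j|] -> //.
  by rewrite row_rowsub.
have -> : F A = \sum_j \sum_(J : {ffun 'I_p -> 'I_n}) A ord0 j *
    ((\prod_i A (lift ord0 i) (J i)) * F (cons (delta_mx 0 j) (\matrix_i delta_mx 0 (J i)))).
  rewrite {1}EA (cons_set _ _ 0) [row ord0 A]row_sum_delta multilinear_set_row_sum //.
  apply: eq_bigr => j _; rewrite -cons_set mxE (IH (fun B => F (cons (delta_mx 0 j) B))) // mulr_sumr.
  by apply: eq_bigr => J _; congr (_ * (_ * _)); apply: eq_bigr => i _; rewrite !mxE.
rewrite pair_big /=.
pose glue (q : 'I_n * {ffun 'I_p -> 'I_n}) : {ffun 'I_p.+1 -> 'I_n} :=
  [ffun i => if unlift ord0 i is Some j then q.2 j else q.1].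
rewrite [RHS](reindex glue); last first.
  exists (fun J : {ffun 'I_p.+1 -> 'I_n} => (J ord0, [ffun i => J (lift ord0 i)])) => [[j J] _|J _].
    rewrite /glue ffunE unlift_none; congr (_, _); apply/ffunP => i.
    by rewrite !ffunE liftK.
  by apply/ffunP => i; rewrite ffunE /=; case: unliftP => [k|] ->; rewrite ?ffunE.
apply: eq_bigr => -[j J] _; rewrite big_ord_recl /= mulrA; congr (_ * _ * F _).
  by rewrite ffunE unlift_none.
  by apply: eq_bigr => i _; rewrite ffunE liftK.
apply/row_matrixP => i; rewrite !rowK ffunE; case: unliftP => [k|] _ //.
by rewrite rowK.
Qed.

(** Leibniz's formula: in the expansion over index functions, those that are not injective repeat a
    row and contribute 0, and the permutations contribute their sign. Jacobian determinants enter
    changes of charts through this lemma. *)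
Lemma top_form_det n (F : 'M[R]_n -> R) A :
  multilinear_rows F -> alternating_rows F -> F A = \det A * F 1%:M.
Proof.
move=> Fl Fa; rewrite (multilinear_expand A Fl).
rewrite (bigID (fun f : {ffun 'I_n -> 'I_n} => injectiveb f)) /= addrC big1 ?add0r => [|f Uf].
  rewrite (reindex (@pval _)) /=; last first.
    pose in_Sn := insubd (1%g : 'S_n).
    by exists in_Sn => /= f Uf; first apply: val_inj; apply: insubdK.
  rewrite big_distrl /=; apply: eq_big => /= [s | s _]; rewrite ?(valP s) //.
  rewrite -mulrA mulrCA; congr (_ * _); rewrite ?pvalE //.
  rewrite -(alternating_row_perm Fl Fa 1%:M s); congr F.
  by apply/matrixP => i j; rewrite !mxE eqxx eq_sym.
case/injectivePn: Uf => i1 [i2 Di12 Ef12].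
by rewrite (Fa _ _ _ Di12) ?mulr0 // !rowK Ef12.
Qed.

Section Rows.
Variable n : nat.
Implicit Types (s : seq 'rV[R]_n).

Definition rows p (A : 'M[R]_(p, n)) : seq 'rV[R]_n := [seq row i A | i <- enum 'I_p].

Definition of_rows p s : 'M[R]_(p, n) := \matrix_(i < p) nth 0 s i.

Lemma size_rows p (A : 'M[R]_(p, n)) : size (rows A) = p.
Proof. by rewrite size_map size_enum_ord. Qed.

Lemma nth_rows p (A : 'M[R]_(p, n)) (i : 'I_p) : nth 0 (rows A) i = row i A.
Proof. by rewrite (nth_map i) ?size_enum_ord // nth_ord_enum. Qed.

Lemma rowsK p (A : 'M[R]_(p, n)) : of_rows p (rows A) = A.
Proof. by apply/row_matrixP => i; rewrite rowK nth_rows. Qed.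

Lemma of_rowsK p s : size s = p -> rows (of_rows p s) = s.
Proof.
move=> sp; apply: (@eq_from_nth _ 0); first by rewrite size_rows.
by move=> i; rewrite size_rows => ip; rewrite (nth_rows _ (Ordinal ip)) rowK.
Qed.

Lemma rows_cons p (A : 'M[R]_(p.+1, n)) : rows A = row 0 A :: rows (row' 0 A).
Proof.
rewrite /rows enum_ordSl /= -map_comp; congr cons; apply: eq_map => i.
by rewrite /= row_rowsub.
Qed.

Lemma rows_mulmx p m (A : 'M[R]_(p, m)) (G : 'M[R]_(m, n)) :
  rows (A *m G) = [seq v *m G | v <- [seq row i A | i <- enum 'I_p]].
Proof. by rewrite -map_comp; apply: eq_map => i /=; rewrite row_mul. Qed.

Lemma rows_split p (A B : 'M[R]_(p, n)) i : row' i A = row' i B ->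
  rows B = take i (rows A) ++ row i B :: drop i.+1 (rows A).
Proof.
move=> e; have ip : (i < size (rows A))%N by rewrite size_rows.
apply: (@eq_from_nth _ 0).
  by rewrite size_cat /= size_drop size_takel ?(ltnW ip) // !size_rows addnS -addSn subnKC.
move=> j; rewrite size_rows => jp; rewrite nth_cat size_takel ?(ltnW ip) //.
rewrite (nth_rows _ (Ordinal jp)).
have [ji|ij|ji] := ltngtP j i.
  rewrite nth_take // (nth_rows _ (Ordinal jp)); apply/rowP => l; rewrite !mxE.
  by rewrite (row'_eq e) // inE -val_eqE /= neq_ltn ji.
  rewrite -[(j - i)%N]prednK ?subn_gt0 //= nth_drop.
  have -> : (i.+1 + (j - i).-1 = j)%N by rewrite addSn -addnS prednK ?subn_gt0 // subnKC // ltnW.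
  rewrite (nth_rows _ (Ordinal jp)); apply/rowP => l; rewrite !mxE.
  by rewrite (row'_eq e) // inE -val_eqE /= neq_ltn ij orbT.
by rewrite [X in nth 0 _ X](_ : _ = 0%N) ?ji ?subnn //=; congr (row _ _); apply: val_inj.
Qed.

Lemma rows_splitE p (A : 'M[R]_(p, n)) (i : 'I_p) :
  rows A = take i (rows A) ++ row i A :: drop i.+1 (rows A).
Proof. exact: rows_split. Qed.

Lemma multilinear_rowsP p (a : seq 'rV[R]_n -> R) : seq_linear a ->
  multilinear_rows (fun A : 'M[R]_(p, n) => a (rows A)).
Proof.
move=> ha A B C i b c e e1 e2.
have a0 s1 s2 : a (s1 ++ 0 :: s2) = 0.
  by have := ha s1 s2 (-1) 0 0; rewrite scaler0 addr0 mulN1r addNr.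
rewrite (rows_splitE A i) (rows_split e1) (rows_split e2) e.
by rewrite ha -[c *: _]addr0 ha a0 addr0.
Qed.

(** Adjacent transpositions bring both copies of [x] side by side, where antisymmetry says that the
    value equals its opposite. *)
Lemma seq_antisym_dup (a : seq 'rV[R]_n -> R) s1 s2 s3 x : seq_antisym a ->
  a (s1 ++ x :: s2 ++ x :: s3) = 0.
Proof.
move=> ha; elim: s2 s1 => [|z s2 IH] s1 /=.
  by have /eqP := ha s1 s3 x x; rewrite -addr_eq0 -mulr2n mulrn_eq0 => /eqP.
rewrite ha; have -> : s1 ++ z :: x :: s2 ++ x :: s3 = rcons s1 z ++ x :: s2 ++ x :: s3.
  by rewrite cat_rcons.
by rewrite IH oppr0.
Qed.

Lemma alternating_rowsP p (a : seq 'rV[R]_n -> R) : seq_antisym a ->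
  alternating_rows (fun A : 'M[R]_(p, n) => a (rows A)).
Proof.
move=> ha A i j; wlog ij : i j / (i < j)%N => [h|_ e].
  rewrite neq_ltn => /orP[ij e|ij e]; first by apply: h e => //; rewrite neq_ltn ij.
  by apply: (h j i ij); rewrite ?e // neq_ltn ij.
rewrite (rows_splitE A i).
have -> : drop i.+1 (rows A) = take (j - i.+1) (drop i.+1 (rows A)) ++
    row i A :: drop j.+1 (rows A).
  rewrite -{1}(cat_take_drop (j - i.+1) (drop i.+1 (rows A))) drop_drop subnK //.
  by rewrite [drop j _](drop_nth 0) ?size_rows // nth_rows e.
exact: seq_antisym_dup.
Qed.

(** Leads from matrix forms back to list forms; the default value 0 makes the result homogeneous of
    degree [p]. *)
Definition form_of p (F : 'M[R]_(p, n) -> R) s : R :=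
  if size s == p then F (of_rows p s) else 0.

Lemma form_of_rows p (F : 'M[R]_(p, n) -> R) A : form_of F (rows A) = F A.
Proof. by rewrite /form_of size_rows eqxx rowsK. Qed.

Lemma form_of_homog p (F : 'M[R]_(p, n) -> R) : seq_homog p (form_of F).
Proof. by move=> s /negbTE sp; rewrite /form_of sp. Qed.

Lemma row'_of_rows p s1 s2 x y (i : 'I_p) : i = size s1 :> nat ->
  row' i (of_rows p (s1 ++ x :: s2)) = row' i (of_rows p (s1 ++ y :: s2)).
Proof.
move=> ip; apply/row_matrixP => k; rewrite !row_rowsub !rowK !nth_cat.
have : lift i k != i :> nat by rewrite eq_sym; have := neq_lift i k.
rewrite -ip; case: ltngtP => // h _.
by case: (_ - _)%N (subn_gt0 i (lift i k)); rewrite ?h.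
Qed.

Lemma form_of_linear p (F : 'M[R]_(p, n) -> R) :
  multilinear_rows F -> seq_linear (form_of F).
Proof.
move=> hF s1 s2 c x y; rewrite /form_of !size_cat /=.
case: eqP => [sp|]; last by rewrite mulr0 addr0.
have ip : (size s1 < p)%N by rewrite -sp addnS ltnS leq_addr.
have rE z : row (Ordinal ip) (of_rows p (s1 ++ z :: s2)) = z.
  by rewrite rowK nth_cat /= ltnn subnn.
rewrite (hF _ (of_rows p (s1 ++ x :: s2)) (of_rows p (s1 ++ y :: s2)) (Ordinal ip) c 1).
  by rewrite mul1r.
  by rewrite !rE scale1r.
  exact: row'_of_rows.
exact: row'_of_rows.
Qed.

Lemma form_of_antisym p (F : 'M[R]_(p, n) -> R) :
  multilinear_rows F -> alternating_rows F -> seq_antisym (form_of F).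
Proof.
move=> Fl Fa s1 s2 x y; rewrite /form_of !size_cat /=.
case: eqP => [sp|]; last by rewrite oppr0.
have ip : (size s1 < p)%N by rewrite -sp addnS ltnS leq_addr.
have jp : ((size s1).+1 < p)%N by rewrite -sp !addnS !ltnS leq_addr.
have ij : Ordinal ip != Ordinal jp by rewrite -val_eqE /= neq_ltn ltnSn.
rewrite -(alternating_xrow Fl Fa _ ij); congr F.
apply/matrixP => k l; rewrite !mxE; congr ((_ : 'rV[R]_n) 0 l).
case: tpermP => [->|->|/eqP/negbTE ki /eqP/negbTE kj] /=.
  by rewrite !nth_cat /= ltnn subnn ltnNge leqnSn subSnn.
  by rewrite !nth_cat /= ltnn subnn ltnNge leqnSn subSnn.
rewrite !nth_cat; case: ltngtP => // h; last by move: ki; rewrite -val_eqE /= h eqxx.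
have : k != (size s1).+1 :> nat by rewrite -[X in _ != X]/(val (Ordinal jp)) val_eqE kj.
case E : (k - size s1)%N => [|[|m]] //=.
  by move/eqP: E; rewrite subn_eq0 leqNgt h.
by rewrite -(subnKC (ltnW h)) E addn1 eqxx.
Qed.

End Rows.

End TopForms.

(** * The exterior derivative *)

Section ExteriorDerivative.
Context {R : realType} {V : normedModType R}.
Implicit Types (A : V -> seq V -> R) (s t : seq V).

(* Cartan's formula for a constant vector field x: x _| dA = D_x A - d(x _| A). *)
Fixpoint dseq A y s : R :=
  if s is x :: t then 'D_x (fun z => A z t) y - dseq (fun z t => A z (x :: t)) y t
  else 0.

Lemma near_eq_dseq A A' y s : (\near y, forall t, A y t = A' y t) ->
  dseq A y s = dseq A' y s.
Proof.
elim: s A A' => //= x s IH A A' AA'; congr (_ - _).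
  by apply: near_eq_derive; apply: filterS AA' => z; exact.
by apply: IH; apply: filterS AA' => z h t; exact: h.
Qed.

Lemma eq_dseq A A' y s : (forall y t, A y t = A' y t) -> dseq A y s = dseq A' y s.
Proof. by move=> h; apply: near_eq_dseq; exact: nearW. Qed.

Definition diff_at A y := forall t, differentiable (fun z => A z t) y.

Lemma diff_at_cons A x y : diff_at A y -> diff_at (fun z t => A z (x :: t)) y.
Proof. by move=> h t; exact: h. Qed.

Lemma derive_scale (f g : V -> R) y x : differentiable f y -> differentiable g y ->
  'D_x (fun z => f z * g z) y = f y * 'D_x g y + g y * 'D_x f y.
Proof.
move=> df dg.
by rewrite -[fun z => f z * g z]/(f * g) deriveM //; exact: diff_derivable.
Qed.

Lemma derive_add (f g : V -> R) y x : differentiable f y -> differentiable g y ->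
  'D_x (fun z => f z + g z) y = 'D_x f y + 'D_x g y.
Proof.
move=> df dg.
by rewrite -[fun z => f z + g z]/(f + g) deriveD //; exact: diff_derivable.
Qed.

Lemma derive_sub (f g : V -> R) y x : differentiable f y -> differentiable g y ->
  'D_x (fun z => f z - g z) y = 'D_x f y - 'D_x g y.
Proof.
move=> df dg.
by rewrite -[fun z => f z - g z]/(f - g) deriveB //; exact: diff_derivable.
Qed.

Lemma derive_opp (f : V -> R) y x : differentiable f y ->
  'D_x (fun z => - f z) y = - 'D_x f y.
Proof.
by move=> df; rewrite -[fun z => - f z]/(- f) deriveN //; exact: diff_derivable.
Qed.

Lemma derive_sumr I (r : seq I) (f : I -> V -> R) y x :
  (forall i, differentiable (f i) y) ->
  'D_x (fun z => \sum_(i <- r) f i z) y = \sum_(i <- r) 'D_x (f i) y /\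
  differentiable (fun z => \sum_(i <- r) f i z) y.
Proof.
move=> df; elim: r => [|i r [IH1 IH2]].
  rewrite big_nil (_ : (fun z => _) = cst 0); last by apply/funext => z; rewrite big_nil.
  by split; [exact: derive_cst|exact: differentiable_cst].
rewrite big_cons (_ : (fun z => _) = (fun z => f i z + \sum_(i <- r) f i z)).
  split; last exact: differentiableD.
  by rewrite derive_add // IH1.
by apply/funext => z; rewrite big_cons.
Qed.

Lemma dseqD A A' y s : diff_at A y -> diff_at A' y ->
  dseq (fun z t => A z t + A' z t) y s = dseq A y s + dseq A' y s.
Proof.
elim: s A A' => [|x s IH] A A' hA hA' /=; first by rewrite addr0.
rewrite (derive_add x (hA s) (hA' s)) IH; [|exact: diff_at_cons..].
by rewrite opprD addrACA.
Qed.

Lemma dseqN A y s : diff_at A y -> dseq (fun z t => - A z t) y s = - dseq A y s.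
Proof.
elim: s A => [|x s IH] A hA /=; first by rewrite oppr0.
rewrite (derive_opp x (hA s)) IH; last exact: diff_at_cons.
by rewrite opprD opprK.
Qed.

Lemma dseq0 y s : dseq (fun _ _ => 0) y s = 0.
Proof. by elim: s => //= x s ->; rewrite derive_cst subr0. Qed.

Lemma dseq_sum I (r : seq I) (A : I -> V -> seq V -> R) y s :
  (forall i, diff_at (A i) y) ->
  dseq (fun z t => \sum_(i <- r) A i z t) y s = \sum_(i <- r) dseq (A i) y s.
Proof.
move=> hA; elim: r => [|i r IH].
  by rewrite big_nil -[RHS](dseq0 y s); apply: eq_dseq => z t; rewrite big_nil.
rewrite big_cons -IH -dseqD //; first by apply: eq_dseq => z t; rewrite big_cons.
by move=> t; have [_] := derive_sumr r 0 (fun i => hA i t).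
Qed.

Lemma dseq_scale (f : V -> R) A y s : differentiable f y -> diff_at A y ->
  dseq (fun z t => f z * A z t) y s =
  wedge (fun x => 'D_x f y) (A y) s + f y * dseq A y s.
Proof.
move=> df; elim: s A => [|x s IH] A hA /=; first by rewrite mulr0 addr0.
rewrite (derive_scale x df (hA s)) IH; last exact: diff_at_cons.
move: ('D_x _ y) ('D_x _ y) (wedge _ _ _) (dseq _ _ _) => a b c d; ring.
Qed.

Lemma diff_wedge (u : V -> V -> R) A s y :
  (forall x, differentiable (fun z => u z x) y) -> diff_at A y ->
  differentiable (fun z => wedge (u z) (A z) s) y.
Proof.
move=> hu; elim: s A => [|x s IH] A hA /=; first exact: differentiable_cst.
apply: differentiableB; first exact: differentiableM.
by apply: IH; exact: diff_at_cons.
Qed.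

Lemma derive_wedge (u : V -> V -> R) A y s v :
  (forall x, differentiable (fun z => u z x) y) -> diff_at A y ->
  'D_v (fun z => wedge (u z) (A z) s) y =
  wedge (fun x => 'D_v (fun z => u z x) y) (A y) s +
  wedge (u y) (fun t => 'D_v (fun z => A z t) y) s.
Proof.
move=> hu; elim: s A => [|x s IH] A hA /=; first by rewrite derive_cst addr0.
have h1 : differentiable (fun z => u z x * A z s) y by exact: differentiableM.
have h2 := diff_wedge s hu (diff_at_cons x hA).
rewrite (derive_sub v h1 h2) (derive_scale v (hu x) (hA s)) IH; last exact: diff_at_cons.
move: ('D_v _ y) ('D_v _ y) (wedge _ _ _) (wedge _ _ _) => p q a b; ring.
Qed.

Lemma diff_wedge2 (B : V -> V -> V -> R) A s y :
  (forall x x', differentiable (fun z => B z x x') y) -> diff_at A y ->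
  differentiable (fun z => wedge2 (B z) (A z) s) y.
Proof.
move=> hB; elim: s A => [|x s IH] A hA /=; first exact: differentiable_cst.
apply: differentiableD; first exact: diff_wedge.
by apply: IH; exact: diff_at_cons.
Qed.

Lemma derive_wedge2 (B : V -> V -> V -> R) A y s v :
  (forall x x', differentiable (fun z => B z x x') y) -> diff_at A y ->
  'D_v (fun z => wedge2 (B z) (A z) s) y =
  wedge2 (fun x x' => 'D_v (fun z => B z x x') y) (A y) s +
  wedge2 (B y) (fun t => 'D_v (fun z => A z t) y) s.
Proof.
move=> hB; elim: s A => [|x s IH] A hA /=; first by rewrite derive_cst addr0.
have h1 := diff_wedge s (hB x) hA.
have h2 := diff_wedge2 s hB (diff_at_cons x hA).
rewrite (derive_add v h1 h2) (derive_wedge s v (hB x) hA) IH; last exact: diff_at_cons.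
by rewrite addrACA.
Qed.

(** The graded Leibniz rule d(u /\ A) = du /\ A - u /\ dA: the 2-form given to [wedge2] is du,
    written out on constant vector fields. *)
Lemma dseq_wedge (u : V -> V -> R) A y s :
  (forall x, differentiable (fun z => u z x) y) -> diff_at A y ->
  dseq (fun z => wedge (u z) (A z)) y s =
  wedge2 (fun x x' => 'D_x (fun z => u z x') y - 'D_x' (fun z => u z x) y) (A y) s -
  wedge (u y) (dseq A y) s.
Proof.
move=> hu; elim: s A => [|x s IH] A hA /=; first by rewrite subr0.
rewrite derive_wedge //.
have -> : dseq (fun z t => u z x * A z t - wedge (u z) (fun t => A z (x :: t)) t) y s =
    wedge (fun x' => 'D_x' (fun z => u z x) y) (A y) s + u y x * dseq A y s -
    dseq (fun z => wedge (u z) (fun t => A z (x :: t))) y s.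
  rewrite -dseq_scale // -dseqN.
    rewrite -dseqD //.
      by move=> t; exact: differentiableM.
    by move=> t; apply: differentiableN; apply: diff_wedge => //; exact: diff_at_cons.
  by move=> t; apply: diff_wedge => //; exact: diff_at_cons.
rewrite IH; last exact: diff_at_cons.
have -> : wedge (fun x' => 'D_x (fun z => u z x') y - 'D_x' (fun z => u z x) y) (A y) s =
    wedge (fun x' => 'D_x (fun z => u z x') y) (A y) s -
    wedge (fun x' => 'D_x' (fun z => u z x) y) (A y) s.
  rewrite -mulN1r addrC -wedgeDl; apply: eq_wedge => // x'.
  by rewrite mulN1r addrC.
have -> : wedge (u y) (fun t => 'D_x (fun z => A z t) y - dseq (fun z t => A z (x :: t)) y t) s =
   wedge (u y) (fun t => 'D_x (fun z => A z t) y) s -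
   wedge (u y) (dseq (fun z t => A z (x :: t)) y) s.
  rewrite -[- wedge _ _ _]mulN1r addrC -wedgeDr; apply: eq_wedge => // t.
  by rewrite mulN1r addrC.
move: (wedge _ _ _) (wedge _ _ _) (wedge _ _ _) (wedge _ _ _) (wedge2 _ _ _) (dseq _ _ _).
by move=> a b c d e f; ring.
Qed.

Lemma dseq_wedge2 (B : V -> V -> V -> R) A y s :
  (forall x x', differentiable (fun z => B z x x') y) -> diff_at A y ->
  (forall x x' x'', 'D_x (fun z => B z x' x'') y - 'D_x' (fun z => B z x x'') y +
     'D_x'' (fun z => B z x x') y = 0) ->
  dseq (fun z => wedge2 (B z) (A z)) y s = wedge2 (B y) (dseq A y) s.
Proof.
move=> hB hA dB; elim: s A hA => [|x s IH] A hA //=.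
rewrite derive_wedge2 //.
have -> : dseq (fun z t => wedge (B z x) (A z) t + wedge2 (B z) (fun t => A z (x :: t)) t) y s =
    dseq (fun z => wedge (B z x) (A z)) y s +
    dseq (fun z => wedge2 (B z) (fun t => A z (x :: t))) y s.
  rewrite dseqD //; first by move=> t; exact: diff_wedge.
  by move=> t; apply: diff_wedge2 => //; exact: diff_at_cons.
rewrite IH; last exact: diff_at_cons.
rewrite (dseq_wedge _ (hB x) hA).
(* Cartan's formula: since dB = 0, the exterior derivative of x _| B is the directional derivative
   D_x B, and the result cancels the term produced by [derive_wedge2]. *)
have -> : wedge2 (fun x0 x' => 'D_x0 (fun z => B z x x') y - 'D_x' (fun z => B z x x0) y) (A y) s =
    wedge2 (fun x0 x' => 'D_x (fun z => B z x0 x') y) (A y) s.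
  apply: eq_wedge2 => // x0 x'; apply/esym/eqP; rewrite -subr_eq0 opprB addrA.
  by rewrite -(dB x x0 x') addrAC.
have -> : wedge2 (B y) (fun t => 'D_x (fun z => A z t) y - dseq (fun z t => A z (x :: t)) y t) s =
   wedge2 (B y) (fun t => 'D_x (fun z => A z t) y) s -
   wedge2 (B y) (dseq (fun z t => A z (x :: t)) y) s.
  rewrite -[- wedge2 _ _ _]mulN1r addrC -wedge2Dr; apply: eq_wedge2 => // t.
  by rewrite mulN1r addrC.
move: (wedge _ _ _) (wedge2 _ _ _) (wedge2 _ _ _) (wedge2 _ _ _) => a b c d; ring.
Qed.

End ExteriorDerivative.

(** * Naturality of the exterior derivative *)

Section Pullback.
Context {R : realType} {n m : nat}.
Variables (Phi : 'rV[R]_n -> 'rV[R]_m).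

Definition pull (A : 'rV[R]_m -> seq 'rV[R]_m -> R) z s :=
  A (Phi z) [seq 'D_v Phi z | v <- s].

Lemma derive_chain (W : normedModType R) (g : 'rV[R]_m -> W) z v :
  differentiable Phi z -> differentiable g (Phi z) ->
  'D_v (fun y => g (Phi y)) z = 'D_('D_v Phi z) g (Phi z).
Proof.
move=> df dg; rewrite (deriveE _ df) (deriveE _ dg).
by rewrite -[fun y => _]/(g \o Phi) (deriveE _ (differentiable_comp df dg)) (diff_comp df dg).
Qed.

Lemma seq_linear_sum (a : seq 'rV[R]_m -> R) (w : 'rV[R]_m) t : seq_linear a ->
  a (w :: t) = \sum_k w 0 k * a (delta_mx 0 k :: t).
Proof.
move=> ha; rewrite {1}(row_sum_delta w).
have a0 : a (0 :: t) = 0.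
  by have := ha [::] t (-1) 0 0; rewrite scaler0 addr0 mulN1r addNr.
elim/big_rec2: _ => [//|k r z _ <-]; exact: (ha [::]).
Qed.

Variables (U : set 'rV[R]_n) (O : set 'rV[R]_m) (x : 'rV[R]_n).
Hypotheses (oU : open U) (oO : open O) (Phi2 : Ck_on 2 U Phi).
Hypotheses (UO : forall z, U z -> O (Phi z)) (Ux : U x).

Let dPhi z : U z -> differentiable Phi z.
Proof. by have [h _] := Ck_onSP Phi2; exact: h. Qed.

Let nU : \forall z \near x, U z.
Proof. exact: open_nbhs_nbhs. Qed.

Let nO : \forall y \near Phi x, O y.
Proof. by apply: open_nbhs_nbhs; split=> //; exact: UO. Qed.

Let J v := 'D_v Phi x.
Let W k w z : R := ('D_w Phi z : 'rV[R]_m) 0 k.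
Let Bk k v w := 'D_v (W k w) x.
Let B v w : 'rV[R]_m := \row_k Bk k v w.

Let dW k w : differentiable (W k w) x.
Proof.
have [_ /(_ w) h] := Ck_onSP Phi2; have [h' _] := Ck_onSP h.
by move/differentiable_mxP: (h' x Ux); apply.
Qed.

Let B_sym v w : B v w = B w v.
Proof.
suff h k : Bk k v w = Bk k w v by apply: eq_mx => _ k; exact: h.
have h : Ck_on 2 U (fun z => Phi z 0 k) by move/(Ck_mxP 2 _ oU): Phi2; apply.
have e u : \forall z \near x, 'D_u (fun z => Phi z 0 k) z = W k u z.
  apply: filterS nU => z Uz; rewrite /W.
  by rewrite (@derive_coord _ _ 1 m Phi) //; apply: diff_derivable; exact: dPhi.
by rewrite /Bk -(near_eq_derive _ (e w)) -(near_eq_derive _ (e v)); exact: derive_sym oU h Ux.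
Qed.

(* The contribution of the second derivatives of Phi to D_v (Phi^* b); it
   disappears from d(Phi^* b) because they are symmetric. *)
Fixpoint Kterm v (b : seq 'rV[R]_m -> R) s : R :=
  if s is w :: t then b (B v w :: map J t) + Kterm v (fun t => b (J w :: t)) t else 0.

Let eq_Kterm v b b' s : b =1 b' -> Kterm v b s = Kterm v b' s.
Proof.
by elim: s b b' => //= w s IH b b' e; rewrite e; congr (_ + _); apply: IH => t; exact: e.
Qed.

Let Kterm_sum v (c : 'I_m -> R) (b : 'I_m -> seq 'rV[R]_m -> R) s :
  Kterm v (fun t => \sum_k c k * b k t) s = \sum_k c k * Kterm v (b k) s.
Proof.
elim: s b => [|w s IH] b /=; first by rewrite big1 // => k _; rewrite mulr0.
rewrite (IH (fun k t => b k (J w :: t))) -big_split /=.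
by apply: eq_bigr => k _; rewrite mulrDr.
Qed.

(** Antisymmetry moves [B v w] to the head of the list, which produces the signs of [wedge]; by
    [B_sym] the 1-forms obtained are the differentials w |-> D_w (W k v). *)
Let Kterm_wedge v b s : seq_linear b -> seq_antisym b ->
  Kterm v b s = \sum_k wedge (fun w => Bk k w v) (fun t => b (delta_mx 0 k :: map J t)) s.
Proof.
elim: s b => [|w s IH] b bl ba /=; first by rewrite big1.
rewrite (seq_linear_sum _ _ bl) IH; [|exact: seq_linear_cons|exact: seq_antisym_cons].
rewrite -big_split /=; apply: eq_bigr => k _.
rewrite [B v w]B_sym mxE; congr (_ + _); rewrite -wedgeNr.
by apply: eq_wedge => // t; rewrite /= (ba [::]).
Qed.

Definition regular_on A := [/\ forall y, O y -> seq_linear (A y),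
  forall y, O y -> seq_antisym (A y) & forall y, O y -> diff_at A y].

Let regular_cons A w : regular_on A -> regular_on (fun y t => A y (w :: t)).
Proof.
move=> [h1 h2 h3]; split=> y Oy.
  by apply: seq_linear_cons; exact: h1.
  by apply: seq_antisym_cons; exact: h2.
by apply: diff_at_cons; exact: h3.
Qed.

Let pull_cons A w z t : regular_on A -> U z ->
  pull A z (w :: t) = \sum_k W k w z * pull (fun y t => A y (delta_mx 0 k :: t)) z t.
Proof. by move=> [h1 _ _] Uz; rewrite /pull /= seq_linear_sum //; apply: h1; exact: UO. Qed.

Let near_cons A w t : regular_on A -> \forall y \near Phi x,
  A y (w :: t) = \sum_k w 0 k * A y (delta_mx 0 k :: t).
Proof.
by move=> [h1 _ _]; apply: filterS nO => y Oy; rewrite seq_linear_sum //; exact: h1.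
Qed.

Let near_pull_cons A w : regular_on A -> \forall z \near x, forall t,
  pull A z (w :: t) = \sum_k W k w z * pull (fun y t => A y (delta_mx 0 k :: t)) z t.
Proof. by move=> hA; apply: filterS nU => z Uz t; exact: pull_cons. Qed.

Let diff_pull A t : regular_on A -> differentiable (fun z => pull A z t) x.
Proof.
elim: t A => [|w t IH] A hA.
  have [_ _ h3] := hA.
  exact: (differentiable_comp (dPhi Ux) (h3 _ (UO Ux) [::])).
apply: (@near_eq_differentiable _ _ _
  (fun z => \sum_k W k w z * pull (fun y t => A y (delta_mx 0 k :: t)) z t)).
  by apply: filterS (near_pull_cons w hA) => z ->.
have h k : differentiable
    (fun z => W k w z * pull (fun y t => A y (delta_mx 0 k :: t)) z t) x.
  by apply: differentiableM; [exact: dW|apply: IH; exact: regular_cons].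
by have [_] := derive_sumr (index_enum 'I_m) 0 h.
Qed.

Let derive_pull A t v : regular_on A ->
  'D_v (fun z => pull A z t) x =
  'D_(J v) (fun y => A y (map J t)) (Phi x) + Kterm v (A (Phi x)) t.
Proof.
elim: t A => [|w t IH] A hA.
  have [_ _ h3] := hA.
  rewrite addr0; exact: (derive_chain v (dPhi Ux) (h3 _ (UO Ux) [::])).
have e : \forall z \near x, pull A z (w :: t) =
    \sum_k W k w z * pull (fun y t => A y (delta_mx 0 k :: t)) z t.
  by apply: filterS (near_pull_cons w hA) => z ->.
rewrite (near_eq_derive _ e).
have dk k : differentiable (fun z => pull (fun y t => A y (delta_mx 0 k :: t)) z t) x.
  by apply: diff_pull; exact: regular_cons.
have h k : differentiable
    (fun z => W k w z * pull (fun y t => A y (delta_mx 0 k :: t)) z t) x.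
  exact: differentiableM.
have [-> _] := derive_sumr (index_enum 'I_m) v h.
have [h1 h2 h3] := hA.
rewrite /= (seq_linear_sum _ _ (h1 _ (UO Ux))).
rewrite (near_eq_derive _ (near_cons (J w) (map J t) hA)).
have dA k : differentiable (fun y => (J w : 'rV[R]_m) 0 k * A y (delta_mx 0 k :: map J t)) (Phi x).
  by apply: differentiableM; [exact: differentiable_cst|exact: h3 (UO Ux) _].
have [-> _] := derive_sumr (index_enum 'I_m) (J v) dA.
rewrite (@eq_Kterm v _ (fun t => \sum_k (J w : 'rV[R]_m) 0 k * A (Phi x) (delta_mx 0 k :: t))).
  rewrite Kterm_sum -!big_split /=; apply: eq_bigr => k _.
  rewrite (derive_scale v (dW k w) (dk k)) IH; last exact: regular_cons.
  have -> : 'D_(J v) (fun y => (J w : 'rV[R]_m) 0 k * A y (delta_mx 0 k :: map J t)) (Phi x) =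
     (J w : 'rV[R]_m) 0 k * 'D_(J v) (fun y => A y (delta_mx 0 k :: map J t)) (Phi x).
    rewrite (derive_scale (J v) (differentiable_cst _ _) (h3 _ (UO Ux) _)) derive_cst.
    by rewrite mulr0 addr0.
  rewrite mxE /Bk /pull -/J -[W k w x]/((J w : 'rV[R]_m) 0 k).
  move: ('D_v _ x) ('D_(J v) _ _) (Kterm _ _ _) (A _ _) ((J w : 'rV[R]_m) 0 k).
  by move=> a b c d e'; ring.
by move=> t'; exact: seq_linear_sum (h1 _ (UO Ux)).
Qed.

(** Contracting Phi^* A with a constant field [v] gives the sum over k of the function [W k v] times
    the pull-back of e_k _| A. By the Leibniz rule its derivative contains the extra terms d(W k v)
    /\ ..., which are exactly the second-derivative terms of D_v (Phi^* A), so both cancel. *)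
Lemma dseq_pull A s : regular_on A ->
  dseq (pull A) x s = dseq A (Phi x) [seq 'D_v Phi x | v <- s].
Proof.
elim: s A => //= v s IH A hA; have [h1 h2 h3] := hA.
rewrite (derive_pull s v hA) (near_eq_dseq s (near_pull_cons v hA)) -/J.
have dk k : diff_at (pull (fun y t => A y (delta_mx 0 k :: t))) x.
  by move=> t; apply: diff_pull; exact: regular_cons.
rewrite dseq_sum; last by move=> k t; exact: (differentiableM (dW k v) (dk k t)).
have -> : dseq (fun y t => A y (J v :: t)) (Phi x) (map J s) =
    dseq (fun y t => \sum_k (J v : 'rV[R]_m) 0 k * A y (delta_mx 0 k :: t)) (Phi x) (map J s).
  apply: near_eq_dseq; apply: filterS nO => y Oy t.
  by rewrite seq_linear_sum //; exact: h1.
have dAk k : diff_at (fun y t => A y (delta_mx 0 k :: t)) (Phi x).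
  by move=> t; exact: h3 (UO Ux) _.
rewrite dseq_sum; last first.
  by move=> k t; exact: (differentiableM (differentiable_cst _ _) (dAk k t)).
rewrite Kterm_wedge; [|exact: h1 (UO Ux)|exact: h2 (UO Ux)].
rewrite -addrA; congr (_ + _); rewrite -!sumrN -big_split /=; apply: eq_bigr => k _.
rewrite (dseq_scale _ (dW k v) (dk k)).
rewrite (dseq_scale _ (differentiable_cst _ _) (dAk k)).
rewrite [X in _ = - (X + _)]wedge0l; last by move=> u _; exact: derive_cst.
rewrite IH; last exact: regular_cons.
rewrite /pull /Bk -/J -[W k v x]/((J v : 'rV[R]_m) 0 k).
by rewrite opprD addrA subrr !add0r.
Qed.

End Pullback.

(** * Lattice sums and change of variables *)

Section Lattice.
Context {R : realType} {n : nat}.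
Implicit Types (f g : 'rV[R]_n -> R) (x : 'rV[R]_n) (j : nat).

(* Sums over the lattice of mesh 1/(j+1) in the cube of half-width j+1 replace
   integrals; all statements are about their limits as j tends to infinity, so
   that no integral has to exist. *)
Definition grid_radius j := (j.+1 ^ 2)%N.
Definition grid j := {ffun 'I_n -> 'I_(2 * grid_radius j).+1}.

Definition grid_point j (z : grid j) : 'rV[R]_n :=
  \row_i (((z i)%:R - (grid_radius j)%:R) / j.+1%:R).

Definition grid_sum j f : R := j.+1%:R ^- n * \sum_(z : grid j) f (grid_point z).

Lemma eq_grid_sum j f g : f =1 g -> grid_sum j f = grid_sum j g.
Proof. by move=> fg; congr (_ * _); apply: eq_bigr => z _; exact: fg. Qed.

Lemma grid_sumD j f g : grid_sum j (fun x => f x + g x) = grid_sum j f + grid_sum j g.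
Proof. by rewrite /grid_sum big_split /= mulrDr. Qed.

Lemma grid_sumZ j c f : grid_sum j (fun x => c * f x) = c * grid_sum j f.
Proof. by rewrite /grid_sum -mulr_sumr mulrCA. Qed.

Lemma grid_sumB j f g : grid_sum j (fun x => f x - g x) = grid_sum j f - grid_sum j g.
Proof.
rewrite -[- grid_sum j g]mulN1r -grid_sumZ -grid_sumD; apply: eq_grid_sum => x.
by rewrite mulN1r.
Qed.

Lemma grid_sum0 j : grid_sum j (fun=> 0) = 0.
Proof. by rewrite /grid_sum big1 ?mulr0. Qed.

Lemma grid_sum_sum j I (r : seq I) (F : I -> 'rV[R]_n -> R) :
  grid_sum j (fun x => \sum_(i <- r) F i x) = \sum_(i <- r) grid_sum j (F i).
Proof. by rewrite /grid_sum exchange_big /= -mulr_sumr. Qed.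

Lemma grid_sum_le j f g : (forall x, f x <= g x) -> grid_sum j f <= grid_sum j g.
Proof.
move=> fg; apply: ler_wpM2l; first by rewrite invr_ge0 exprn_ge0.
by apply: ler_sum => z _; exact: fg.
Qed.

Lemma grid_sum_norm j f : `|grid_sum j f| <= grid_sum j (fun x => `|f x|).
Proof.
rewrite /grid_sum normrM ger0_norm ?invr_ge0 ?exprn_ge0 //.
by apply: ler_wpM2l; [rewrite invr_ge0 exprn_ge0|exact: ler_norm_sum].
Qed.

Lemma card_ord_le m a l (P : pred 'I_m) :
  (forall k : 'I_m, P k -> (a <= k < a + l)%N) -> (#|P| <= l)%N.
Proof.
move=> h; rewrite -(size_iota a l) cardE -(size_map val); apply: uniq_leq_size.
  by rewrite map_inj_uniq ?enum_uniq //; exact: val_inj.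
by move=> _ /mapP[k /[!mem_enum] Pk ->]; rewrite mem_iota; exact: h.
Qed.

Lemma card_ord_ge m a l (P : pred 'I_m) :
  (forall k, (a <= k < a + l)%N -> exists2 kP : (k < m)%N, true & P (Ordinal kP)) ->
  (l <= #|P|)%N.
Proof.
move=> h; rewrite -[leqLHS](size_iota a l) cardE -(size_map val); apply: uniq_leq_size.
  exact: iota_uniq.
move=> k; rewrite mem_iota => /h[kP _ Pk]; apply/mapP; exists (Ordinal kP) => //.
by rewrite mem_enum.
Qed.

Lemma sum_prod_bool m (P : 'I_n -> pred 'I_m) :
  \sum_(z : {ffun 'I_n -> 'I_m}) \prod_i (P i (z i))%:R = \prod_i (#|P i|%:R : R).
Proof.
rewrite -(bigA_distr_bigA (fun i k => (P i k)%:R)) /=; apply: eq_bigr => i _.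
by rewrite -sum1_card natr_sum [RHS]big_mkcond /=; apply: eq_bigr => k _; rewrite -topredE /=; case: (P i k).
Qed.

(** In each coordinate at most 2 rho (j+1) + 1 <= (2 rho + 1)(j+1) lattice values lie in
    [-rho, rho]; the factor (j+1)^n cancels against the normalization, so the bound is uniform in
    [j]. *)
Lemma grid_sum_bound j f (rho : nat) C : 0 <= C ->
  (forall x, `|f x| <= C) -> (forall x, rho%:R < `|x| -> f x = 0) ->
  `|grid_sum j f| <= C * (2 * rho + 1)%:R ^+ n.
Proof.
move=> C0 fC f0; have N0 : (0 : R) < j.+1%:R by rewrite ltr0n.
apply: le_trans (grid_sum_norm _ _) _; rewrite /grid_sum mulrC ler_pdivrMr ?exprn_gt0 //.
pose P (k : 'I_(2 * grid_radius j).+1) :=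
  (grid_radius j - rho * j.+1 <= k < grid_radius j - rho * j.+1 + (2 * rho * j.+1).+1)%N.
apply: (@le_trans _ _ (\sum_(z : grid j) C * \prod_i (P (z i))%:R)).
  apply: ler_sum => z _; have [x0|x0] := ltP rho%:R `|grid_point z|.
    by rewrite f0 // normr0 mulr_ge0 // prodr_ge0.
  rewrite big1 ?mulr1 // => i _; rewrite [P _](_ : _ = true) //.
  have := le_trans (mx_norm_ge (grid_point z) 0 i) x0; rewrite mxE normrM normfV.
  rewrite (gtr0_norm N0) ler_pdivrMr // -natrM ler_norml => /andP[h1 h2].
  have {}h1 : (grid_radius j <= z i + rho * j.+1)%N.
    by rewrite -(ler_nat R) natrD; move: h1; lra.
  have {}h2 : (z i <= grid_radius j + rho * j.+1)%N.
    by rewrite -(ler_nat R) natrD; move: h2; lra.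
  rewrite /P -mulnA; move: (rho * j.+1)%N (grid_radius j) (nat_of_ord (z i)) h1 h2 => a b c; lia.
rewrite -mulr_sumr (sum_prod_bool (fun=> P)) -mulrA -exprMn ler_wpM2l //.
rewrite prodr_const card_ord lerXn2r ?nnegrE // -natrM ler_nat.
apply: (@leq_trans (2 * rho * j.+1).+1); last by lia.
by apply: (@card_ord_le _ (grid_radius j - rho * j.+1)) => k.
Qed.

(** An interval of half-width r holds at least floor(r (j+1)) lattice values, which is at least r
    (j+1) / 2 once r (j+1) >= 2. Taking the product over the coordinates yields the constant
    [d * (r / 2) ^+ n]. *)
Lemma grid_sum_lower f x0 r d : 0 < r -> 0 < d -> (forall x, 0 <= f x) ->
  (forall x, `|x - x0| <= r -> d <= f x) ->
  exists2 e, 0 < e & \forall j \near \oo, e <= grid_sum j f.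
Proof.
move=> r0 d0 f0 fd; exists (d * (r / 2) ^+ n).
  by rewrite mulr_gt0 // exprn_gt0 // divr_gt0.
near=> j; have N0 : (0 : R) < j.+1%:R by rewrite ltr0n.
have jr : 2 <= r * j.+1%:R.
  have : 2 / r <= j%:R by near: j; exact: nbhs_infty_ger.
  rewrite ler_pdivrMr // mulrC => h; apply: le_trans h _.
  by rewrite ler_pM2l // ler_nat.
have jx : `|x0| + r <= j%:R by near: j; exact: nbhs_infty_ger.
rewrite /grid_sum [leRHS]mulrC ler_pdivlMr ?exprn_gt0 //.
pose P i (k : 'I_(2 * grid_radius j).+1) :=
  `|(k%:R - (grid_radius j)%:R) / j.+1%:R - x0 0 i| <= r.
apply: (@le_trans _ _ (\sum_(z : grid j) d * \prod_i (P i (z i))%:R)); last first.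
  apply: ler_sum => z _; have [h|/forallPn[i Pi]] := boolP [forall i, P i (z i)].
    rewrite big1 ?mulr1; last by move=> i _; rewrite (forallP h i).
    apply: fd; apply: mx_norm_le (ltW r0) _ => i k; rewrite ord1 !mxE.
    exact: (forallP h k).
  by rewrite (bigD1 i) //= (negbTE Pi) mul0r mulr0.
rewrite -mulr_sumr sum_prod_bool -mulrA -exprMn; apply: ler_wpM2l; first exact: ltW.
have -> : (r / 2 * j.+1%:R) ^+ n = \prod_(i < n) (r / 2 * j.+1%:R) by rewrite prodr_const card_ord.
apply: ler_prod => i _; apply/andP; split; first by rewrite mulr_ge0 // divr_ge0 // ltW.
(* [a] is the first index strictly to the right of x0_i - r. The [l] indices starting there stay in
   the left half of the interval, which is enough for the count. *)
pose a := (Num.truncn ((grid_radius j)%:R + j.+1%:R * (x0 0 i - r))).+1.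
have xi : `|x0 0 i| <= `|x0| by exact: mx_norm_ge.
have [xi1 xi2] : x0 0 i <= j%:R - r /\ r - j%:R <= x0 0 i.
  by have := ler_norm (x0 0 i); have := ler_norm (- x0 0 i); rewrite normrN; lra.
have G : (grid_radius j)%:R = j.+1%:R * j.+1%:R :> R by rewrite /grid_radius natrX expr2.
have jS : j.+1%:R = j%:R + 1 :> R by rewrite -natr1.
have j0 : 0 <= j%:R :> R by [].
have pos : 0 <= (grid_radius j)%:R + j.+1%:R * (x0 0 i - r).
  by rewrite G -mulrDr mulr_ge0 ?ltW //; lra.
have /andP[a1 a2] := Num.Theory.truncn_itv pos.
pose l := Num.truncn (r * j.+1%:R).
have /andP[l1 l2] : l%:R <= r * j.+1%:R < l.+1%:R.
  by apply: Num.Theory.truncn_itv; rewrite mulr_ge0 ?ltW.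
have lN : r / 2 * j.+1%:R <= l%:R by move: l2; rewrite -natr1; lra.
apply: le_trans lN _; rewrite ler_nat.
apply: (@card_ord_ge _ a) => k /andP[ak kal].
have k1 : j.+1%:R * (x0 0 i - r) <= k%:R - (grid_radius j)%:R.
  by have : a%:R <= k%:R :> R by [rewrite ler_nat|]; move: a2; rewrite /a; lra.
have k2 : k%:R - (grid_radius j)%:R <= j.+1%:R * (x0 0 i + r).
  have : k.+1%:R <= (a + l)%:R :> R by rewrite ler_nat.
  rewrite natrD /a -[k.+1%:R]natr1 -[(Num.truncn _).+1%:R]natr1; move: l1 a1; lra.
have kP : (k < (2 * grid_radius j).+1)%N.
  rewrite ltnS -(ler_nat R) natrM; apply: le_trans (_ : (grid_radius j)%:R + j.+1%:R * (x0 0 i + r) <= _); first lra.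
  have : j.+1%:R * (x0 0 i + r) <= j.+1%:R * j.+1%:R by rewrite ler_pM2l //; lra.
  by rewrite G; lra.
exists kP => //; rewrite /P /= ler_norml; apply/andP; split.
  by rewrite lerBrDr addrC -[_ - r]/(x0 0 i - r) ler_pdivlMr // mulrC.
by rewrite lerBlDr [r + _]addrC ler_pdivrMr // mulrC.
Unshelve. all: by end_near. Qed.

(* The sum of the difference quotients of V telescopes to 0. *)
Lemma discrete_stokes j V (W : 'rV[R]_n -> R) i (rho : nat) e : (rho < j)%N -> 0 <= e ->
  (forall x, rho%:R < `|x| -> V x = 0) -> (forall x, rho%:R < `|x| -> W x = 0) ->
  (forall x, `|j.+1%:R * (V (x + j.+1%:R^-1 *: delta_mx 0 i) - V x) - W x| <= e) ->
  `|grid_sum j W| <= e * (2 * rho.+1 + 1)%:R ^+ n.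
Proof.
move=> rj e0 V0 W0 h; have N0 : (0 : R) < j.+1%:R by rewrite ltr0n.
pose D x := j.+1%:R * (V (x + j.+1%:R^-1 *: delta_mx 0 i) - V x).
have D0 : grid_sum j D = 0.
  rewrite grid_sumZ grid_sumB [X in X - _](_ : _ = grid_sum j V) ?subrr ?mulr0 //.
  congr (_ * _).
  (* The shift by one mesh is made cyclic to become a bijection of the grid. Wrapping around is
     harmless: the shifted last point and the first point both have a coordinate of size at least j
     + 1, beyond the support of [V]. *)
  pose next (z : grid j) : grid j := [ffun k => if k == i then ordS (z k) else z k].
  have next_bij : bijective next.
    exists (fun z : grid j => [ffun k => if k == i then ord_pred (z k) else z k]) => z.
      by apply/ffunP => k; rewrite !ffunE; case: eqP => // _; rewrite ordSK.
    by apply/ffunP => k; rewrite !ffunE; case: eqP => // _; rewrite ord_predK.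
  rewrite [RHS](reindex next) /=; last exact: onW_bij.
  apply: eq_bigr => z _; have [zi|zi] := eqVneq (z i : nat) (2 * grid_radius j)%N.
    rewrite !V0 //.
      apply: lt_le_trans (mx_norm_ge _ 0 i); rewrite !mxE ffunE eqxx /= zi modnn.
      rewrite sub0r mulNr normrN normrM normfV !ger0_norm //.
      by rewrite /grid_radius expnS expn1 natrM mulfK ?gt_eqF // ltr_nat ltnW.
    apply: lt_le_trans (mx_norm_ge _ 0 i); rewrite !mxE !eqxx zi mulr1 -[X in _ + X]mul1r -mulrDl.
    apply: lt_le_trans (ler_norm _); rewrite ltr_pdivlMr //.
    have -> : (2 * grid_radius j)%:R = 2 * (grid_radius j)%:R :> R by rewrite natrM.
    have -> : (grid_radius j)%:R = j.+1%:R * j.+1%:R :> R by rewrite /grid_radius natrX expr2.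
    apply: (@lt_trans _ _ (j.+1%:R * j.+1%:R)); last by lra.
    by rewrite ltr_pM2r // ltr_nat ltnW.
  congr V; apply/rowP => k; rewrite !mxE ffunE; have [->|ki] := eqVneq k i.
    rewrite eqxx mulr1 -[X in _ + X]mul1r -mulrDl; congr (_ / _); rewrite /= modn_small.
      by rewrite -natr1; lra.
    by rewrite ltnS; have := ltn_ord (z i); rewrite ltnS leq_eqVlt (negbTE zi).
  by rewrite mulr0 addr0.
have -> : grid_sum j W = grid_sum j (fun x => W x - D x) by rewrite grid_sumB D0 subr0.
(* The difference quotient of [V] lives on a set larger by one mesh, at most 1, than the support:
   whence the radius [rho.+1]. *)
apply: grid_sum_bound => // x; first by rewrite distrC; exact: h.
move=> hx; rewrite W0; last by apply: le_lt_trans hx; rewrite ler_nat.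
rewrite /D !V0 ?subrr ?mulr0 ?subrr //; first by apply: le_lt_trans hx; rewrite ler_nat.
have h1 : `|j.+1%:R^-1 *: (delta_mx 0 i : 'rV[R]_n)| <= 1.
  apply: mx_norm_le => // a b; rewrite ord1 !mxE eqxx normrM normfV (gtr0_norm N0).
  rewrite ler_pdivrMl // mulr1; case: eqP => _; last by rewrite normr0.
  by rewrite normr1 ler1n.
have := ler_distD (x + j.+1%:R^-1 *: delta_mx 0 i) x 0; rewrite !subr0.
rewrite opprD addrA subrr add0r normrN -natr1 in hx *; lra.
Qed.

Definition signed_perm (s : 'I_n -> bool) (p : {perm 'I_n}) : 'M[R]_n :=
  \matrix_(i, k) ((-1) ^+ s k * (i == p k)%:R).

(** The grid is symmetric under permutations and reflections of the coordinates, a reflection being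
    [rev_ord] on indices. Linear changes of variables are later reduced to these exact ones. *)
Lemma grid_sum_signed_perm j f s p :
  grid_sum j (fun x => f (x *m signed_perm s p)) = grid_sum j f.
Proof.
congr (_ * _).
pose mv (z : grid j) : grid j := [ffun k => if s k then rev_ord (z (p k)) else z (p k)].
have mv_bij : bijective mv.
  exists (fun z : grid j => [ffun k => let l := (p^-1)%g k in if s l then rev_ord (z l) else z l]) => z.
    apply/ffunP => k; rewrite /mv !ffunE /= !permKV; case: (s _) => //; exact: rev_ordK.
  apply/ffunP => k; rewrite /mv !ffunE /= !permK; case: (s _) => //; exact: rev_ordK.
rewrite [RHS](reindex mv) /=; last exact: onW_bij.
apply: eq_bigr => z _; congr f; apply/rowP => k; rewrite !mxE (bigD1 (p k)) //= !mxE eqxx mulr1.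
rewrite big1 ?addr0; last by move=> l /negbTE lk; rewrite [signed_perm _ _ _ _]mxE lk !mulr0.
rewrite ffunE; case: (s k) => /=; last by rewrite expr0 mulr1.
rewrite expr1 mulrN1 -mulNr opprB; congr (_ / _).
have zk : (z (p k) <= 2 * grid_radius j)%N by rewrite -ltnS.
by rewrite subSS natrB // natrM; lra.
Qed.

End Lattice.

Section Dext.
Context {R : realType} {n : nat}.

Lemma row'_lift p (M : 'M[R]_(p.+2, n)) (i : 'I_p.+1) :
  rows (row' (lift ord0 i) M) = row 0 M :: rows (row' i (row' 0 M)).
Proof.
rewrite rows_cons; congr cons.
  by apply/rowP => k; rewrite !mxE; congr (M _ k); apply: val_inj.
congr rows; apply/matrixP => k l; rewrite !mxE; congr (M _ l).
by apply: val_inj; rewrite /= /bump /= !add1n ltnS; case: (i <= k)%N.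
Qed.

(** Unrolling Cartan's recursion along the rows gives the alternating sum of [dext], one sign per
    contraction. *)
Lemma dext_dseq p (A : 'rV[R]_n -> seq 'rV[R]_n -> R) x (M : 'M[R]_(p.+1, n)) :
  dext (fun y (N : 'M[R]_(p, n)) => A y (rows N)) x M = dseq A x (rows M).
Proof.
elim: p A M => [|p IH] A M; rewrite /dext big_ord_recl expr0 mul1r.
  by rewrite big_ord0 addr0 rows_cons /= /rows enum_ord0 /= subr0.
rewrite [in RHS]rows_cons /= -IH /dext -sumrN; congr (_ + _); apply: eq_bigr => i _.
rewrite /bump /= add1n exprS mulN1r mulNr; congr (- (_ * _)).
have -> : row (lift ord0 i) M = row i (row' 0 M) by apply/rowP => k; rewrite !mxE.
by congr (derive _ x _); apply/funext => y; rewrite row'_lift.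
Qed.

Lemma dext_form_of p (a : 'rV[R]_n -> 'M[R]_(p, n) -> R) x M :
  dext a x M = dseq (fun y => form_of (a y)) x (rows M).
Proof.
rewrite -dext_dseq; apply: eq_bigr => i _; congr (_ * _).
by congr (derive _ x _); apply/funext => y; rewrite form_of_rows.
Qed.

(** The sum is the expansion along the first column of the determinant of the matrix [M g | M], with
    [g] the gradient of [h]; this square matrix of size n + 1 factors through R^n, hence is
    singular. *)
Lemma dext_top (h : 'rV[R]_n -> R) y (M : 'M[R]_(n.+1, n)) : differentiable h y ->
  dext (fun y (N : 'M[R]_n) => h y * \det N) y M = 0.
Proof.
move=> dh; pose g : 'cV[R]_n := \col_k 'D_(delta_mx 0 k) h y.
pose X : 'M[R]_(n.+1, 1 + n) := row_mx (M *m g) M.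
have detX : \det (X : 'M[R]_n.+1) = 0.
  have XE : X = M *m row_mx g 1%:M by rewrite mul_mx_row mulmx1.
  apply/eqP; apply: contraT => d0.
  have : (X : 'M[R]_n.+1) \in unitmx by rewrite unitmxE unitfE.
  rewrite -row_free_unit /row_free => /eqP rX.
  have := mxrankM_maxl M (row_mx g 1%:M); rewrite -XE rX => h1.
  by have := leq_trans h1 (rank_leq_col M); rewrite ltnn.
rewrite -[RHS]detX (expand_det_col _ (0 : 'I_n.+1)); apply: eq_bigr => i _.
have -> : 'D_(row i M) (fun y => h y * \det (row' i M)) y = 'D_(row i M) h y * \det (row' i M).
  rewrite (derive_scale _ dh (differentiable_cst _ _)) derive_cst mulr0 add0r.
  by rewrite mulrC.
have -> : (X : 'M[R]_n.+1) i 0 = 'D_(row i M) h y.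
  have -> : (0 : 'I_n.+1) = lshift n (0 : 'I_1) by apply: val_inj.
  rewrite /X [LHS]row_mxEl mxE (deriveE _ dh) [row i M]row_sum_delta linear_sum.
  by apply: eq_bigr => k _; rewrite linearZ /= !mxE (deriveE _ dh).
rewrite /cofactor addn0 mulrCA; congr (_ * (_ * \det _)).
apply/matrixP => k l; rewrite !mxE.
have -> : lift (0 : 'I_n.+1) l = rshift 1 l by apply: val_inj.
have -> : fintype.split (rshift 1 l) = inr l by exact: (unsplitK (inr l : 'I_1 + 'I_n)).
by [].
Qed.

Lemma Ck_det (V : normedModType R) p k U (F : V -> 'M[R]_p) : open U ->
  (forall i j, Ck_on k U (fun x => F x i j)) -> Ck_on k U (fun x => \det (F x)).
Proof.
move=> oU hF; apply: Ck_sum => // s _; apply: Ck_mul => //; first exact: Ck_cst.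
by apply: Ck_prod.
Qed.

End Dext.

(** * Lattice sums along a homotopy *)

Section Homotopy.
Context {R : realType} {n : nat}.

(* The point (t, x) of R x R^n. *)
Definition tpt (t : R) (x : 'rV[R]_n) : 'rV[R]_n.+1 := row_mx (t%:M : 'rV[R]_1) x.
Definition tpt2 (p : 'rV[R]_n.+1) : 'rV[R]_n := rsubmx (p : 'rV[R]_(1 + n)).
Definition tpt1 (p : 'rV[R]_n.+1) : R := p 0 0.

Lemma tpt2K t x : tpt2 (tpt t x) = x.
Proof. by rewrite /tpt2 row_mxKr. Qed.

Lemma tpt2E p l : tpt2 p 0 l = p 0 (lift 0 l).
Proof. by rewrite mxE; congr (p _ _); apply: val_inj. Qed.

Lemma tptE1 t x : tpt t x 0 0 = t.
Proof.
have -> : (0 : 'I_n.+1) = lshift n (0 : 'I_1) by apply: val_inj.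
by rewrite [LHS]row_mxEl mxE eqxx mulr1n.
Qed.

Lemma tptE2 t x l : tpt t x 0 (lift 0 l) = x 0 l.
Proof. by rewrite -tpt2E tpt2K. Qed.

Lemma tptP (p q : 'rV[R]_n.+1) : p 0 0 = q 0 0 -> (forall l, p 0 (lift 0 l) = q 0 (lift 0 l)) ->
  p = q.
Proof. by move=> h0 h; apply/rowP => l; case: (unliftP 0 l) => [l'|] ->. Qed.

Lemma tpt1K t x : tpt1 (tpt t x) = t.
Proof. exact: tptE1. Qed.

Lemma tptK p : tpt (tpt1 p) (tpt2 p) = p.
Proof. by apply: tptP => [|l]; rewrite ?tptE1 ?tptE2 ?tpt2E. Qed.

Lemma tpt_shift2 t x (s : R) k :
  tpt t x + s *: delta_mx 0 (lift 0 k) = tpt t (x + s *: delta_mx 0 k).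
Proof.
apply: tptP => [|l]; rewrite [LHS]mxE ?tptE1 ?tptE2 [X in _ + X]mxE [delta_mx _ _ _ _]mxE.
  by rewrite (negbTE (neq_lift _ _)) andbF mulr0 addr0.
by rewrite (inj_eq lift_inj) !mxE.
Qed.

Lemma tpt_shift1 t x (s : R) : tpt t x + s *: delta_mx 0 0 = tpt (t + s) x.
Proof.
apply: tptP => [|l]; rewrite [LHS]mxE ?tptE1 ?tptE2 [X in _ + X]mxE [delta_mx _ _ _ _]mxE.
  by rewrite !eqxx mulr1.
by rewrite [lift 0 l == 0]eq_sym (negbTE (neq_lift _ _)) andbF mulr0 addr0.
Qed.

Lemma tpt2_continuous : continuous tpt2.
Proof. exact: (@continuous_rsubmx _ 1 1 n). Qed.

Lemma derive_tpt2 (V : 'rV[R]_n.+1 -> R) t x k :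
  'D_(delta_mx 0 k) (fun y => V (tpt t y)) x = 'D_(delta_mx 0 (lift 0 k)) V (tpt t x).
Proof.
rewrite /derive; apply: (congr1 (fun g => lim (g @ 0^'))); apply/funext => s.
by rewrite /= ![s *: _ + _]addrC tpt_shift2.
Qed.

Lemma is_derive_tpt1 (V : 'rV[R]_n.+1 -> R) t x : differentiable V (tpt t x) ->
  is_derive t 1 (fun s => V (tpt s x)) ('D_(delta_mx 0 0) V (tpt t x)).
Proof.
move=> dV.
have E s : tpt s x = tpt 0 x + s *: delta_mx 0 0 by rewrite tpt_shift1 add0r.
have -> : (fun s => V (tpt s x)) = (fun s => V (tpt 0 x + s *: delta_mx 0 0)).
  by apply/funext => s; rewrite -E.
by have h := @is_derive_line _ _ V (tpt 0 x) (delta_mx 0 0) t; rewrite -E in h; exact: h.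
Qed.

Lemma tpt_norm t x b : 0 <= b -> (`|tpt t x| <= b) = (`|t| <= b) && (`|x| <= b).
Proof.
move=> b0; apply/idP/andP => [h|[h1 h2]].
  split; first by have := le_trans (mx_norm_ge (tpt t x) 0 0) h; rewrite tptE1.
  apply: mx_norm_le => // i k; rewrite ord1 -(tptE2 t x k).
  exact: le_trans (mx_norm_ge (tpt t x) 0 (lift 0 k)) h.
apply: mx_norm_le => // i k; rewrite ord1; case: (unliftP 0 k) => [l|] ->.
  by rewrite tptE2; exact: le_trans (mx_norm_ge x 0 l) h2.
by rewrite tptE1.
Qed.

Lemma tptB t s x y : tpt t x - tpt s y = tpt (t - s) (x - y).
Proof.
by apply: tptP => [|l]; rewrite [LHS]mxE [X in _ + X]mxE ?tptE1 ?tptE2 ?mxE.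
Qed.

(** Heine's theorem on the slab [0,1] x R^n. Continuity is relative to the slab because the
    densities to come vanish off [K] only for t in [0,1]; two points off [K] are no problem, since
    [G] is 0 at both. *)
Lemma equicontinuous_slab (G : 'rV[R]_n.+1 -> R) (K : set 'rV[R]_n) (rho : R) :
  0 <= rho -> (forall x, K x -> `|x| <= rho) ->
  (forall t x, 0 <= t <= 1 -> ~ K x -> G (tpt t x) = 0) ->
  (forall t x, 0 <= t <= 1 -> forall e, 0 < e ->
    \forall q \near tpt t x, 0 <= tpt1 q <= 1 -> `|G (tpt t x) - G q| < e) ->
  forall e, 0 < e -> exists2 d, 0 < d & forall t x y, 0 <= t <= 1 -> `|x - y| < d ->
    `|G (tpt t x) - G (tpt t y)| < e.
Proof.
move=> rho0 Krho G0 cG e e0.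
(* The norm on R x R^n is the maximum norm; the margin 1 lets a single bound cover both [x] and t <=
   1. *)
pose C : set 'rV[R]_n.+1 := [set p | 0 <= tpt1 p <= 1 /\ `|p| <= rho + 1].
have cC : compact C.
  apply: bounded_closed_compact.
    by exists (rho + 1); split; [exact: num_real|move=> b bb p [_ /le_trans]; apply; exact: ltW].
  apply: (@closedI _ (tpt1 @^-1` [set t | 0 <= t <= 1]) [set p | `|p| <= rho + 1]).
    apply: preimage_closed; first by move=> p _; exact: coord_continuous.
    rewrite (_ : [set _ | _] = [set t : R | 0 <= t] `&` [set t | t <= 1]).
      by apply: closedI; [exact: closed_ge|exact: closed_le].
    by apply/seteqP; split=> t /=; [move=> /andP[]|move=> [-> ->]].
  apply: (@preimage_closed _ _ _ [set t : R | t <= rho + 1]); last exact: closed_le.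
  by move=> p _; exact: norm_continuous.
pose P (d : R) (p : 'rV[R]_n.+1) := forall q, 0 <= tpt1 p <= 1 -> 0 <= tpt1 q <= 1 ->
  `|q - p| < d -> `|G p - G q| < e.
have H : \forall d \near (0 : R)^'+, C `<=` P d.
  apply: ((compact_near_coveringP C).1 cC _ _ P) => p [pt _].
  have e2 : 0 < e / 2 by rewrite divr_gt0.
  have := cG (tpt1 p) (tpt2 p) pt _ e2; rewrite tptK => /nbhs_normP[r /= r0 hr].
  exists ([set p' | `|p - p'| < r / 2], [set d | d < r / 2]).
    split; first by apply/(nbhs_normP p); exists (r / 2) => //=; rewrite divr_gt0.
    by apply: nbhs_right_lt; rewrite divr_gt0.
  move=> [p' d] /= [pp' dr] q p't qt qd.
  have h1 : `|G p - G p'| < e / 2 by apply: hr p't => /=; lra.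
  have h2 : `|G p - G q| < e / 2.
    by apply: hr qt => /=; have := ler_distD p' p q; rewrite (distrC p' q); lra.
  by rewrite (splitr e); apply: le_lt_trans (ler_distD (G p) _ _) _; rewrite distrC ltrD.
have [d [d0 Hd]] : exists d : R, 0 < d /\ C `<=` P d.
  have /filter_ex[d [d0 h]] : \forall d \near (0 : R)^'+, 0 < d /\ C `<=` P d.
    by apply: filterS (filterI (nbhs_right_gt 0) H) => d [].
  by exists d.
exists d => // t x y t01 xy.
have tn : `|t| <= rho + 1 by case/andP: t01 => t0 t1; rewrite ger0_norm //; lra.
have rho1 : 0 <= rho + 1 by lra.
have inC z : K z -> C (tpt t z).
  by move=> Kz; split; rewrite ?tpt1K // tpt_norm // tn /=; have := Krho _ Kz; lra.
have dist z w : `|z - w| < d -> `|tpt t w - tpt t z| < d.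
  move=> zw; rewrite tptB subrr; apply: le_lt_trans zw.
  by rewrite tpt_norm // normr0 normr_ge0 distrC lexx.
have [Kx|nKx] := pselect (K x).
  by apply: (Hd _ (inC _ Kx)); rewrite ?tpt1K //; exact: dist.
have [Ky|nKy] := pselect (K y).
  by rewrite distrC; apply: (Hd _ (inC _ Ky)); rewrite ?tpt1K //; apply: dist; rewrite distrC.
by rewrite !G0 // subrr normr0.
Qed.

(** By the mean value theorem the difference quotient of [h t] is a value of its derivative within
    one mesh. Equicontinuity on the slab makes the error in [discrete_stokes] small, uniformly in
    [t]. *)
Lemma grid_sum_derive_small (h : R -> 'rV[R]_n -> R) (G : 'rV[R]_n.+1 -> R)
    (K : set 'rV[R]_n) (rho : nat) i :
  (forall x, K x -> `|x| <= rho%:R) ->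
  (forall t, 0 <= t <= 1 -> Ck_on 1 setT (h t)) ->
  (forall t x, 0 <= t <= 1 -> 'D_(delta_mx 0 i) (h t) x = G (tpt t x)) ->
  (forall t x, 0 <= t <= 1 -> ~ K x -> h t x = 0) ->
  (forall t x, 0 <= t <= 1 -> ~ K x -> G (tpt t x) = 0) ->
  (forall t x, 0 <= t <= 1 -> forall e, 0 < e ->
    \forall q \near tpt t x, 0 <= tpt1 q <= 1 -> `|G (tpt t x) - G q| < e) ->
  forall e, 0 < e -> \forall j \near \oo, forall t, 0 <= t <= 1 ->
    `|grid_sum j (fun x => G (tpt t x))| <= e.
Proof.
move=> Krho h1 hG h0 G0 cG e e0.
pose B : R := (2 * rho.+1 + 1)%:R ^+ n.
have B0 : 0 < B by rewrite exprn_gt0 // ltr0n addn1.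
have eB : 0 < e / B by rewrite divr_gt0.
have [d d0 hd] := equicontinuous_slab (ler0n _ rho) Krho G0 cG eB.
near=> j => t t01.
have rj : (rho < j)%N by near: j; exact: nbhs_infty_gt.
have jd : j.+1%:R^-1 < d.
  have : d^-1 < j%:R by near: j; exact: nbhs_infty_gtr.
  move=> h'; rewrite -[d]invrK ltf_pV2 ?posrE ?invr_gt0 ?ltr0n //.
  by apply: lt_trans h' _; rewrite ltr_nat.
have N0 : (0 : R) < j.+1%:R^-1 by rewrite invr_gt0 ltr0n.
have nK x : rho%:R < `|x| -> ~ K x by move=> hx /Krho; rewrite leNgt hx.
rewrite -[e](@divfK _ B) ?gt_eqF //.
apply: (@discrete_stokes _ _ _ (h t) _ i rho _ rj (ltW eB)) => [x /nK|x /nK|x].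
    exact: h0.
  exact: G0.
have [s sh ->] := @MVT_line _ _ (h t) x (delta_mx 0 i) _ N0
  (fun s _ => (Ck_onSP (h1 t t01)).1 _ I).
rewrite mulrA mulfV ?mul1r ?pnatr_eq0 // hG //.
apply/ltW/hd => //; apply: le_lt_trans jd.
rewrite addrC addKr normrZ; case/andP: sh => s0 sh; rewrite ger0_norm //.
apply: le_trans sh; rewrite -[leRHS]mulr1 ler_wpM2l //.
by apply: mx_norm_le => // a b; rewrite !mxE; case: (_ && _); rewrite ?normr1 ?normr0.
Unshelve. all: by end_near. Qed.

Variables (U K : set 'rV[R]_n) (Phi : 'rV[R]_n.+1 -> 'rV[R]_n) (h : 'rV[R]_n -> R).
Hypotheses (oU : open U) (cK : compact K) (KU : K `<=` U).
Hypotheses (Phi2 : Ck_on 2 (tpt2 @^-1` U) Phi) (h1 : Ck_on 1 setT h).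
Hypothesis h0 : forall t x, 0 <= t <= 1 -> U x -> ~ K x -> h (Phi (tpt t x)) = 0.

(* The coefficient of the pull-back of h dx_1 ... dx_n by Phi(t, .), extended
   by 0 outside U. *)
Definition homotopy_density t x : R :=
  if x \in U then h (Phi (tpt t x)) * \det (row' 0 (jacobian Phi (tpt t x))) else 0.

Let oU' : open (tpt2 @^-1` U).
Proof. by apply: open_comp => // p _; exact: tpt2_continuous. Qed.

Let clK : closed K.
Proof. by apply: compact_closed => //; exact: norm_hausdorff. Qed.

Let dPhi p : U (tpt2 p) -> differentiable Phi p.
Proof. by have [d _] := Ck_onSP Phi2; exact: d. Qed.

(** The coefficients of the pull-back of h dx_1 ... dx_n by [Phi]: [V i] belongs to the product of
    all differentials but the i-th. [V 0] is the density and the others are, up to sign, its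
    flux. *)
Let V (i : 'I_n.+1) p := h (Phi p) * \det (row' i (jacobian Phi p)).

Let V1 i : Ck_on 1 (tpt2 @^-1` U) (V i).
Proof.
apply: Ck_mul => //.
  by apply: (Ck_comp (O := setT) oU' (Ck_onS Phi2) h1).
apply: Ck_det => // k l.
apply: (Ck_on_ext oU' _ (Ck_jacobian (lift i k) l oU' Phi2)) => p _.
by rewrite [RHS]mxE.
Qed.

(* The pull-back by Phi of the top form h dx_1 ... dx_n is closed on R x R^n. *)
Let divergence_free p : U (tpt2 p) ->
  \sum_(i < n.+1) (-1) ^+ i * 'D_(delta_mx 0 i) (V i) p = 0.
Proof.
move=> Up.
pose A y := form_of (fun M : 'M[R]_n => h y * \det M).
have dh y : differentiable h y by have [d _] := Ck_onSP h1; exact: d.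
have ml y : multilinear_rows (fun M : 'M[R]_n => h y * \det M).
  move=> B C D i b c e1 e2 e3.
  by rewrite (determinant_multilinear e1 (esym e2) (esym e3)) mulrDr !(mulrCA (h y)).
have al y : alternating_rows (fun M : 'M[R]_n => h y * \det M).
  move=> B i k ik e; rewrite (determinant_alternate ik) ?mulr0 // => l.
  by have := congr1 (fun v : 'rV[R]_n => v 0 l) e; rewrite !mxE.
have rA : regular_on setT A.
  split=> y _; [exact: form_of_linear|exact: form_of_antisym|].
  move=> t; rewrite /A /form_of; case: (_ == _); last exact: differentiable_cst.
  by apply: differentiableM => //; exact: differentiable_cst.
have := dseq_pull oU' openT Phi2 (fun _ _ => I) Up (rows (1%:M : 'M[R]_n.+1)) rA.
have mapE p' q (M : 'M[R]_(q, n.+1)) : U (tpt2 p') ->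
    [seq 'D_v Phi p' | v <- rows M] = rows (M *m jacobian Phi p').
  move=> Up'; rewrite rows_mulmx; apply: eq_map => v.
  by rewrite (deriveEjacobian _ (dPhi Up')).
rewrite mapE // -dext_form_of dext_top // -dext_dseq /dext => E; rewrite -[RHS]E.
apply: eq_bigr => i _; congr (_ * _); rewrite row1; apply: near_eq_derive.
have : \forall q \near p, U (tpt2 q) by exact: open_nbhs_nbhs.
apply: filterS => q Uq; rewrite /pull mapE // /A form_of_rows; congr (_ * \det _).
by rewrite !row'Esub mul_rowsub_mx mul1mx.
Qed.

Let dV i p : U (tpt2 p) -> differentiable (V i) p.
Proof. by have [d _] := Ck_onSP (V1 i); exact: d. Qed.

Let V0 i t x : 0 <= t <= 1 -> U x -> ~ K x -> V i (tpt t x) = 0.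
Proof. by move=> t01 Ux nKx; rewrite /V h0 // mul0r. Qed.

Let ext (i : 'I_n.+1) t x := if x \in U then V i (tpt t x) else 0.

Let tpt_is_diff t (x : 'rV[R]_n) : Ck_on 1 setT (tpt t).
Proof.
apply/Ck_mxP => [|i k]; first exact: openT.
rewrite ord1; case: (unliftP 0 k) => [l|] ->.
  apply: (Ck_on_ext openT _ (@Ck_coord _ 1 1 n setT 0 l)) => y _.
  by rewrite tptE2.
by apply: (Ck_on_ext openT _ (Ck_cst 1 setT t)) => y _; rewrite tptE1.
Qed.

Let ext1 i t : 0 <= t <= 1 -> Ck_on 1 setT (ext i t).
Proof.
move=> t01; apply: (Ck_zero_ext oU clK KU) => [x Ux nKx|]; first exact: V0.
apply: (Ck_comp oU (Ck_on_sub _ (tpt_is_diff t 0)) (V1 i)) => // x Ux.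
by rewrite /= tpt2K.
Qed.

Let W (i : 'I_n) p := if tpt2 p \in U then 'D_(delta_mx 0 (lift 0 i)) (V (lift 0 i)) p else 0.

Let ext_near i t x : U x -> \forall y \near x, ext i t y = V i (tpt t y).
Proof.
move=> Ux; have : \forall y \near x, U y by exact: open_nbhs_nbhs.
by apply: filterS => y Uy; rewrite /ext mem_set.
Qed.

Let ext_near0 i t x : 0 <= t <= 1 -> ~ K x -> \forall y \near x, ext i t y = 0.
Proof.
move=> t01 nKx.
have : \forall y \near x, ~ K y.
  by apply: (open_nbhs_nbhs (A := ~` K)); split=> //; exact: closed_openC.
by apply: filterS => y nKy; rewrite /ext; case: ifPn => // /set_mem Uy; exact: V0.
Qed.

Let derive_ext (i : 'I_n) t x : 0 <= t <= 1 ->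
  'D_(delta_mx 0 i) (ext (lift 0 i) t) x = W i (tpt t x).
Proof.
move=> t01; rewrite /W tpt2K; case: ifPn => [/set_mem Ux|/negP nUx].
  by rewrite (near_eq_derive _ (ext_near (lift 0 i) t Ux)) derive_tpt2.
have nKx : ~ K x by move=> /KU Ux; apply: nUx; rewrite inE.
by rewrite (near_eq_derive _ (ext_near0 (lift 0 i) t01 nKx)) derive_cst.
Qed.

Let W0 i t x : 0 <= t <= 1 -> ~ K x -> W i (tpt t x) = 0.
Proof.
move=> t01 nKx; rewrite -derive_ext //.
by rewrite (near_eq_derive _ (ext_near0 (lift 0 i) t01 nKx)) derive_cst.
Qed.

Let W_cont i t x : 0 <= t <= 1 -> forall e, 0 < e ->
  \forall q \near tpt t x, 0 <= tpt1 q <= 1 -> `|W i (tpt t x) - W i q| < e.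
Proof.
move=> t01 e e0; have [Ux|nUx] := pselect (U x).
  have Up : U (tpt2 (tpt t x)) by rewrite tpt2K.
  have [_ /(_ (delta_mx 0 (lift 0 i))) c] := Ck_onSP (V1 (lift 0 i)).
  have nUp : \forall q \near tpt t x, U (tpt2 q) by exact: open_nbhs_nbhs.
  move/cvgrPdist_lt: (c _ Up) => /(_ e e0) ce.
  apply: filterS (filterI nUp ce) => q [Uq cq] _.
  by rewrite /W !mem_set.
have nKx : ~ K x by move=> /KU.
have oK : open (tpt2 @^-1` (~` K)).
  by apply: open_comp => [p _|]; [exact: tpt2_continuous|exact: closed_openC].
have : \forall q \near tpt t x, ~ K (tpt2 q).
  by apply: (open_nbhs_nbhs (A := tpt2 @^-1` (~` K))); split=> //=; rewrite tpt2K.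
apply: filterS => q nKq q01; rewrite W0 // -[q]tptK W0 //.
by rewrite subrr normr0.
Qed.

Let K_bounded : exists2 rho : nat, True & forall x, K x -> `|x| <= rho%:R.
Proof.
have [M [_ hM]] := compact_bounded cK.
exists (Num.truncn (Num.max M 0)).+2 => // x Kx.
have M0 : 0 <= Num.max M 0 by rewrite le_max lexx orbT.
have /andP[_ hlt] := Num.Theory.truncn_itv M0.
apply: hM Kx; apply: lt_le_trans (_ : (Num.truncn (Num.max M 0)).+1%:R <= _); last by rewrite ler_nat.
by apply: le_lt_trans hlt; rewrite le_max lexx.
Qed.

Let grid_W_small e : 0 < e -> \forall j \near \oo, forall t i, 0 <= t <= 1 ->
  `|grid_sum j (fun x => W i (tpt t x))| <= e.
Proof.
move=> e0; have [rho _ hrho] := K_bounded.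
have : \forall j \near \oo, forall i t, 0 <= t <= 1 ->
    `|grid_sum j (fun x => W i (tpt t x))| <= e.
  apply: filter_forall => i.
  apply: (grid_sum_derive_small (h := ext (lift 0 i)) hrho) e0.
          exact: ext1.
        by move=> t x; exact: derive_ext.
      by move=> t x t01 nKx; exact: (nbhs_singleton (ext_near0 (lift 0 i) t01 nKx)).
    exact: W0.
  exact: W_cont.
by apply: filterS => j h' t i; exact: h'.
Qed.

(* The mean value theorem in t: the t-derivative of the density is minus a
   divergence in x, whose lattice sums are small uniformly in t. *)
Lemma homotopy_grid_sum e : 0 < e -> \forall j \near \oo,
  `|grid_sum j (homotopy_density 1) - grid_sum j (homotopy_density 0)| <= e.
Proof.
move=> e0.
(* There are n divergence terms; dividing by n + 1 also covers n = 0. *)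
have en : 0 < e / n.+1%:R by rewrite divr_gt0 // ltr0n.
apply: filterS (grid_W_small en) => j hj.
pose G t := grid_sum j (homotopy_density t).
pose T t x := if x \in U then 'D_(delta_mx 0 0) (V 0) (tpt t x) else 0.
have dz (t : R) (z : @grid n j) :
    is_derive t (1 : R) (fun t => homotopy_density t (grid_point z)) (T t (grid_point z)).
  rewrite /homotopy_density /T; case: ifPn => [/set_mem Uz|_]; last exact: is_derive_cst.
  by apply: is_derive_tpt1; apply: dV; rewrite tpt2K.
have dG (t : R) : is_derive t (1 : R) G (grid_sum j (T t)).
  have dz' (z : @grid n j) : differentiable (fun t => homotopy_density t (grid_point z)) t.
    by apply/derivable1_diffP; case: (dz t z).
  have [E1 E2] := derive_sumr (index_enum (@grid n j)) (1 : R) dz'.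
  have d1 := differentiable_cst ((j.+1%:R : R) ^- n) t.
  apply: DeriveDef; first by apply/derivable1_diffP; exact: (differentiableM d1 E2).
  rewrite (derive_scale (1 : R) d1 E2) E1 derive_cst mulr0 addr0; congr (_ * _).
  by apply: eq_bigr => z _; case: (dz t z).
have TE t : 0 <= t <= 1 -> grid_sum j (T t) = \sum_(i < n) (-1) ^+ i * grid_sum j (fun x => W i (tpt t x)).
  move=> t01; under eq_bigr do rewrite -grid_sumZ.
  rewrite -grid_sum_sum; apply: eq_grid_sum => x; rewrite /T /W.
  under eq_bigr do rewrite tpt2K.
  case: ifPn => [/set_mem Ux|_]; last by rewrite big1 // => i _; rewrite mulr0.
  have := @divergence_free (tpt t x); rewrite tpt2K => /(_ Ux).
  rewrite big_ord_recl expr0 mul1r => /eqP; rewrite addr_eq0 => /eqP ->.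
  rewrite -sumrN; apply: eq_bigr => i _.
  by rewrite lift0 exprS mulN1r mulNr opprK.
have cG : {within `[0, 1], continuous G}.
  by apply: derivable_within_continuous => t _; case: (dG t).
have [t t01 ->] := @MVT_segment _ G (fun t => grid_sum j (T t)) 0 1 ler01 (fun t _ => dG t) cG.
rewrite subr0 mulr1; rewrite in_itv /= in t01; rewrite TE //.
apply: le_trans (ler_norm_sum _ _ _) _.
apply: (@le_trans _ _ (\sum_(i < n) e / n.+1%:R)).
  by apply: ler_sum => i _; rewrite normrM normrX normrN1 expr1n mul1r; exact: hj.
rewrite sumr_const card_ord -[_ *+ n]mulr_natr mulrAC ler_pdivrMr ?ltr0n //.
by rewrite ler_pM2l // ler_nat.
Qed.

End Homotopy.

Section NullSequences.
Context {R : realType}.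
Implicit Types u v : nat -> R.

Definition null_seq u := forall e, 0 < e -> \forall j \near \oo, `|u j| <= e.

Lemma eq_null_seq u v : u =1 v -> null_seq u -> null_seq v.
Proof. by move=> uv h e e0; apply: filterS (h e e0) => j; rewrite uv. Qed.

Lemma null_seqD u v : null_seq u -> null_seq v -> null_seq (fun j => u j + v j).
Proof.
move=> hu hv e e0; have e2 : 0 < e / 2 by rewrite divr_gt0.
apply: filterS2 (hu _ e2) (hv _ e2) => j h1 h2.
by rewrite (splitr e); apply: le_trans (ler_normD _ _) _; exact: lerD.
Qed.

Lemma null_seqZ c u : null_seq u -> null_seq (fun j => c * u j).
Proof.
move=> hu e e0; have c0 : 0 < `|c| + 1 by rewrite ltr_wpDl.
have ec : 0 < e / (`|c| + 1) by rewrite divr_gt0.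
apply: filterS (hu _ ec) => j h; rewrite normrM.
apply: le_trans (ler_wpM2l (normr_ge0 c) h) _.
by rewrite mulrA ler_pdivrMr // mulrC ler_pM2l // lerDl.
Qed.

Lemma null_seq0 : null_seq (fun=> 0).
Proof. by move=> e e0; apply: nearW => j; rewrite normr0 ltW. Qed.

Lemma null_seq_sum I (r : seq I) (F : I -> nat -> R) :
  (forall i, null_seq (F i)) -> null_seq (fun j => \sum_(i <- r) F i j).
Proof.
move=> h; elim: r => [|i r IH].
  by apply: eq_null_seq null_seq0 => j; rewrite big_nil.
by apply: eq_null_seq (null_seqD (h i) IH) => j; rewrite big_cons.
Qed.

End NullSequences.

(** * Asymptotic invariance under affine maps *)

Section ChangeOfVariables.
Context {R : realType} {n : nat}.
Implicit Types (h : 'rV[R]_n -> R) (A B : 'M[R]_n) (x : 'rV[R]_n).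

Definition supp_ball h r := forall x, r < `|x| -> h x = 0.

Lemma closed_ball_compact x r : compact [set y : 'rV[R]_n | `|y - x| <= r].
Proof.
apply: bounded_closed_compact.
  exists (`|x| + r); split; first exact: num_real.
  move=> b bb y /= yx; apply: le_trans (ltW bb).
  by rewrite -[y](subrK x) [leRHS]addrC; apply: le_trans (ler_normD _ _) _; rewrite lerD2r.
apply: (@preimage_closed _ _ (fun y : 'rV[R]_n => `|y - x|) [set t : R | t <= r]); last exact: closed_le.
move=> y _; apply: (@continuous_comp _ _ _ (fun y : 'rV[R]_n => y - x) Num.norm).
  by apply: continuousB; [exact: cvg_id|exact: cst_continuous].
exact: norm_continuous.
Qed.

Lemma open_ball_norm x r : open [set y : 'rV[R]_n | `|y - x| < r].
Proof.
apply: (@open_comp _ _ (fun y : 'rV[R]_n => `|y - x|) [set t : R | t < r]); last exact: open_lt.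
move=> y _; apply: (@continuous_comp _ _ _ (fun y : 'rV[R]_n => y - x) Num.norm).
  by apply: continuousB; [exact: cvg_id|exact: cst_continuous].
exact: norm_continuous.
Qed.

Lemma mulmx_norm x A : `|x *m A| <= n%:R * (`|x| * `|A|).
Proof.
apply: mx_norm_le => [|i k]; first by rewrite mulr_ge0 // mulr_ge0.
rewrite ord1 mxE; apply: le_trans (ler_norm_sum _ _ _) _.
apply: (@le_trans _ _ (\sum_(l < n) `|x| * `|A|)).
  by apply: ler_sum => l _; rewrite normrM; apply: ler_pM => //; exact: mx_norm_ge.
by rewrite sumr_const card_ord -[_ *+ n]mulr_natl.
Qed.

Lemma Ck_slice (Phi : 'rV[R]_n.+1 -> 'rV[R]_n) t x : differentiable Phi (tpt t x) ->
  row' 0 (jacobian Phi (tpt t x)) = jacobian (fun y => Phi (tpt t y)) x.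
Proof.
move=> dP.
have dt : differentiable (tpt t) x.
  apply/differentiable_mxP => i k; rewrite ord1; case: (unliftP 0 k) => [l|] ->.
    rewrite (_ : (fun y => _) = (fun y : 'rV[R]_n => y 0 l)).
      exact: differentiable_coord.
    by apply/funext => y; rewrite tptE2.
  rewrite (_ : (fun y => _) = cst t); first exact: differentiable_cst.
  by apply/funext => y; rewrite tptE1.
apply/matrixP => i k; rewrite mxE [LHS](jacobian_coord _ _ dP).
rewrite [RHS](jacobian_coord _ _ (differentiable_comp dt dP)).
by rewrite (@derive_tpt2 _ _ (fun p => Phi p 0 k)).
Qed.

Lemma jacobian_affine A (b x : 'rV[R]_n) : jacobian (fun y => y *m A + b) x = A.
Proof.
have d : differentiable (fun y : 'rV[R]_n => y *m A + b) x.
  apply: differentiableD; last exact: differentiable_cst.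
  apply/differentiable_mxP => i k.
  rewrite (_ : (fun y => _) = (fun y : 'rV[R]_n => \sum_l y i l * A l k)); last first.
    by apply/funext => y; rewrite mxE.
  have [_] := derive_sumr (index_enum 'I_n) (0 : 'rV[R]_n)
    (fun l => differentiableM (differentiable_coord x i l) (differentiable_cst (A l k) x)).
  exact.
apply/row_matrixP => i; rewrite (row_jacobian i d) rowE.
apply: cvg_lim => //; apply: cvg_near_cst.
have : \forall h \near (0 : R)^', h != 0 by exact: nbhs_dnbhs_neq.
apply: filterS => h h0; rewrite /= mulmxDl -[_ + _ + b]addrA addrK.
by rewrite -scalemxAl scalerA mulVf // scale1r.
Qed.

Lemma homotopy_densityE (U : set 'rV[R]_n) (Phi : 'rV[R]_n.+1 -> 'rV[R]_n) h t x :
  Ck_on 2 (tpt2 @^-1` U) Phi -> U x ->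
  homotopy_density U Phi h t x =
  h (Phi (tpt t x)) * \det (jacobian (fun y => Phi (tpt t y)) x).
Proof.
move=> Phi2 Ux; rewrite /homotopy_density mem_set // Ck_slice //.
by have [d _] := Ck_onSP Phi2; apply: d; rewrite /= tpt2K.
Qed.

Lemma homotopy_density_affine (Phi : 'rV[R]_n.+1 -> 'rV[R]_n) h t x A b :
  Ck_on 2 (tpt2 @^-1` setT) Phi -> (fun y => Phi (tpt t y)) = (fun y => y *m A + b) ->
  homotopy_density setT Phi h t x = h (x *m A + b) * \det A.
Proof.
move=> Phi2 E; rewrite homotopy_densityE // E jacobian_affine.
by rewrite -[Phi _]/((fun y => Phi (tpt t y)) x) E.
Qed.

Lemma Ck_tpt1 k U : Ck_on k U (@tpt1 R n).
Proof. exact: Ck_coord. Qed.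

Lemma Ck_tpt2 k U l : open U -> Ck_on k U (fun p : 'rV[R]_n.+1 => tpt2 p 0 l).
Proof.
move=> oU; apply: (Ck_on_ext oU _ (@Ck_coord _ k 1 n.+1 U 0 (lift 0 l))) => p _.
by rewrite tpt2E.
Qed.

Lemma invmx_norm_bound A x : A \in unitmx ->
  `|x| <= n%:R * (`|x *m A| * `|invmx A|).
Proof. by move=> uA; rewrite -{1}[x](mulmxK uA); exact: mulmx_norm. Qed.

(** The homotopy x + t b moves points by at most |b|, so all supports stay in one ball. *)
Lemma null_translation h b r : Ck_on 1 setT h -> supp_ball h r ->
  null_seq (fun j => grid_sum j (fun x => h (x + b)) - grid_sum j h).
Proof.
move=> h1 hr.
pose Phi (p : 'rV[R]_n.+1) := tpt2 p + tpt1 p *: b.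
have oT : open (tpt2 @^-1` (setT : set 'rV[R]_n)) by exact: openT.
have Phi2 : Ck_on 2 (tpt2 @^-1` (setT : set 'rV[R]_n)) Phi.
  apply/Ck_mxP => // i k; rewrite ord1.
  apply: (@Ck_on_ext _ _ _ 2 _ (fun p => tpt2 p 0 k + tpt1 p * b 0 k)) => //.
    by move=> p _; rewrite !mxE.
  apply: Ck_add => //; first exact: Ck_tpt2.
  by apply: Ck_mul => //; [exact: Ck_tpt1|exact: Ck_cst].
have PhiE t : (fun y => Phi (tpt t y)) = (fun y => y *m 1%:M + t *: b).
  by apply/funext => y; rewrite /Phi tpt1K tpt2K mulmx1.
have H : null_seq (fun j => grid_sum j (homotopy_density setT Phi h 1) -
    grid_sum j (homotopy_density setT Phi h 0)).
  move=> e e0.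
  apply: (homotopy_grid_sum openT (@closed_ball_compact 0 (r + `|b|)) (fun _ _ => I) Phi2 h1 _ e0).
  move=> t x /andP[t0 t1] _ nK.
  apply: hr; rewrite ltNge; apply/negP => hle; apply: nK; rewrite /= subr0.
  have h2 := ler_normB (Phi (tpt t x)) (t *: b).
  rewrite {1}/Phi tpt1K tpt2K addrK normrZ ger0_norm // in h2.
  by apply: le_trans h2 _; apply: lerD => //; rewrite ler_piMl.
apply: eq_null_seq H => j; congr (_ - _); apply: eq_grid_sum => x.
  by rewrite (homotopy_density_affine _ _ Phi2 (PhiE 1)) det1 mulr1 mulmx1 scale1r.
by rewrite (homotopy_density_affine _ _ Phi2 (PhiE 0)) det1 mulr1 mulmx1 scale0r addr0.
Qed.

Lemma Ck_idV (V : normedModType R) k (U : set V) : Ck_on k U (id : V -> V).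
Proof.
case: k => [|k]; first by move=> x _; exact: cvg_id.
split=> [x _|v]; first exact: (@ex_diff _ _ _ _ _ id id (is_diff_id x)).
have -> : 'D_v (id : V -> V) = fun=> v by apply/funext => x; rewrite derive_id.
exact: Ck_cst.
Qed.

Definition segment_mx A B (t : R) := (1 - t) *: A + t *: B.

(** The entries of the inverse are cofactors over the determinant, hence continuous and bounded on
    [0,1]. The bound keeps the supports of the functions x |-> h(x S_t) in one compact set, as
    [homotopy_grid_sum] requires. *)
Lemma segment_mx_bound A B : (forall t, 0 <= t <= 1 -> \det (segment_mx A B t) != 0) ->
  exists2 C, 0 <= C & forall t x, 0 <= t <= 1 -> `|x| <= C * `|x *m segment_mx A B t|.
Proof.
move=> dAB; pose S := segment_mx A B.
have oT : open (setT : set R) by exact: openT.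
have S1 k i l : Ck_on k setT (fun t : R => S t i l).
  apply: (@Ck_on_ext _ _ _ k setT (fun t : R => (1 - t) * A i l + t * B i l)) => //.
    by move=> t _; rewrite !mxE.
  apply: Ck_add => //; apply: Ck_mul => //; try exact: Ck_cst; last exact: Ck_idV.
  by apply: Ck_sub => //; [exact: Ck_cst|exact: Ck_idV].
pose g i l t := (\det (S t))^-1 * \adj (S t) i l.
have D0 : Ck_on 0 setT (fun t : R => \det (S t)).
  by apply: Ck_det => // i' l'; exact: S1.
pose O := [set t | \det (S t) != 0].
have oO : open O.
  apply: (@open_comp _ _ (fun t : R => \det (S t)) [set y : R | y != 0]) => [t _|].
    exact: D0.
  exact: open_neq.
have cg i l : Ck_on 0 O (g i l).
  have A0 : Ck_on 0 setT (fun t : R => \adj (S t) i l).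
    apply: (@Ck_on_ext _ _ _ 0 setT
      (fun t : R => (-1) ^+ (l + i) * \det (row' l (col' i (S t))))) => //.
      by move=> s _; rewrite [RHS]mxE.
    apply: Ck_mul => //; first exact: Ck_cst.
    apply: Ck_det => // i' l'.
    apply: (Ck_on_ext oT _ (S1 0 (lift l i') (lift i l'))) => s _.
    by rewrite [RHS]mxE [RHS]mxE.
  apply: Ck_mul => //; last exact: Ck_on_sub A0.
  by apply: Ck_inv => //; exact: Ck_on_sub D0.
pose G t := \sum_i \sum_l `|g i l t|.
have cG : {within `[0, 1], continuous G}.
  apply: continuous_in_subspaceT => t; rewrite inE /= in_itv /= => t01.
  have : Ck_on 0 O G.
    apply: Ck_sum => // i _; apply: Ck_sum => // l _ s Os.
    exact: (continuous_comp (cg i l s Os) (@norm_continuous _ _ _)).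
  by apply; exact: dAB.
have [c c01 hc] := EVT_max ler01 cG.
exists (n%:R * G c) => [|t x t01].
  by rewrite mulr_ge0 //; apply: sumr_ge0 => i _; apply: sumr_ge0.
have uS : S t \in unitmx by rewrite unitmxE unitfE dAB.
apply: le_trans (invmx_norm_bound x uS) _; rewrite -mulrA ler_wpM2l // mulrC ler_wpM2r //.
apply: le_trans (hc t _); last by rewrite in_itv.
have G0 i l : `|g i l t| <= G t.
  rewrite /G (bigD1 i) //= (bigD1 l) //= -addrA lerDl addr_ge0 //.
    exact: sumr_ge0.
  by apply: sumr_ge0 => i' _; exact: sumr_ge0.
apply: mx_norm_le => [|i l]; first by apply: sumr_ge0 => i _; exact: sumr_ge0.
by apply: le_trans (G0 i l); rewrite /invmx uS mxE.
Qed.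

Lemma null_segment A B h r : (forall t, 0 <= t <= 1 -> \det (segment_mx A B t) != 0) ->
  Ck_on 1 setT h -> supp_ball h r ->
  null_seq (fun j => grid_sum j (fun x => h (x *m B)) * \det B -
    grid_sum j (fun x => h (x *m A)) * \det A).
Proof.
move=> dAB h1 hr; have [C C0 hC] := segment_mx_bound dAB.
pose Phi (p : 'rV[R]_n.+1) := tpt2 p *m segment_mx A B (tpt1 p).
have oT : open (tpt2 @^-1` (setT : set 'rV[R]_n)) by exact: openT.
have Phi2 : Ck_on 2 (tpt2 @^-1` (setT : set 'rV[R]_n)) Phi.
  apply/Ck_mxP => // i k; rewrite ord1.
  apply: (@Ck_on_ext _ _ _ 2 _ (fun p => \sum_l tpt2 p 0 l * ((1 - tpt1 p) * A l k + tpt1 p * B l k))) => //.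
    by move=> p _; rewrite [RHS]mxE; apply: eq_bigr => l _; congr (_ * _); rewrite !mxE.
  apply: Ck_sum => // l _; apply: Ck_mul => //; first exact: Ck_tpt2.
  apply: Ck_add => //; apply: Ck_mul => //; try exact: Ck_cst; last exact: Ck_tpt1.
  by apply: Ck_sub => //; [exact: Ck_cst|exact: Ck_tpt1].
have PhiE t : (fun y => Phi (tpt t y)) = (fun y => y *m segment_mx A B t + 0).
  by apply/funext => y; rewrite /Phi tpt1K tpt2K addr0.
have H : null_seq (fun j => grid_sum j (homotopy_density setT Phi h 1) -
    grid_sum j (homotopy_density setT Phi h 0)).
  move=> e e0.
  apply: (homotopy_grid_sum openT (@closed_ball_compact 0 (C * r)) (fun _ _ => I) Phi2 h1 _ e0).
  move=> t x t01 _ nK.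
  apply: hr; rewrite ltNge; apply/negP => hle; apply: nK; rewrite /= subr0.
  apply: le_trans (hC t x t01) _; apply: ler_wpM2l => //.
  by move: hle; rewrite /Phi tpt1K tpt2K.
apply: eq_null_seq H => j; rewrite ![_ * \det _]mulrC -!grid_sumZ.
congr (_ - _); apply: eq_grid_sum => x.
  rewrite (homotopy_density_affine _ _ Phi2 (PhiE 1)) addr0 /segment_mx subrr.
  by rewrite scale0r add0r scale1r mulrC.
rewrite (homotopy_density_affine _ _ Phi2 (PhiE 0)) addr0 /segment_mx subr0.
by rewrite scale0r addr0 scale1r mulrC.
Qed.

Lemma Ck_comp_affine k h A b : Ck_on k setT h -> Ck_on k setT (fun x => h (x *m A + b)).
Proof.
move=> hk; apply: (Ck_comp (f := fun x => x *m A + b) openT _ hk) => //.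
apply/Ck_mxP => [|i l]; first exact: openT.
rewrite ord1; apply: (@Ck_on_ext _ _ _ k setT (fun x : 'rV[R]_n => \sum_m x 0 m * A m l + b 0 l)).
  exact: openT.
  by move=> x _; rewrite !mxE.
apply: Ck_add; [exact: openT| |exact: Ck_cst].
apply: Ck_sum => [|m _]; first exact: openT.
by apply: Ck_mul; [exact: openT|exact: Ck_coord|exact: Ck_cst].
Qed.

Lemma Ck_comp_mulmx k h A : Ck_on k setT h -> Ck_on k setT (fun x => h (x *m A)).
Proof.
move=> hk; apply: Ck_on_ext openT _ (Ck_comp_affine A 0 hk) => x _.
by rewrite addr0.
Qed.

Lemma supp_ball_mulmx h A r : A \in unitmx -> supp_ball h r ->
  supp_ball (fun x => h (x *m A)) (n%:R * (r * `|invmx A|)).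
Proof.
move=> uA hr x hx; apply: hr; rewrite ltNge; apply/negP => hle.
have := lt_le_trans hx (invmx_norm_bound x uA); apply/negP; rewrite -leNgt.
by apply: ler_wpM2l => //; apply: ler_wpM2r.
Qed.

Definition preserves_volume A := forall h r, Ck_on 1 setT h -> supp_ball h r ->
  null_seq (fun j => grid_sum j (fun x => h (x *m A)) * `|\det A| - grid_sum j h).

Lemma preserves_volumeM A B : B \in unitmx ->
  preserves_volume A -> preserves_volume B -> preserves_volume (A *m B).
Proof.
move=> uB pA pB h r h1 hr.
have hA := null_seqZ `|\det B| (pA _ _ (Ck_comp_mulmx B h1) (supp_ball_mulmx uB hr)).
apply: eq_null_seq (null_seqD hA (pB _ _ h1 hr)) => j.
rewrite det_mulmx normrM; under [in RHS]eq_grid_sum do rewrite mulmxA.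
by move: (grid_sum _ _) (grid_sum _ _) (grid_sum _ _) => a b c; ring.
Qed.

Lemma preserves_volume_signed_perm s p :
  `|\det (signed_perm s p : 'M[R]_n)| = 1 -> preserves_volume (signed_perm s p).
Proof.
move=> d1 h r h1 hr; apply: eq_null_seq (@null_seq0 _) => j.
by rewrite grid_sum_signed_perm d1 mulr1 subrr.
Qed.

(** [null_segment] compares sums weighted by signed determinants. The second hypothesis says that
    both determinants have the same sign, so the comparison passes to absolute values. *)
Lemma preserves_volume_segment A B :
  (forall t, 0 <= t <= 1 -> \det (segment_mx A B t) != 0) ->
  \det A * `|\det B| = \det B * `|\det A| -> preserves_volume B -> preserves_volume A.
Proof.
move=> dAB sgn pB h r h1 hr.
have B0 : \det B != 0.
  by have := dAB 1; rewrite /segment_mx subrr scale0r add0r scale1r; apply; rewrite ler01 lexx.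
have HA := null_seqZ (- (`|\det B| / \det B)) (null_segment dAB h1 hr).
apply: eq_null_seq (null_seqD HA (pB _ _ h1 hr)) => j.
move: (grid_sum _ _) (grid_sum _ _) (grid_sum _ _) => a b c.
have -> : `|\det A| = \det A * `|\det B| / \det B by rewrite sgn mulrAC mulfV // mul1r.
by field.
Qed.

End ChangeOfVariables.

Section LinearChange.
Context {R : realType} {n : nat}.

(* The segment from T to the diagonal matrix of signs of its diagonal consists
   of invertible matrices, and signed permutations preserve the lattice. *)
Lemma preserves_volume_triangular (T : 'M[R]_n.+1) :
  (forall i, T i i != 0) ->
  is_trig_mx T \/ is_trig_mx T^T -> preserves_volume T.
Proof.
move=> T0 hT.
pose S := signed_perm (fun i => T i i < 0) 1%g : 'M[R]_n.+1.
have detE (M : 'M[R]_n.+1) : is_trig_mx M \/ is_trig_mx M^T -> \det M = \prod_i M i i.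
  case=> h; first exact: det_trig.
  by rewrite -det_tr det_trig //; apply: eq_bigr => i _; rewrite mxE.
have SE i k : S i k = (-1) ^+ (T i i < 0)%R * (i == k)%:R.
  by rewrite mxE perm1; case: eqP => [->|]; rewrite ?mulr0.
have segT t : is_trig_mx (segment_mx T S t) \/ is_trig_mx (segment_mx T S t)^T.
  case: hT => /is_trig_mxP h; [left|right]; apply/is_trig_mxP => i k ik.
    have ik' : i != k by rewrite neq_ltn ik.
    by rewrite !mxE perm1 (negbTE ik') h // !mulr0 addr0.
  have ik' : k != i by rewrite neq_ltn ik orbT.
  have := h i k ik; rewrite !mxE perm1 (negbTE ik') => ->.
  by rewrite !mulr0 addr0.
have dS : \det S = \prod_i (-1) ^+ (T i i < 0)%R.
  rewrite (detE S); first by apply: eq_bigr => i _; rewrite SE eqxx mulr1.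
  by have := segT 1; rewrite /segment_mx subrr scale0r add0r scale1r.
have dS1 : `|\det S| = 1.
  by rewrite dS normr_prod big1 // => i _; rewrite normrX normrN1 expr1n.
apply: (@preserves_volume_segment _ _ _ S); last exact: preserves_volume_signed_perm.
  move=> t /andP[t0 t1]; rewrite detE //; apply/prodf_neq0 => i _.
  rewrite !mxE perm1 eqxx mulr1; have := T0 i; case: ltgtP => // Ti _; rewrite ?expr0 ?expr1.
    rewrite lt_eqF //; have [->|tn0] := eqVneq t 0; first by lra.
    have : 0 < t by rewrite lt_neqAle eq_sym tn0.
    by nra.
  rewrite gt_eqF //; have [->|tn0] := eqVneq t 0; first by lra.
  have : 0 < t by rewrite lt_neqAle eq_sym tn0.
  by nra.
rewrite dS1 mulr1 detE // dS normr_prod -big_split /=; apply: eq_bigr => i _.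
case: ltrP => Ti; rewrite ?expr1 ?expr0.
  by rewrite mulN1r ltr0_norm // opprK.
by rewrite mul1r ger0_norm.
Qed.

(** In the decomposition P A = L U the permutation is an exact symmetry of the lattice, and both
    triangular factors have a diagonal without zeros. *)
Lemma preserves_volume_unitmx (A : 'M[R]_n.+1) : A \in unitmx -> preserves_volume A.
Proof.
move=> uA; have := cormen_lup_correct A; have := cormen_lup_perm A.
have := cormen_lup_detL A; have := @cormen_lup_lower _ _ A; have := @cormen_lup_upper _ _ A.
case: (cormen_lup A) => -[P L] U /= hU hL dL /is_perm_mxP[s ->] E.
have uP : (perm_mx s : 'M[R]_n.+1) \in unitmx by rewrite unitmx_perm.
have uL : L \in unitmx by rewrite unitmxE dL unitr1.
have uU : U \in unitmx.
  have : perm_mx s *m A \in unitmx by rewrite unitmx_mul uP.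
  by rewrite -[_ *m A]/(perm_mx s * A) E unitmx_mul => /andP[].
have -> : A = perm_mx (s^-1)%g *m (L *m U).
  by rewrite -[L *m U]/(L * U) -E -[perm_mx s * A]/(_ *m _) mulmxA -perm_mxM mulVg perm_mx1 mul1mx.
have trU : is_trig_mx U^T by apply/is_trig_mxP => i k ik; rewrite mxE hU.
have U0 i : U i i != 0.
  move: uU; rewrite unitmxE unitfE -det_tr det_trig // => /prodf_neq0/(_ i isT).
  by rewrite mxE.
apply: preserves_volumeM; first by rewrite unitmx_mul uL.
  have -> : perm_mx (s^-1)%g = signed_perm (fun=> false) s :> 'M[R]_n.+1.
    by apply/matrixP => i k; rewrite !mxE expr0 mul1r (canF_eq (permKV s)).
  apply: preserves_volume_signed_perm.
  have -> : signed_perm (fun=> false) s = perm_mx (s^-1)%g :> 'M[R]_n.+1.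
    by apply/matrixP => i k; rewrite !mxE expr0 mul1r (canF_eq (permKV s)).
  by rewrite det_perm normrX normrN1 expr1n.
apply: preserves_volumeM => //; apply: preserves_volume_triangular => //; last by right.
  by move=> i; rewrite hL // eqxx oner_neq0.
left; apply/is_trig_mxP => i k ik; have neq_ik : i != k by rewrite neq_ltn ik.
rewrite hL; last exact: ltnW.
by rewrite (negbTE neq_ik).
Qed.

End LinearChange.

(** * Asymptotic invariance under local diffeomorphisms *)

Section LocalChange.
Context {R : realType} {n : nat}.
Implicit Types (h : 'rV[R]_n -> R) (A B : 'M[R]_n) (x : 'rV[R]_n).

Lemma preserves_volume_unit A : A \in unitmx -> preserves_volume A.
Proof.
case: n A => [|n'] A uA; last exact: preserves_volume_unitmx.
move=> h r _ _; apply: eq_null_seq (@null_seq0 R) => j.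
rewrite det_mx00 normr1 mulr1 -grid_sumB; apply/esym.
rewrite -[RHS](@grid_sum0 R 0 j); apply: eq_grid_sum => x.
by rewrite (thinmx0 (x *m A)) (thinmx0 x) subrr.
Qed.

Lemma jacobian_diff (m : nat) (f : 'rV[R]_n -> 'rV[R]_m) x v :
  differentiable f x -> 'd f x v = v *m jacobian f x.
Proof. by move=> df; rewrite mul_rV_lin1. Qed.

Lemma linear_approximation (m : nat) (f : 'rV[R]_n -> 'rV[R]_m) x0 e : differentiable f x0 -> 0 < e ->
  exists2 r, 0 < r & forall x, `|x - x0| < r ->
    `|f x - f x0 - (x - x0) *m jacobian f x0| <= e * `|x - x0|.
Proof.
move=> df e0; have /eqaddoP/(_ e e0) := diff_locally df.
rewrite near_nbhs => /nbhs_normP[r /= r0 hr]; exists r => // x xr.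
have /hr /= : ball_ Num.norm 0 r (x - x0) by rewrite /= sub0r normrN.
by rewrite !fctE /= subrK jacobian_diff // opprD addrA.
Qed.

(* Deform phi to its affine approximation at x0. *)
Lemma null_local (phi : 'rV[R]_n -> 'rV[R]_n) O x0 : open O -> O x0 -> Ck_on 2 O phi ->
  jacobian phi x0 \in unitmx ->
  exists r s, [/\ 0 < r, 0 < s, forall x, `|x - x0| < r -> O x &
    forall h, Ck_on 1 setT h -> (forall y, s <= `|y - phi x0| -> h y = 0) ->
      null_seq (fun j => grid_sum j (fun x => if `|x - x0| < r
          then h (phi x) * \det (jacobian phi x) else 0)
        - Num.sg (\det (jacobian phi x0)) * grid_sum j h)].
Proof.
move=> oO Ox0 phi2 uA; set A := jacobian phi x0.
have [dphi _] := Ck_onSP phi2.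
(* [q] bounds the dilation of [A] from below; the summand 1 keeps [C] positive even if n = 0. *)
pose C := n%:R * `|invmx A| + 1; pose q := C^-1.
have C0 : 0 < C by rewrite ltr_wpDl // mulr_ge0.
have q0 : 0 < q by rewrite invr_gt0.
have hq x : q * `|x| <= `|x *m A|.
  rewrite mulrC ler_pdivrMr //; apply: le_trans (invmx_norm_bound x uA) _.
  rewrite mulrCA; apply: ler_wpM2l => //.
  by rewrite lerDl.
have q20 : 0 < q / 2 by rewrite divr_gt0.
have [r1 r10 hr1] := linear_approximation (dphi _ Ox0) q20.
have [r2 /= r20 hr2] : exists2 r2, 0 < r2 & forall x, `|x - x0| < r2 -> O x.
  have /nbhs_normP[r2 r20 hr2] := open_nbhs_nbhs (conj oO Ox0).
  by exists r2 => // x xr; apply: hr2; rewrite /= distrC.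
(* On the ball of radius r the homotopy differs from the affine map by at most (q / 2) |x - x0|, so
   |Phi - phi x0| >= (q / 2) |x - x0|. With s = (q / 2)(r / 2), the function h o Phi vanishes
   between the radii r / 2 and r for every t in [0,1]. *)
pose r := Num.min r1 r2; pose s := q * r / 4.
have r0 : 0 < r by rewrite lt_min r10.
have s0 : 0 < s by rewrite divr_gt0 // mulr_gt0.
pose U := [set x : 'rV[R]_n | `|x - x0| < r].
have UO x : U x -> O x by move=> Ux; apply: hr2; move: Ux; rewrite /U /= lt_min => /andP[].
exists r, s; split=> // h h1 hs.
pose b := phi x0 - x0 *m A.
pose Phi p := tpt2 p *m A + b + tpt1 p *: (phi (tpt2 p) - (tpt2 p *m A + b)).
have oU : open U by exact: open_ball_norm.
have oU' : open (tpt2 @^-1` U) by apply: open_comp => // p _; exact: tpt2_continuous.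
have t2 : Ck_on 2 (tpt2 @^-1` U) (@tpt2 R n).
  by apply/(Ck_mxP _ _ oU') => i k; rewrite ord1; exact: Ck_tpt2.
have aff k : Ck_on 2 (tpt2 @^-1` U) (fun p => (tpt2 p *m A + b) 0 k).
  apply: (@Ck_on_ext _ _ _ 2 _ (fun p => \sum_l tpt2 p 0 l * A l k + b 0 k)) => //.
    by move=> p _; rewrite !mxE.
  apply: Ck_add => //; last exact: Ck_cst.
  apply: Ck_sum => // l _; apply: Ck_mul => //; first exact: Ck_tpt2.
  exact: Ck_cst.
have Phi2 : Ck_on 2 (tpt2 @^-1` U) Phi.
  apply/(Ck_mxP _ _ oU') => i k; rewrite ord1.
  apply: (@Ck_on_ext _ _ _ 2 _ (fun p => (tpt2 p *m A + b) 0 k +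
      tpt1 p * (phi (tpt2 p) 0 k - (tpt2 p *m A + b) 0 k))) => //.
    by move=> p _; rewrite [RHS]mxE [X in _ = _ + X]mxE [X in _ = _ + _ * X]mxE [X in _ = _ + _ * (_ + X)]mxE.
  apply: Ck_add => //; apply: Ck_mul => //; first exact: Ck_tpt1.
  apply: Ck_sub => //; apply: (Ck_comp oU' t2 (g := fun y => phi y 0 k) (O := O)).
    by move/(Ck_mxP _ _ oO): phi2; apply.
  by move=> p; exact: UO.
have affE x : x *m A + b = phi x0 + (x - x0) *m A.
  by rewrite /b mulmxBl addrCA.
have low t x : 0 <= t <= 1 -> U x -> q / 2 * `|x - x0| <= `|Phi (tpt t x) - phi x0|.
  move=> /andP[t0 t1] Ux.
  have /hr1 h1x : `|x - x0| < r1 by move: Ux; rewrite /U /= lt_min => /andP[].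
  have -> : Phi (tpt t x) - phi x0 =
      (x - x0) *m A + t *: (phi x - phi x0 - (x - x0) *m A).
    by rewrite /Phi tpt1K tpt2K affE addrAC [phi x0 + _ - _]addrAC subrr add0r opprD addrA.
  have h2 := hq (x - x0).
  have h3 : `|t *: (phi x - phi x0 - (x - x0) *m A)| <= q / 2 * `|x - x0|.
    rewrite normrZ ger0_norm //; apply: le_trans h1x.
    by rewrite ler_piMl.
  have := lerB_normD ((x - x0) *m A) (t *: (phi x - phi x0 - (x - x0) *m A)).
  move: h2 h3; move: `|_ + _| `|_ *m _| `|_ *: _| `|x - x0| => c1 c2 c3 c4 h2 h3 h4.
  by lra.
have PhiE t : (fun y => Phi (tpt t y)) =
    (fun y => y *m A + b + t *: (phi y - (y *m A + b))).
  by apply/funext => y; rewrite /Phi tpt1K tpt2K.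
have H : null_seq (fun j => grid_sum j (homotopy_density U Phi h 1) -
    grid_sum j (homotopy_density U Phi h 0)).
  move=> e e0.
  apply: (homotopy_grid_sum oU (@closed_ball_compact _ _ x0 (r / 2)) _ Phi2 h1 _ e0).
    by move=> x /= xr; apply: le_lt_trans xr _; rewrite ltr_pdivrMr // ltr_pMr // ltr1n.
  move=> t x t01 Ux nK; apply: hs; apply: le_trans (low t x t01 Ux).
  have : r / 2 <= `|x - x0| by rewrite leNgt; apply/negP => /ltW.
  move=> h2; have -> : s = q / 2 * (r / 2) by rewrite /s; field.
  by apply: ler_wpM2l h2; exact: ltW.
have E1 x : homotopy_density U Phi h 1 x =
    if `|x - x0| < r then h (phi x) * \det (jacobian phi x) else 0.
  case: ifPn => Ux; last by rewrite /homotopy_density memNset //; exact/negP.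
  have E : (fun y => Phi (tpt 1 y)) = phi.
    by rewrite PhiE; apply/funext => y; rewrite scale1r addrC subrK.
  rewrite (homotopy_densityE h 1 Phi2 Ux) E.
  by rewrite (congr1 (@^~ x) E : Phi (tpt 1 x) = phi x).
have E0 x : homotopy_density U Phi h 0 x = h (x *m A + b) * \det A.
  have E : (fun y => Phi (tpt 0 y)) = (fun y => y *m A + b).
    by rewrite PhiE; apply/funext => y; rewrite scale0r addr0.
  have [Ux|Ux] := pselect (U x).
    rewrite (homotopy_densityE h 0 Phi2 Ux) E jacobian_affine.
    by rewrite (congr1 (@^~ x) E : Phi (tpt 0 x) = x *m A + b).
  rewrite /homotopy_density memNset // hs ?mul0r // affE addrC addKr.
  apply: le_trans (hq _); have : r <= `|x - x0| by rewrite leNgt; apply/negP.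
  move=> /(ler_wpM2l (ltW q0)); apply: le_trans.
  by rewrite /s ler_pdivrMr // ler_peMr ?ler1n // mulr_ge0 // ltW.
have hb : Ck_on 1 setT (fun x => h (x + b)).
  have -> : (fun x => h (x + b)) = (fun x => h (x *m 1%:M + b)).
    by apply/funext => x; rewrite mulmx1.
  exact: Ck_comp_affine.
have sh : supp_ball h (s + `|phi x0|).
  move=> y hy; apply: hs; have := ler_normB (y - phi x0) (- phi x0).
  rewrite opprK subrK normrN => h2; move: (lt_le_trans hy h2).
  by rewrite ltrD2r => /ltW.
have shb : supp_ball (fun x => h (x + b)) (s + `|phi x0| + `|b|).
  move=> y hy; apply: sh; have := ler_normB (y + b) b.
  rewrite addrK => h2; move: (lt_le_trans hy h2).
  by rewrite ltrD2r.
(* At t = 0 the map is affine: [V1] removes its linear part and [V2] the translation. The sign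
   remains because the Jacobian determinant is not taken in absolute value. *)
have V1 := null_seqZ (Num.sg (\det A)) (preserves_volume_unit uA hb shb).
have V2 := null_seqZ (Num.sg (\det A)) (null_translation b h1 sh).
apply: eq_null_seq (null_seqD H (null_seqD V1 V2)) => j.
under [X in X - _ + _]eq_grid_sum do rewrite E1.
under [X in _ - X + _]eq_grid_sum do rewrite E0 mulrC.
rewrite grid_sumZ [\det A in X in _ - X + _]numEsg.
by move: (grid_sum _ _) (grid_sum _ _) (grid_sum _ _) (grid_sum _ _) => a1 a2 a3 a4; ring.
Qed.

End LocalChange.

(** * Integration on a compact manifold *)

Section ManifoldFunctions.

Section Charts.
Context {R : realType} {n : nat} {T : topologicalType}.
Implicit Types (c d : chart R n T).

Lemma cinvP c x : cim c x -> cdom c (cinv c x) /\ cmap c (cinv c x) = x.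
Proof. by move=> [p cp <-]; rewrite cmapK ?inE. Qed.

Lemma cim_cmap c p : cdom c p -> cim c (cmap c p).
Proof. by exists p. Qed.

Lemma cinv_cmap c p : cdom c p -> cinv c (cmap c p) = p.
Proof. by move=> cp; rewrite cmapK ?inE. Qed.

Lemma cinv_cvg c x : cim c x -> cinv c y @[y --> x] --> cinv c x.
Proof. by move=> cx; exact: (cinv_continuous (mem_set cx)). Qed.

Lemma open_cim_preimage c (A : set T) : open A -> open [set x | cim c x /\ A (cinv c x)].
Proof.
rewrite !openE => oA x [cx Ax].
have h1 : nbhs x (cim c) by exact: (open_nbhs_nbhs (conj (@cim_open _ _ _ c) cx)).
have h2 : nbhs x (cinv c @^-1` A) by exact: (cinv_cvg cx (oA _ Ax)).
exact: filterI h1 h2.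
Qed.

Lemma open_cdom_preimage c (A : set 'rV[R]_n) : open A ->
  open [set p | cdom c p /\ A (cmap c p)].
Proof.
rewrite !openE => oA p [cp Ap].
have h1 : nbhs p (cdom c) by exact: (open_nbhs_nbhs (conj (@cdom_open _ _ _ c) cp)).
have h2 : nbhs p (cmap c @^-1` A) by exact: (cmap_continuous (mem_set cp) (oA _ Ap)).
exact: filterI h1 h2.
Qed.

End Charts.

Section LocalRepresentation.
Context {R : realType} {n m : nat} {S T : topologicalType}.
Variables (f : S -> T) (c : chart R n S) (d : chart R m T).

Lemma locdomE : locdom f c d = [set x | cim c x /\ cdom d (f (cinv c x))].
Proof.
apply/seteqP; split=> [x [p [cp dp] <-]|x [cx dx]] /=.
  by rewrite cinv_cmap //; split; [exact: cim_cmap|].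
by have [h1 h2] := cinvP cx; exists (cinv c x).
Qed.

Lemma open_locdom : continuous f -> open (locdom f c d).
Proof.
move=> cf; rewrite locdomE; apply: (@open_cim_preimage _ _ _ c (f @^-1` cdom d)).
by apply: open_comp; [move=> x _; exact: cf|exact: cdom_open].
Qed.

Lemma locrep_cim x : locdom f c d x -> cim d (locrep f c d x).
Proof. by rewrite locdomE => -[_ h]; exact: cim_cmap. Qed.

End LocalRepresentation.

Section Transitions.
Context {R : realType} {n : nat} {T : topologicalType}.
Implicit Types (c d : chart R n T).

Lemma overlapE c d : overlap c d = [set x | cim c x /\ cdom d (cinv c x)].
Proof. exact: locdomE. Qed.

Lemma open_overlap c d : open (overlap c d).
Proof. by apply: open_locdom => x; exact: cvg_id. Qed.

Lemma cinv_transition c d x : overlap c d x -> cinv d (transition c d x) = cinv c x.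
Proof. by rewrite overlapE => -[_ h]; rewrite /transition /locrep cinv_cmap. Qed.

Lemma overlap_transition c d x : overlap c d x -> overlap d c (transition c d x).
Proof.
move=> h; rewrite overlapE /= cinv_transition //; move: h; rewrite overlapE => -[h1 h2].
by split; [exact: cim_cmap|have [] := cinvP h1].
Qed.

Lemma transitionK c d x : overlap c d x -> transition d c (transition c d x) = x.
Proof.
move=> h; rewrite {1}/transition /locrep cinv_transition //.
by move: h; rewrite overlapE => -[/cinvP[]].
Qed.

Lemma overlap_cmap c d p : cdom c p -> cdom d p -> overlap c d (cmap c p).
Proof. by move=> cp dp; exists p. Qed.

Lemma transition_cmap c d p : cdom c p -> transition c d (cmap c p) = cmap d p.
Proof. by move=> cp; rewrite /transition /locrep cinv_cmap. Qed.

End Transitions.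

Context {R : realType} {n : nat} (N : smoothManifold R n).
Implicit Types (c d : chart R n N) (u w : N -> R).

Lemma transition_smooth c d : atlas c -> atlas d -> smooth_on (overlap c d) (transition c d).
Proof. by move=> ac ad; have [] := atlas_compatible ac ad. Qed.

Lemma jacobian_transition c d x : atlas c -> atlas d -> overlap c d x ->
  jacobian (transition c d) x *m jacobian (transition d c) (transition c d x) = 1%:M.
Proof.
move=> ac ad ox.
have [dcd _] := Ck_onSP (transition_smooth ac ad 1).
have [ddc _] := Ck_onSP (transition_smooth ad ac 1).
have h1 := dcd _ ox; have h2 := ddc _ (overlap_transition ox).
rewrite -(jacobian_comp h1 h2) -[RHS](jacobian_id x).
have dd := differentiable_comp h1 h2.
apply: near_eq_jacobian dd.
have nb := open_nbhs_nbhs (conj (@open_overlap _ _ _ c d) ox).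
by apply: (@filterS _ _ _ _ _ _ nb) => y; exact: transitionK.
Qed.

Lemma jacobian_transition_unit c d x : atlas c -> atlas d -> overlap c d x ->
  jacobian (transition c d) x \in unitmx.
Proof. by move=> ac ad ox; have [h _] := mulmx1_unit (jacobian_transition ac ad ox). Qed.

Definition Ck_mfd k u := forall c, atlas c -> Ck_on k (cim c) (fun x => u (cinv c x)).

Lemma Ck_mfd_mul k u w : Ck_mfd k u -> Ck_mfd k w -> Ck_mfd k (fun p => u p * w p).
Proof. by move=> hu hw c ac; apply: Ck_mul; [exact: cim_open|exact: hu|exact: hw]. Qed.

Lemma Ck_mfd_sum k I (r : seq I) (F : I -> N -> R) : (forall i, Ck_mfd k (F i)) ->
  Ck_mfd k (fun p => \sum_(i <- r) F i p).
Proof. by move=> hF c ac; apply: Ck_sum; [exact: cim_open|move=> i _; exact: hF]. Qed.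

Lemma Ck_mfd_inv k u : (forall p, u p != 0) -> Ck_mfd k u -> Ck_mfd k (fun p => (u p)^-1).
Proof. by move=> u0 hu c ac; apply: Ck_inv; [exact: cim_open|move=> x _; exact: u0|exact: hu]. Qed.

Lemma Ck_mfd_le k l u : (k <= l)%N -> Ck_mfd l u -> Ck_mfd k u.
Proof. by move=> kl hu c ac; exact: Ck_on_le kl (hu c ac). Qed.

Lemma Ck_mfd_ext0 k u c (K : set N) : atlas c -> closed K -> K `<=` cdom c ->
  (forall p, ~ K p -> u p = 0) -> Ck_on k (cim c) (fun x => u (cinv c x)) -> Ck_mfd k u.
Proof.
move=> ac clK Kc u0 hu d ad; apply/Ck_onP => x dx.
have [dp dE] := cinvP dx.
have [cp|ncp] := pselect (cdom c (cinv d x)).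
  have oo := @open_overlap _ _ _ d c.
  have ox : overlap d c x by rewrite overlapE.
  have : Ck_on k (overlap d c) (fun y => u (cinv c (transition d c y))).
    apply: (Ck_comp oo (transition_smooth ad ac k) hu) => y; exact: locrep_cim.
  move=> /Ck_onP/(_ x ox); apply: Ck_near_ext.
  apply: filterS (open_nbhs_nbhs (conj oo ox)) => y oy.
  by rewrite cinv_transition.
apply: (@Ck_near_ext _ _ _ _ (fun=> 0)); last exact: Ck_cst.
have oK : open (~` K) by exact: closed_openC.
have nK : (~` K) (cinv d x) by move=> /Kc.
apply: filterS (open_nbhs_nbhs (conj (@open_cim_preimage _ _ _ d _ oK) (conj dx nK))) => y [_ Ky].
by rewrite u0.
Qed.

Hypothesis N_compact : compact [set: N].

Lemma closed_compact (K : set N) : closed K -> compact K.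
Proof. by move=> clK; exact: (subclosed_compact clK N_compact). Qed.

Lemma compact_cmap c (K : set N) : closed K -> K `<=` cdom c -> compact (cmap c @` K).
Proof.
move=> clK Kc; apply: continuous_compact; last exact: closed_compact.
by apply: continuous_in_subspaceT => p /set_mem Kp; exact: (cmap_continuous (mem_set (Kc _ Kp))).
Qed.

Lemma closed_cinv c (K : set 'rV[R]_n) : compact K -> K `<=` cim c -> closed (cinv c @` K).
Proof.
move=> cK Kc; apply: compact_closed; first exact: mfd_hausdorff.
apply: continuous_compact => //.
by apply: continuous_in_subspaceT => p /set_mem Kp; exact: (cinv_continuous (mem_set (Kc _ Kp))).
Qed.

(** The image of [K] in the chart is compact, so extension by 0 yields a function on all of R^n with
    bounded support, to which lattice sums apply. *)
Lemma Ck_chart_ext k c (K : set N) (F : 'rV[R]_n -> R) : closed K -> K `<=` cdom c ->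
  Ck_on k (cim c) F -> (forall x, cim c x -> ~ K (cinv c x) -> F x = 0) ->
  Ck_on k setT (fun x => if x \in cim c then F x else 0) /\
  exists r, supp_ball (fun x => if x \in cim c then F x else 0) r.
Proof.
move=> clK Kc hF F0; have cK := compact_cmap clK Kc.
have KE x : cim c x -> ~ (cmap c @` K) x -> F x = 0.
  move=> cx nK; apply: F0 => // Kx; apply: nK; exists (cinv c x) => //.
  by have [] := cinvP cx.
split.
  apply: (@Ck_zero_ext _ _ _ k (cim c) (cmap c @` K)) => //.
  exact: cim_open.
  by apply: compact_closed => //; exact: norm_hausdorff.
  by move=> x [p Kp <-]; apply: cim_cmap; exact: Kc.
have [M [_ hM]] := compact_bounded cK.
exists (M + 1) => x hx; case: ifPn => // /set_mem cx; apply: KE => // Kx.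
have := hM (M + 1); rewrite ltrDl ltr01 => /(_ isT x Kx) /=.
by rewrite leNgt hx.
Qed.

Lemma manifold_bump k (W : set N) p : open W -> W p ->
  exists u K, [/\ Ck_mfd k u, closed K, K `<=` W,
    forall q, ~ K q -> u q = 0 & (forall q, 0 <= u q) /\ 0 < u p].
Proof.
move=> oW Wp; have [c ac cp] := atlas_cover p.
set x0 := cmap c p.
have oA := @open_cim_preimage _ _ _ c _ oW.
have [s /= s0 hs] : exists2 s, 0 < s & forall x, `|x - x0| < s -> cim c x /\ W (cinv c x).
  have A0 : [set x | cim c x /\ W (cinv c x)] x0.
    by rewrite /= /x0 cinv_cmap //; split => //; exact: cim_cmap.
  have /nbhs_normP[s s0 hs] := open_nbhs_nbhs (conj oA A0).
  by exists s => // x xs; apply: hs; rewrite /= distrC.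
pose r := s / 2; have r0 : 0 < r by rewrite divr_gt0.
have rs : r < s by rewrite /r ltr_pdivrMr // ltr_pMr // ltr1n.
pose B := [set x : 'rV[R]_n | `|x - x0| <= r].
have Bc : B `<=` cim c by move=> x xB; have [] := hs x (le_lt_trans xB rs).
pose u q := if q \in cdom c then ball_bump k x0 r (cmap c q) else 0.
pose K := cinv c @` B.
have clK : closed K by exact: closed_cinv (@closed_ball_compact _ _ x0 r) Bc.
have u0 q : ~ K q -> u q = 0.
  move=> nK; rewrite /u; case: ifPn => // /set_mem cq; apply: ball_bump_eq0 => //.
  rewrite leNgt; apply/negP => h; apply: nK; exists (cmap c q); first exact: ltW.
  exact: cinv_cmap.
exists u, K; split => //.
   apply: (Ck_mfd_ext0 ac clK _ u0); first by move=> q [x Bx <-]; have [] := cinvP (Bc _ Bx).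
  apply: (Ck_on_ext _ _ (Ck_ball_bump k x0 r (cim c))); first exact: cim_open.
  by move=> x /set_mem cx; have [h1 h2] := cinvP cx; rewrite /u mem_set // h2.
   by move=> q [x Bx <-]; have [] := hs x (le_lt_trans Bx rs).
split; last by rewrite /u mem_set //; exact: ball_bump_gt0.
by move=> q; rewrite /u; case: ifP => // _; exact: ball_bump_ge0.
Qed.

(* [compact_cover] asks for a pointed space; a covering by open neighbourhoods
   is finitely subcovered along the filter of supersets of finite lists. *)
Lemma finite_open_cover (O : N -> set N) : (forall q, open (O q)) -> (forall q, O q q) ->
  exists D : seq N, forall p, exists2 q, q \in D & O q p.
Proof.
move=> oO Oq.
pose F : set_system (seq N) := [set A : set (seq N) | exists l0 : seq N, forall l : seq N, {subset l0 <= l} -> A l].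
have FF : Filter F.
  split; first by exists [::].
    move=> A B [lA hA] [lB hB]; exists (lA ++ lB) => l hl.
    by split; [apply: hA|apply: hB] => z zl; apply: hl; rewrite mem_cat zl ?orbT.
  by move=> A B AB [l0 h0]; exists l0 => l hl; apply: AB; exact: h0.
have /(_ (seq N) F (fun D p => exists2 q, q \in D & O q p) FF) :=
  (compact_near_coveringP _).1 N_compact.
case=> [q _|D hD].
  exists (O q, [set l : seq N | q \in l]); last by move=> [p l] [/= Op ql]; exists q.
  split; first exact: (open_nbhs_nbhs (conj (oO q) (Oq q))).
  by exists [:: q] => l hl; apply: hl; rewrite mem_head.
by exists D => p; exact: (hD D (fun _ => id) p I).
Qed.

(** Bumps positive at the point that indexes them are divided by their sum over a finite subcover.
    The functions are indexed by all points of N, but only those in the list [l] are summed. *)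
Lemma partition_of_unity k (W : N -> set N) : (forall p, open (W p)) -> (forall p, W p p) ->
  exists (l : seq N) (s : N -> N -> R), [/\ forall q, Ck_mfd k (s q),
    forall q p, 0 <= s q p,
    forall q, exists K, [/\ closed K, K `<=` W q & forall p, ~ K p -> s q p = 0] &
    forall p, \sum_(q <- l) s q p = 1].
Proof.
move=> oW Wp.
have /choice[u hu] p := manifold_bump k (oW p) (Wp p).
have uC q : Ck_mfd k (u q) by have [K []] := hu q.
have u_ge0 q p : 0 <= u q p by have [K [_ _ _ _ []]] := hu q.
have u_gt0 q : 0 < u q q by have [K [_ _ _ _ []]] := hu q.
pose O q := [set p | 0 < u q p].
have oO q : open (O q).
  rewrite openE => p /= up; have [c ac cp] := atlas_cover p.
  have cu : {for cmap c p, continuous (fun x => u q (cinv c x))}.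
    exact: (Ck_on_continuous (uC q c ac) (cim_cmap cp)).
  have o1 : nbhs (cmap c p) [set x | 0 < u q (cinv c x)].
    apply: (cu [set t : R | 0 < t]); rewrite cinv_cmap //.
    exact: (open_nbhs_nbhs (conj (@open_gt _ 0) up)).
  have o2 : nbhs p (cmap c @^-1` [set x | 0 < u q (cinv c x)]).
    exact: (cmap_continuous (mem_set cp) o1).
  have o3 : nbhs p (cdom c) by exact: (open_nbhs_nbhs (conj (@cdom_open _ _ _ c) cp)).
  by apply: filterS2 o2 o3 => z /= + cz; rewrite cinv_cmap.
have [D hD] := finite_open_cover oO u_gt0.
pose b p := \sum_(q <- D) u q p.
have b_gt0 p : 0 < b p.
  have [q qD uqp] := hD p.
  rewrite /b (big_rem q) //=; apply: ltr_pwDl => //.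
  by apply: sumr_ge0 => z _; exact: u_ge0.
have b_neq0 p : b p != 0 by rewrite gt_eqF.
exists D, (fun q p => u q p * (b p)^-1); split.
   by move=> q; apply: Ck_mfd_mul => //; apply: Ck_mfd_inv => //; exact: Ck_mfd_sum.
   by move=> q p; rewrite mulr_ge0 // invr_ge0 ltW.
   by move=> q; have [K [_ h1 h2 h3 _]] := hu q; exists K; split => // p Kp; rewrite h3 // mul0r.
by move=> p; rewrite -mulr_suml mulfV //; exact: b_neq0.
Qed.

End ManifoldFunctions.

Section Stokes.
Context {R : realType} {n : nat}.

Lemma supp_ball_nat (h : 'rV[R]_n -> R) r : supp_ball h r ->
  exists rho : nat, supp_ball h rho%:R.
Proof.
move=> hr; exists (Num.truncn (Num.max r 0)).+1 => x hx; apply: hr.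
have M0 : 0 <= Num.max r 0 by rewrite le_max lexx orbT.
have /andP[_ hlt] := Num.Theory.truncn_itv M0.
apply: lt_trans hx; apply: le_lt_trans hlt; by rewrite le_max lexx.
Qed.

Lemma supp_ball_derive (h : 'rV[R]_n -> R) r v : supp_ball h r -> supp_ball ('D_v h) r.
Proof.
move=> hr x hx; rewrite (near_eq_derive (g := fun=> 0)) ?derive_cst //.
have o : open (~` [set y : 'rV[R]_n | `|y - 0| <= r]).
  apply: closed_openC; apply: compact_closed; first exact: norm_hausdorff.
  exact: (@closed_ball_compact _ _ 0 r).
have ox : (~` [set y : 'rV[R]_n | `|y - 0| <= r]) x by rewrite /= subr0; apply/negP; rewrite -ltNge.
apply: filterS (open_nbhs_nbhs (conj o ox)) => y /= /negP.
by rewrite subr0 -ltNge; exact: hr.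
Qed.

(** Stokes' theorem in R^n: the estimate along homotopies, applied to a function that does not
    depend on [t]. *)
Lemma null_derive (h : 'rV[R]_n -> R) r i : Ck_on 1 setT h -> supp_ball h r ->
  null_seq (fun j => grid_sum j ('D_(delta_mx 0 i) h)).
Proof.
move=> h1 /supp_ball_nat[rho hr] e e0.
have Dr := supp_ball_derive (delta_mx 0 i) hr.
have [_ Dc] := Ck_onSP h1.
pose G p := 'D_(delta_mx 0 i) h (tpt2 p).
pose K := [set x : 'rV[R]_n | `|x| <= rho%:R].
have nK x : ~ K x -> rho%:R < `|x| by move=> /negP; rewrite -ltNge.
have GE t x : G (tpt t x) = 'D_(delta_mx 0 i) h x by rewrite /G tpt2K.
have cG t x : 0 <= t <= 1 -> forall e, 0 < e ->
    \forall q \near tpt t x, 0 <= tpt1 q <= 1 -> `|G (tpt t x) - G q| < e.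
  move=> _ e' e'0.
  have cW : {for tpt t x, continuous G}.
    exact: (continuous_comp (@tpt2_continuous _ _ _) (Dc (delta_mx 0 i) _ I)).
  by move/cvgrPdist_lt: cW => /(_ _ e'0); apply: filterS.
have /(_ e e0) := @grid_sum_derive_small _ _ (fun=> h) G K rho i (fun _ => id)
  (fun _ _ => h1) (fun t x _ => esym (GE t x)) (fun _ x _ nKx => hr x (nK x nKx))
  (fun t x _ nKx => etrans (GE t x) (Dr x (nK x nKx))) cG.
apply: filterS => j /(_ 0); rewrite lexx ler01 => /(_ isT).
by congr (`|_| <= _); apply: eq_grid_sum.
Qed.

Lemma Ck_on_cover k (U : set 'rV[R]_n) (f : 'rV[R]_n -> R) :
  (forall x, U x -> exists g, (\near x, g x = f x) /\ Ck_on k [set x] g) -> Ck_on k U f.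
Proof.
by move=> h; apply/Ck_onP => x /h[g [e hg]]; exact: Ck_near_ext e hg.
Qed.

Lemma sg_locally_constant (U : set 'rV[R]_n) (f : 'rV[R]_n -> R) x : Ck_on 0 U f ->
  U x -> f x != 0 -> \forall y \near x, Num.sg (f y) = Num.sg (f x).
Proof.
move=> cf Ux f0; have fx := cf _ Ux.
case: (ltrgt0P (f x)) f0 => // h _.
  have nb : \forall y \near x, 0 < f y := fx _ (open_nbhs_nbhs (conj (@open_gt _ 0) h)).
  by apply: filterS nb => y /= fy; rewrite !gtr0_sg.
have nb : \forall y \near x, f y < 0 := fx _ (open_nbhs_nbhs (conj (@open_lt _ 0) h)).
by apply: filterS nb => y /= fy; rewrite !ltr0_sg.
Qed.

(** Being locally constant, the sign is of every class; this makes |f| as regular as f. *)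
Lemma Ck_sg k (U : set 'rV[R]_n) (f : 'rV[R]_n -> R) : Ck_on k U f ->
  (forall x, U x -> f x != 0) -> forall l, Ck_on l U (fun x => Num.sg (f x)).
Proof.
move=> hf f0 l; have c0 : Ck_on 0 U f by exact: Ck_on_le hf.
apply: Ck_on_cover => x Ux; exists (fun=> Num.sg (f x)); split; last exact: Ck_cst.
by apply: filterS (sg_locally_constant c0 Ux (f0 _ Ux)) => y ->.
Qed.

Lemma Ck_norm k (U : set 'rV[R]_n) (f : 'rV[R]_n -> R) : open U -> Ck_on k U f ->
  (forall x, U x -> f x != 0) -> Ck_on k U (fun x => `|f x|).
Proof.
move=> oU hf f0; apply: (Ck_on_ext oU _ (Ck_mul oU (Ck_sg hf f0 k) hf)) => x _.
by rewrite normrEsg.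
Qed.

End Stokes.

(** * Densities and their sums in different charts *)

Section VolumeSums.
Context {R : realType} {n : nat} (N : smoothManifold R n).
Hypothesis N_compact : compact [set: N].
Variable v : chart R n N -> 'rV[R]_n -> R.
Hypothesis v1 : forall c, atlas c -> Ck_on 1 (cim c) (v c).
Hypothesis v_neq0 : forall c, atlas c -> forall x, cim c x -> v c x != 0.
Hypothesis v_transition : forall c d, atlas c -> atlas d -> forall x, overlap c d x ->
  v c x = \det (jacobian (transition c d) x) * v d (transition c d x).
Implicit Types (c d : chart R n N) (w : N -> R) (U : set N).

Definition supported U w := exists K, [/\ closed K, K `<=` U & forall p, ~ K p -> w p = 0].

Lemma supportedS U U' w : U `<=` U' -> supported U w -> supported U' w.
Proof. by move=> UU' [K [h1 h2 h3]]; exists K; split => // p /h2/UU'. Qed.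

Lemma supportedMl U u w : supported U w -> supported U (fun p => u p * w p).
Proof. by move=> [K [h1 h2 h3]]; exists K; split => // p /h3 ->; rewrite mulr0. Qed.

Lemma supportedMI U U' u w : supported U u -> supported U' w ->
  supported (U `&` U') (fun p => u p * w p).
Proof.
move=> [K [h1 h2 h3]] [K' [h1' h2' h3']]; exists (K `&` K'); split.
    exact: closedI.
  by move=> p [/h2 ? /h2' ?].
move=> p nK; have [/h3 ->|/contrapT Kp] := pselect (~ K p); first by rewrite mul0r.
by rewrite (h3' p) ?mulr0 // => K'p; apply: nK.
Qed.

(* The expression in c of the density w |v|. *)
Definition chart_density c w x := if x \in cim c then w (cinv c x) * `|v c x| else 0.

Definition chart_sum c j w := grid_sum j (chart_density c w).

Lemma chart_density_regular c w : atlas c -> Ck_mfd 1 w -> supported (cdom c) w ->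
  Ck_on 1 setT (chart_density c w) /\ exists r, supp_ball (chart_density c w) r.
Proof.
move=> ac hw [K [clK Kc w0]].
have oc : open (cim c) by exact: cim_open.
apply: (@Ck_chart_ext _ _ _ N_compact 1 c K (fun x => w (cinv c x) * `|v c x|)) => //.
  apply: Ck_mul => //; first exact: hw.
  by apply: Ck_norm => //; [exact: v1|exact: v_neq0].
by move=> x _ /w0 ->; rewrite mul0r.
Qed.

Lemma chart_density_eq0 c w x : (cim c x -> w (cinv c x) = 0) -> chart_density c w x = 0.
Proof. by rewrite /chart_density; case: ifPn => // /set_mem cx ->; rewrite ?mul0r. Qed.

Lemma chart_sum_sum c j I (r : seq I) (F : I -> N -> R) :
  chart_sum c j (fun p => \sum_(i <- r) F i p) = \sum_(i <- r) chart_sum c j (F i).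
Proof.
rewrite /chart_sum -grid_sum_sum; apply: eq_grid_sum => x; rewrite /chart_density.
by case: ifP => _; [rewrite mulr_suml|rewrite big1].
Qed.

Lemma eq_chart_sum c j w w' : w =1 w' -> chart_sum c j w = chart_sum c j w'.
Proof.
by move=> e; apply: eq_grid_sum => x; rewrite /chart_density; case: ifP => // _; rewrite e.
Qed.

Lemma open_positive (O : set 'rV[R]_n) (f : 'rV[R]_n -> R) : open O -> Ck_on 0 O f ->
  open [set x | O x /\ 0 < f x].
Proof.
rewrite !openE => oO cf x [Ox fx].
have nb : \forall y \near x, 0 < f y := cf _ Ox _ (open_nbhs_nbhs (conj (@open_gt _ 0) fx)).
exact: filterI (oO _ Ox) nb.
Qed.

Lemma sg_density (a b D D' : R) : Num.sg D = Num.sg D' ->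
  a * `|b| * D = Num.sg D' * (a * (`|D| * `|b|)).
Proof. by move=> e; rewrite [X in _ * X = _](numEsg D) e; ring. Qed.

(** The neighbourhood [W] is so small that [null_local] applies and the Jacobian determinant keeps
    the sign it has at [q]. That sign is then a common factor, which drops out because its square is
    1. *)
Lemma chart_sum_change_local c d q : atlas c -> atlas d -> cdom c q -> cdom d q ->
  exists W : set N, [/\ open W, W q & forall w, Ck_mfd 1 w -> supported (cdom d) w ->
    (forall p, ~ W p -> w p = 0) ->
    null_seq (fun j => chart_sum c j w - chart_sum d j w)].
Proof.
move=> ac ad cq dq; set x0 := cmap c q; set phi := transition c d.
have oO := @open_overlap _ _ _ c d.
have Ox0 : overlap c d x0 by exact: overlap_cmap.
have phi2 : Ck_on 2 (overlap c d) phi by exact: transition_smooth.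
have uA := jacobian_transition_unit ac ad Ox0.
have [r [s [r0 s0 rO H]]] := null_local oO Ox0 phi2 uA.
set A := jacobian phi x0 in H *.
have A0 : \det A != 0 by move: uA; rewrite unitmxE unitfE.
(* Positivity of [f] means that the determinant has the same sign at [x] as at [x0]. *)
pose f x := \det (jacobian phi x) * \det A.
have cf : Ck_on 0 (overlap c d) f.
  apply: Ck_mul => //; last exact: Ck_cst.
  by apply: Ck_det => // i l; apply: Ck_jacobian => //; exact: Ck_on_le phi2.
pose V := [set x | overlap c d x /\ 0 < f x] `&` [set x | `|x - x0| < r].
have oV : open V by apply: openI; [exact: open_positive|exact: open_ball_norm].
pose W := [set p | cdom c p /\ V (cmap c p)] `&`
  [set p | cdom d p /\ [set y | `|y - phi x0| < s] (cmap d p)].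
exists W; split.
    by apply: openI; apply: open_cdom_preimage => //; exact: open_ball_norm.
  split; split => //.
    split => /=; last by rewrite subrr normr0.
    by split => //; rewrite /f -expr2 lt_neqAle sqr_ge0 eq_sym sqrf_eq0 A0.
  by rewrite /= /phi transition_cmap // subrr normr0.
move=> w hw sw w0.
have [h1 _] := chart_density_regular ad hw sw.
have hs y : s <= `|y - phi x0| -> chart_density d w y = 0.
  move=> hy; apply: chart_density_eq0 => dy; apply: w0 => -[_ [_ /=]].
  by have [_ ->] := cinvP dy; rewrite ltNge hy.
have sg2 : Num.sg (\det A) * Num.sg (\det A) = 1 by rewrite -expr2 sqr_sg A0.
have E x : (if `|x - x0| < r then chart_density d w (phi x) * \det (jacobian phi x) else 0) =
    Num.sg (\det A) * chart_density c w x.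
  case: ifPn => hx.
    have Ox := rO _ hx; have cx : cim c x by move: (Ox); rewrite overlapE => -[].
    rewrite /chart_density !mem_set //; last exact: locrep_cim.
    rewrite cinv_transition // (v_transition ac ad Ox) normrM -/phi.
    have [->|w_neq0] := eqVneq (w (cinv c x)) 0; first by rewrite !mul0r mulr0.
    have [[_ [[_ fx] _]] _] : W (cinv c x).
      by apply: contrapT => /w0 e; rewrite e eqxx in w_neq0.
    have sgE : Num.sg (\det (jacobian phi x)) = Num.sg (\det A).
      move: fx; have [_ ->] := cinvP cx; rewrite /f => /gtr0_sg; rewrite sgrM => e.
      by rewrite -[LHS]mulr1 -sg2 mulrA e mul1r.
    exact: (sg_density _ _ sgE).
  rewrite chart_density_eq0 ?mulr0 // => cx; apply: w0 => -[[_ [_ xr]] _].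
  by move: xr => /=; have [_ ->] := cinvP cx; rewrite (negbTE hx).
apply: eq_null_seq (null_seqZ (Num.sg (\det A)) (H _ h1 hs)) => j.
rewrite (eq_grid_sum _ E) grid_sumZ.
by rewrite mulrBr !mulrA sg2 !mul1r.
Qed.

(** A partition of unity subordinate to the neighbourhoods of [chart_sum_change_local] reduces to
    the local case; at a point off [K] the complement of [K] serves as neighbourhood, and both sums
    are 0. *)
Lemma chart_sum_change c d w : atlas c -> atlas d -> Ck_mfd 1 w ->
  supported (cdom c `&` cdom d) w ->
  null_seq (fun j => chart_sum c j w - chart_sum d j w).
Proof.
move=> ac ad hw sw; have [K [clK Kcd w0]] := sw.
have sd : supported (cdom d) w by apply: supportedS sw => p [].
have hW q : exists W : set N, [/\ open W, W q & forall u, Ck_mfd 1 u ->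
    (forall p, ~ W p -> u p = 0) ->
    null_seq (fun j => chart_sum c j (fun p => u p * w p) - chart_sum d j (fun p => u p * w p))].
  have [Kq|nKq] := pselect (K q).
    have [cq dq] := Kcd _ Kq.
    have [W [oW Wq H]] := chart_sum_change_local ac ad cq dq.
    exists W; split => // u hu u0; apply: H; first exact: Ck_mfd_mul.
      exact: supportedMl.
    by move=> p /u0 ->; rewrite mul0r.
  exists (~` K); split => //; first exact: closed_openC.
  move=> u hu u0; apply: eq_null_seq (@null_seq0 R) => j.
  rewrite /chart_sum -grid_sumB -[LHS](@grid_sum0 R n j); apply: eq_grid_sum => x.
  have uw p : u p * w p = 0.
    have [Kp|/w0 ->] := pselect (K p); last by rewrite mulr0.
    by rewrite u0 ?mul0r //= => /(_ Kp).
  by rewrite !chart_density_eq0 ?subrr.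
have /choice[W hW'] := hW.
have [|q|l [s [s1 s_ge0 ssup s_sum]]] := @partition_of_unity _ _ _ N_compact 1 W.
    by move=> q; have [] := hW' q.
  by have [] := hW' q.
have E e j : chart_sum e j w = \sum_(q <- l) chart_sum e j (fun p => s q p * w p).
  rewrite -chart_sum_sum; apply: eq_chart_sum => p.
  by rewrite -mulr_suml s_sum mul1r.
have H : null_seq (fun j => \sum_(q <- l)
    (chart_sum c j (fun p => s q p * w p) - chart_sum d j (fun p => s q p * w p))).
  apply: null_seq_sum => q; have [_ _ Hq] := hW' q; apply: (Hq (s q) (s1 q)) => p nW.
  by have [K' [_ K'W]] := ssup q; apply => K'p; apply: nW; exact: K'W.
by apply: eq_null_seq H => j; rewrite !E -sumrB.
Qed.

End VolumeSums.

Section ExteriorDerivativeForm.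
Context {R : realType} {V : normedModType R}.
Implicit Types (A : V -> seq V -> R) (s t : seq V).

Lemma dseq_linear A y : (\forall z \near y, seq_linear (A z)) -> diff_at A y ->
  seq_linear (dseq A y).
Proof.
move=> hA dA s1; elim: s1 A hA dA => [|z s1 IH] A hA dA s2 c x x' /=.
  have -> : 'D_(c *: x + x') (fun z => A z s2) y =
      c * 'D_x (fun z => A z s2) y + 'D_x' (fun z => A z s2) y.
    by rewrite !(deriveE _ (dA s2)) linearD linearZ.
  have -> : dseq (fun z t => A z (c *: x + x' :: t)) y s2 =
      dseq (fun z t => c * A z (x :: t) + A z (x' :: t)) y s2.
    apply: near_eq_dseq; apply: filterS hA => z hz t; exact: (hz [::]).
  have dx w : diff_at (fun z t => A z (w :: t)) y by exact: diff_at_cons.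
  have dc : diff_at (fun z t => c * A z (x :: t)) y.
    by move=> t; exact: (differentiableM (differentiable_cst c y) (dx x t)).
  rewrite (dseqD _ dc (dx x')) (dseq_scale _ (differentiable_cst c y) (dx x)).
  have -> : wedge (fun x => 'D_x (cst c) y) ((fun t => A y (x :: t))) s2 = 0.
    by apply: wedge0l => w _; exact: derive_cst.
  by move: ('D_x _ y) ('D_x' _ y) (dseq _ _ _) (dseq _ _ _) => d1 d2 d3 d4; rewrite /cst; ring.
have -> : 'D_z (fun z0 => A z0 (s1 ++ c *: x + x' :: s2)) y =
    c * 'D_z (fun z0 => A z0 (s1 ++ x :: s2)) y + 'D_z (fun z0 => A z0 (s1 ++ x' :: s2)) y.
  rewrite (near_eq_derive (g := fun z0 => c * A z0 (s1 ++ x :: s2) + A z0 (s1 ++ x' :: s2))).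
    have dc := differentiableM (differentiable_cst c y) (dA (s1 ++ x :: s2)).
    rewrite (derive_add z dc (dA _)) (derive_scale z (differentiable_cst c y) (dA _)).
    by rewrite derive_cst mulr0 addr0.
  by apply: filterS hA => z' hz'; exact: hz'.
rewrite IH; last 2 first.
    by apply: filterS hA => z' hz'; exact: seq_linear_cons.
  exact: diff_at_cons.
by move: ('D_z _ y) ('D_z _ y) (dseq _ _ _) (dseq _ _ _) => d1 d2 d3 d4; ring.
Qed.

Lemma dseq_antisym A y : (\forall z \near y, seq_antisym (A z)) -> diff_at A y ->
  seq_antisym (dseq A y).
Proof.
move=> hA dA s1; elim: s1 A hA dA => [|z s1 IH] A hA dA s2 x x' /=.
  have -> : dseq (fun z t => A z (x :: x' :: t)) y s2 =
      - dseq (fun z t => A z (x' :: x :: t)) y s2.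
    rewrite -dseqN; last by move=> t; exact: dA.
    by apply: near_eq_dseq; apply: filterS hA => z hz t; exact: (hz [::]).
  by move: ('D_x _ y) ('D_x' _ y) (dseq _ _ _) => d1 d2 d3; ring.
have -> : 'D_z (fun z0 => A z0 (s1 ++ x :: x' :: s2)) y =
    - 'D_z (fun z0 => A z0 (s1 ++ x' :: x :: s2)) y.
  rewrite -(derive_opp z (dA _)); apply: near_eq_derive.
  by apply: filterS hA => z' hz'; exact: hz'.
rewrite IH; last 2 first.
    by apply: filterS hA => z' hz'; exact: seq_antisym_cons.
  exact: diff_at_cons.
by move: ('D_z _ y) (dseq _ _ _) => d1 d2; ring.
Qed.

Lemma Ck_dseq k U A s : open U -> (forall t, Ck_on k.+1 U (fun z => A z t)) ->
  Ck_on k U (fun y => dseq A y s).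
Proof.
move=> oU; elim: s A => [|x s IH] A hA; first exact: Ck_cst.
apply: Ck_sub => //; first by have [_] := Ck_onSP (hA s); apply.
by apply: IH => t; exact: hA.
Qed.

End ExteriorDerivativeForm.

(** * Coefficients of exact top forms *)

Section FormFamilies.
Context {R : realType} {n : nat} (N : smoothManifold R n).
Implicit Types (c d : chart R n N) (u w : N -> R) (x : 'rV[R]_n).
Implicit Types a : chart R n N -> 'rV[R]_n -> seq 'rV[R]_n -> R.

(** The list version of a form on N, of class C^2 because it gets multiplied by partitions of unity
    of finite class. The degree is left open: evaluating the derivative on n vectors in [top]
    selects the part of degree n - 1. *)
Definition form_family a := [/\
  forall c, atlas c -> forall x, cim c x -> seq_linear (a c x) /\ seq_antisym (a c x),
  forall c, atlas c -> forall s, Ck_on 2 (cim c) (fun x => a c x s) &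
  forall c d, atlas c -> atlas d -> forall x, overlap c d x -> forall s,
    a c x s = a d (transition c d x) [seq y *m jacobian (transition c d) x | y <- s]].

Definition top a c x := dseq (a c) x (rows (1%:M : 'M[R]_n)).

Lemma near_cim c x : cim c x -> \forall y \near x, cim c y.
Proof. by move=> cx; exact: (open_nbhs_nbhs (conj (@cim_open _ _ _ c) cx)). Qed.

Lemma form_family_diff a c x : form_family a -> atlas c -> cim c x -> diff_at (a c) x.
Proof. by move=> [_ h _] ac cx s; have [d _] := Ck_onSP (h c ac s); exact: d. Qed.

Lemma form_family_mul u a : Ck_mfd 2 u -> form_family a ->
  form_family (fun c x s => u (cinv c x) * a c x s).
Proof.
move=> hu [h1 h2 h3]; split.
    move=> c ac x cx; have [l1 l2] := h1 c ac x cx.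
    split=> s1 s2 *; [rewrite l1; ring|by rewrite l2 mulrN].
  by move=> c ac s; apply: Ck_mul; [exact: cim_open|exact: hu|exact: h2].
by move=> c d ac ad x ox s; rewrite cinv_transition // (h3 c d).
Qed.

Lemma Ck_top a c : form_family a -> atlas c -> Ck_on 1 (cim c) (top a c).
Proof. by move=> [_ h _] ac; apply: Ck_dseq; [exact: cim_open|exact: h]. Qed.

(** The exterior derivative commutes with the transition map by [dseq_pull], and an alternating form
    evaluated on the rows of a square matrix is a multiple of the determinant. *)
Lemma top_transition a c d x : form_family a -> atlas c -> atlas d -> overlap c d x ->
  top a c x = \det (jacobian (transition c d) x) * top a d (transition c d x).
Proof.
move=> fa ac ad ox; have [h1 h2 h3] := fa.
have oO := @open_overlap _ _ _ c d; have oc := @cim_open _ _ _ d.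
have t2 : Ck_on 2 (overlap c d) (transition c d) by exact: transition_smooth.
have [dt _] := Ck_onSP t2.
have mapE y s : overlap c d y ->
    [seq 'D_v (transition c d) y | v <- s] = [seq v *m jacobian (transition c d) y | v <- s].
  by move=> oy; apply: eq_map => v; rewrite (deriveEjacobian _ (dt _ oy)).
have cimT y : overlap c d y -> cim d (transition c d y) by exact: locrep_cim.
have reg : regular_on (cim d) (a d).
  by split=> y dy; [have [] := h1 d ad y dy|have [] := h1 d ad y dy|exact: form_family_diff].
have -> : top a c x = dseq (pull (transition c d) (a d)) x (rows 1%:M).
  apply: near_eq_dseq; apply: filterS (open_nbhs_nbhs (conj oO ox)) => y oy s.
  by rewrite /pull mapE // (h3 c d).
rewrite (dseq_pull oO oc t2 cimT ox _ reg) mapE //.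
have -> : [seq v *m jacobian (transition c d) x | v <- rows 1%:M] = rows (jacobian (transition c d) x).
  by rewrite -[in RHS](mul1mx (jacobian _ x)) rows_mulmx.
have ct := cimT _ ox; have nc := near_cim ct.
have dd := form_family_diff fa ad ct.
apply: (@top_form_det R n (fun A => dseq (a d) (transition c d x) (rows A))).
  apply: multilinear_rowsP; apply: dseq_linear => //.
  by apply: filterS nc => y dy; have [] := h1 d ad y dy.
apply: alternating_rowsP; apply: dseq_antisym => //.
by apply: filterS nc => y dy; have [] := h1 d ad y dy.
Qed.

End FormFamilies.

(** * Exact top forms on a compact manifold have zeros *)

Section ExactVolume.
Context {R : realType} {q : nat} (N : smoothManifold R q.+1).
Implicit Types (c d : chart R q.+1 N) (u w : N -> R) (x : 'rV[R]_q.+1).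
Implicit Types a b : chart R q.+1 N -> 'rV[R]_q.+1 -> seq 'rV[R]_q.+1 -> R.
Hypothesis N_compact : compact [set: N].

(** Stokes' theorem in one chart: each component of [a] extends by 0 to R^n, so its partial
    derivatives have null sums. The locally constant sign of [v] passes through the derivative. *)
Lemma null_top (v : 'rV[R]_q.+1 -> R) a c (K : set N) : form_family a -> atlas c -> Ck_on 0 (cim c) v ->
  (forall x, cim c x -> v x != 0) -> closed K -> K `<=` cdom c ->
  (forall x s, cim c x -> ~ K (cinv c x) -> a c x s = 0) ->
  null_seq (fun j => grid_sum j (fun x => if x \in cim c then Num.sg (v x) * top a c x else 0)).
Proof.
move=> fa ac cv v0 clK Kc a0; have [_ a2 _] := fa.
have oc : open (cim c) by exact: cim_open.
pose f (i : 'I_q.+1) x := a c x (rows (row' i (1%:M : 'M[R]_q.+1))).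
pose g i x := if x \in cim c then Num.sg (v x) * f i x else 0.
have fC i : Ck_on 2 (cim c) (f i) by exact: a2.
have df i x : cim c x -> differentiable (f i) x by have [d _] := Ck_onSP (fC i); exact: d.
have gC i : Ck_on 1 setT (g i) /\ exists r, supp_ball (g i) r.
  apply: (@Ck_chart_ext _ _ _ N_compact 1 c K (fun x => Num.sg (v x) * f i x)) => //.
    by apply: Ck_mul => //; [exact: (Ck_sg cv)|exact: Ck_onS].
  by move=> x cx nK; rewrite /f a0 // mulr0.
have cK := compact_cmap N_compact clK Kc.
have dg i x : 'D_(delta_mx 0 i) (g i) x =
    if x \in cim c then Num.sg (v x) * 'D_(delta_mx 0 i) (f i) x else 0.
  case: ifPn => [/set_mem cx|nx].
    rewrite (near_eq_derive (g := fun y => Num.sg (v x) * f i y)).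
      rewrite (derive_scale _ (differentiable_cst _ _) (df i x cx)).
      by rewrite derive_cst mulr0 addr0.
    apply: filterS2 (near_cim cx) (sg_locally_constant cv cx (v0 _ cx)) => y cy e.
    by rewrite /g mem_set // e.
  have nK : ~ (cmap c @` K) x.
    by move=> [p Kp e]; move/negP: nx; apply; rewrite -e mem_set //; apply: cim_cmap; exact: Kc.
  have oK : open (~` (cmap c @` K)).
    by apply: closed_openC; apply: compact_closed => //; exact: norm_hausdorff.
  rewrite (near_eq_derive (g := fun=> 0)) ?derive_cst //.
  apply: filterS (open_nbhs_nbhs (conj oK nK)) => y nKy.
  rewrite /g; case: ifPn => // /set_mem cy; rewrite /f a0 ?mulr0 // => Ky; apply: nKy.
  by exists (cinv c y) => //; have [] := cinvP cy.
have topE x : top a c x = \sum_(i < q.+1) (-1) ^+ i * 'D_(delta_mx 0 i) (f i) x.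
  by rewrite /top -dext_dseq /dext; apply: eq_bigr => i _; rewrite row1.
have H : null_seq (fun j => \sum_(i < q.+1) (-1) ^+ i * grid_sum j ('D_(delta_mx 0 i) (g i))).
  apply: null_seq_sum => i; apply: null_seqZ.
  by have [g1 [r gr]] := gC i; exact: null_derive gr.
apply: eq_null_seq H => j; under eq_bigr do rewrite -grid_sumZ.
rewrite -grid_sum_sum; apply: eq_grid_sum => x.
under eq_bigr do rewrite dg.
case: ifP => _; last by rewrite big1 // => i _; rewrite mulr0.
by rewrite topE mulr_sumr; apply: eq_bigr => i _; rewrite mulrCA.
Qed.

(* The function da / db on N. *)
Definition quotient b a p : R :=
  let c := projT1 (cid2 (atlas_cover p)) in top a c (cmap c p) / top b c (cmap c p).

Lemma quotientE b a c x : form_family b -> form_family a ->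
  (forall c, atlas c -> forall x, cim c x -> top b c x != 0) ->
  atlas c -> cim c x -> quotient b a (cinv c x) = top a c x / top b c x.
Proof.
move=> fb fa b0 ac cx; rewrite /quotient; case: cid2 => d ad dp /=.
have [cp cE] := cinvP cx; have ox : overlap c d x by rewrite overlapE.
have -> : cmap d (cinv c x) = transition c d x by [].
rewrite (top_transition fa ac ad ox) (top_transition fb ac ad ox).
have := jacobian_transition_unit ac ad ox; rewrite unitmxE unitfE => J0.
by rewrite -mulf_div divff // mul1r.
Qed.

Lemma grid_sum_positive (f : 'rV[R]_q.+1 -> R) x : Ck_on 0 setT f -> (forall x, 0 <= f x) ->
  0 < f x -> exists2 e, 0 < e & \forall j \near \oo, e <= grid_sum j f.
Proof.
move=> cf f0 fx.
have nb : \forall y \near x, f x / 2 < f y.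
  apply: (cf x I [set t | f x / 2 < t]); apply: (open_nbhs_nbhs (conj (@open_gt _ _) _)).
  by rewrite /= ltr_pdivrMr // ltr_pMr // ltr1n.
have /nbhs_normP[r /= r0 hr] := nb.
have r20 : 0 < r / 2 by rewrite divr_gt0.
have fx2 : 0 < f x / 2 by rewrite divr_gt0.
apply: (grid_sum_lower (x0 := x) r20 fx2 f0) => y hy; apply/ltW/hr; rewrite /= distrC.
by apply: le_lt_trans hy _; rewrite ltr_pdivrMr // ltr_pMr // ltr1n.
Qed.

(* With a partition of unity s subordinate to charts, 1 = sum_p d(s_p b) / db,
   and each summand is supported in a chart and has sums tending to 0, whereas
   the sums of 1 are bounded below. *)
Lemma no_exact_volume b : form_family b -> [set: N] !=set0 ->
  ~ (forall c, atlas c -> forall x, cim c x -> top b c x != 0).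
Proof.
move=> fb [p0 _] b0.
pose v := top b.
have v1 c : atlas c -> Ck_on 1 (cim c) (v c) by exact: Ck_top.
have vt c d : atlas c -> atlas d -> forall x, overlap c d x ->
    v c x = \det (jacobian (transition c d) x) * v d (transition c d x).
  by move=> ac ad x; exact: top_transition.
pose C (p : N) := projT1 (cid2 (atlas_cover p)).
have aC p : atlas (C p) by rewrite /C; case: cid2.
have Cp p : cdom (C p) p by rewrite /C; case: cid2.
have [l [s [s2 s_ge0 ssup s_sum]]] := @partition_of_unity _ _ _ N_compact 2 (fun p => cdom (C p))
  (fun p => @cdom_open _ _ _ (C p)) Cp.
have ssup' p : supported (cdom (C p)) (s p) by have [K [h1 h2 h3]] := ssup p; exists K.
pose a p c x t := s p (cinv c x) * b c x t.
have fa p : form_family (a p) by exact: form_family_mul.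
pose w p := quotient b (a p).
have wE p c x : atlas c -> cim c x -> w p (cinv c x) = top (a p) c x / v c x.
  by move=> ac cx; exact: quotientE.
have w1 p : Ck_mfd 1 (w p).
  move=> c ac; have oc := @cim_open _ _ _ c.
  apply: (@Ck_on_ext _ _ _ 1 _ (fun x => top (a p) c x * (v c x)^-1) _ oc).
    by move=> x /set_mem cx; rewrite wE.
  by apply: Ck_mul => //; [exact: Ck_top|apply: Ck_inv => //; [exact: b0|exact: v1]].
have sumw p : \sum_(i <- l) w i p = 1.
  have cp := cim_cmap (Cp p).
  transitivity (\sum_(i <- l) top (a i) (C p) (cmap (C p) p) / v (C p) (cmap (C p) p)).
    by apply: eq_bigr => i _; rewrite -wE // cinv_cmap.
  rewrite -mulr_suml -dseq_sum; last by move=> i; exact: form_family_diff.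
  have -> : dseq (fun z t => \sum_(i <- l) a i (C p) z t) (cmap (C p) p) (rows 1%:M) =
      v (C p) (cmap (C p) p).
    by apply: eq_dseq => y t; rewrite -mulr_suml s_sum mul1r.
  by rewrite divff // b0.
pose S c j u := chart_sum v c j u.
have stokes p : null_seq (fun j => S (C p) j (w p)).
  have [K [clK KC s0]] := ssup p.
  have a0 x t : cim (C p) x -> ~ K (cinv (C p) x) -> a p (C p) x t = 0.
    by move=> _ /s0; rewrite /a => ->; rewrite mul0r.
  have := null_top (fa p) (aC p) (Ck_onS (v1 _ (aC p))) (b0 _ (aC p)) clK KC a0.
  apply: eq_null_seq => j; apply: eq_grid_sum => x; rewrite /chart_density.
  case: ifP => // /set_mem cx; rewrite wE // [in RHS]normrEsg -/v.
  by have := b0 _ (aC p) _ cx; rewrite -/v; move: (v _ _) (top _ _ _) => c1 c2 c10; field.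
have s1 p : Ck_mfd 1 (s p) by exact: Ck_mfd_le (s2 p).
(* The function s_p' w_p is supported in the domains of both charts, so its sums in the two charts
   may be exchanged. *)
have ws p p' : null_seq (fun j => S (C p') j (fun z => s p' z * w p z) -
    S (C p) j (fun z => s p' z * w p z)).
  apply: (@chart_sum_change _ _ _ N_compact v v1 b0 vt _ _ _ (aC p') (aC p)
    (Ck_mfd_mul (s1 p') (w1 p))).
  apply: supportedMI => //; have [K [h1 h2 h3]] := ssup p; exists K; split => // z nK.
  have cz := cim_cmap (Cp z); rewrite -(cinv_cmap (Cp z)) wE //.
  suff -> : top (a p) (C z) (cmap (C z) z) = 0 by rewrite mul0r.
  have oK : open (~` K) by exact: closed_openC.
  have nKz : (~` K) (cinv (C z) (cmap (C z) z)) by rewrite cinv_cmap.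
  rewrite /top (near_eq_dseq (A' := fun _ _ => 0)) ?dseq0 //.
  have nb := open_nbhs_nbhs (conj (@open_cim_preimage _ _ _ (C z) _ oK) (conj cz nKz)).
  by apply: filterS nb => y [_ nKy] t; rewrite /a h3 // mul0r.
(* Since the w_p add up to 1, the sum of s_p' in its chart is the sum over p of those of s_p' w_p.
   After moving each term to the chart of p, summation over p' restores w_p, whose sums are null by
   [stokes]. *)
have total : null_seq (fun j => \sum_(p' <- l) S (C p') j (s p')).
  have H : null_seq (fun j => \sum_(p <- l) ((\sum_(p' <- l)
      (S (C p') j (fun z => s p' z * w p z) - S (C p) j (fun z => s p' z * w p z))) +
      S (C p) j (w p))).
    apply: null_seq_sum => p; apply: null_seqD => //.
    by apply: null_seq_sum => p'; exact: ws.
  apply: eq_null_seq H => j.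
  transitivity (\sum_(p <- l) \sum_(p' <- l) S (C p') j (fun z => s p' z * w p z)).
    apply: eq_bigr => p _; rewrite sumrB.
    rewrite [X in _ - X + _](_ : _ = S (C p) j (w p)) ?subrK //.
    rewrite -chart_sum_sum; apply: eq_chart_sum => z.
    by rewrite -mulr_suml s_sum mul1r.
  rewrite exchange_big; apply: eq_bigr => p' _.
  rewrite -chart_sum_sum; apply: eq_chart_sum => z.
  by rewrite -mulr_sumr sumw mulr1.
have dens_ge0 p x : 0 <= chart_density v (C p) (s p) x.
  by rewrite /chart_density; case: ifP => // _; rewrite mulr_ge0.
have S_ge0 p j : 0 <= S (C p) j (s p).
  rewrite -[0](@grid_sum0 R q.+1 j); exact: grid_sum_le.
have [p1 p1l sp1] : exists2 p1, p1 \in l & 0 < s p1 p0.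
  apply: contrapT => h; have := s_sum p0; rewrite big_seq big1; first by move/eqP; rewrite eq_sym oner_eq0.
  move=> i il; apply/eqP; rewrite eq_le s_ge0 andbT leNgt; apply/negP => si.
  by apply: h; exists i.
have cp : cdom (C p1) p0.
  have [K [_ KC s0]] := ssup p1; apply: KC; apply: contrapT => /s0 e.
  by rewrite e ltxx in sp1.
have cx := cim_cmap cp.
have [d1 _] := chart_density_regular N_compact v1 b0 (aC p1) (s1 p1) (ssup' p1).
have [|e e0 he] := @grid_sum_positive _ (cmap (C p1) p0) (Ck_onS d1) (dens_ge0 p1).
  by rewrite /chart_density mem_set // cinv_cmap // mulr_gt0 // normr_gt0 b0.
have e20 : 0 < e / 2 by rewrite divr_gt0.
have F : \forall j \near \oo, False.
  apply: filterS2 he (total _ e20) => j h1; rewrite (big_rem p1) //= ger0_norm; last first.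
    by rewrite addr_ge0 // sumr_ge0.
  move=> h2; have h3 : S (C p1) j (s p1) <= e / 2.
    by apply: le_trans h2; rewrite lerDl sumr_ge0.
  by have := le_trans h1 h3; rewrite leNgt ltr_pdivrMr // ltr_pMr // ltr1n.
by have [] := filter_ex F.
Qed.

End ExactVolume.

Lemma no_exact_volume_form {R : realType} {n : nat} (N : smoothManifold R n)
    (b : chart R n N -> 'rV[R]_n -> seq 'rV[R]_n -> R) :
  (0 < n)%N -> compact [set: N] -> [set: N] !=set0 -> form_family b ->
  ~ (forall c, atlas c -> forall x, cim c x -> top b c x != 0%R).
Proof.
by case: n N b => [//|q] N b _ cN N0 fb; exact: (no_exact_volume cN fb N0).
Qed.

(** * The pulled-back fundamental form *)

Section FormCalculus.
Context {R : realType}.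

Lemma Ck_wedge (V : normedModType R) k U (u : V -> V -> R) (A : V -> seq V -> R) s : open U ->
  (forall x, Ck_on k U (fun z => u z x)) -> (forall t, Ck_on k U (fun z => A z t)) ->
  Ck_on k U (fun z => wedge (u z) (A z) s).
Proof.
move=> oU hu; elim: s A => [|x s IH] A hA; first exact: Ck_cst.
apply: Ck_sub => //; first exact: Ck_mul.
by apply: IH => t; exact: hA.
Qed.

Lemma Ck_wedge2 (V : normedModType R) k U (B : V -> V -> V -> R) (A : V -> seq V -> R) s : open U ->
  (forall x y, Ck_on k U (fun z => B z x y)) -> (forall t, Ck_on k U (fun z => A z t)) ->
  Ck_on k U (fun z => wedge2 (B z) (A z) s).
Proof.
move=> oU hB; elim: s A => [|x s IH] A hA; first exact: Ck_cst.
apply: Ck_add => //; first exact: Ck_wedge.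
by apply: IH => t; exact: hA.
Qed.

Lemma Ck_iter_wedge2 (V : normedModType R) k l U (B : V -> V -> V -> R) (A : V -> seq V -> R) s :
  open U ->
  (forall x y, Ck_on k U (fun z => B z x y)) -> (forall t, Ck_on k U (fun z => A z t)) ->
  Ck_on k U (fun z => iter l (wedge2 (B z)) (A z) s).
Proof.
by move=> oU hB hA; elim: l s => [|l IH] s; [exact: hA|exact: Ck_wedge2].
Qed.

Lemma dseq_iter_wedge2 (V : normedModType R) U (B : V -> V -> V -> R) (A : V -> seq V -> R) y l s :
  open U -> U y ->
  (forall x x', Ck_on 1 U (fun z => B z x x')) -> (forall t, Ck_on 1 U (fun z => A z t)) ->
  (forall x x' x'', 'D_x (fun z => B z x' x'') y - 'D_x' (fun z => B z x x'') y +
     'D_x'' (fun z => B z x x') y = 0) ->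
  dseq (fun z => iter l (wedge2 (B z)) (A z)) y s = iter l (wedge2 (B y)) (dseq A y) s.
Proof.
move=> oU Uy hB hA dB; elim: l s => //= l IH s.
rewrite (dseq_wedge2 (A := fun z => iter l (wedge2 (B z)) (A z))) //.
    exact: eq_wedge2.
  by move=> x x'; have [d _] := Ck_onSP (hB x x'); exact: d.
by move=> t; have [d _] := Ck_onSP (Ck_iter_wedge2 l t oU hB hA); exact: d.
Qed.

Lemma dseq_homog (V : normedModType R) p (A : V -> seq V -> R) y :
  (forall z, seq_homog p (A z)) -> seq_homog p.+1 (dseq A y).
Proof.
move=> hA s; elim: s p A hA => [//|x s IH] p A hA hs /=.
have -> : (fun z => A z s) = fun=> 0 by apply/funext => z; exact: hA.
rewrite derive_cst sub0r; case: p hA hs => [|p] hA hs.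
  rewrite (eq_dseq (A' := fun _ _ => 0)) ?dseq0 ?oppr0 // => z t.
  by rewrite hA.
by rewrite (IH p) ?oppr0 // => z t ht; exact: hA.
Qed.

Lemma bilinear_expand n (B : 'rV[R]_n -> 'rV[R]_n -> R) u v :
  (forall c x y z, B (c *: x + y) z = c * B x z + B y z) ->
  (forall c x y z, B z (c *: x + y) = c * B z x + B z y) ->
  B u v = \sum_i \sum_j u 0 i * v 0 j * B (delta_mx 0 i) (delta_mx 0 j).
Proof.
move=> hl hr; rewrite (bilinear_coord (B := fun x y => B y x)); last by move=> *; exact: hl.
apply: eq_bigr => i _; rewrite (bilinear_coord (B := B)); last by move=> *; exact: hr.
by rewrite mulr_sumr; apply: eq_bigr => j _; rewrite mulrA.
Qed.

Lemma innerDl n (G : 'M[R]_n) c u v w : inner G (c *: u + v) w = c * inner G u w + inner G v w.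
Proof. by rewrite /inner !mulmxDl -!scalemxAl mxE [in X in X + _]mxE. Qed.

Lemma innerDr n (G : 'M[R]_n) c u v w : inner G w (c *: u + v) = c * inner G w u + inner G w v.
Proof. by rewrite /inner linearP /= mulmxDr -scalemxAr mxE [in X in X + _]mxE. Qed.

Lemma inner_sym n (G : 'M[R]_n) u v : G^T = G -> inner G u v = inner G v u.
Proof.
move=> GT; have -> : inner G u v = (u *m G *m v^T)^T 0 0 by rewrite [RHS]mxE.
by rewrite !trmx_mul trmxK GT mulmxA.
Qed.

End FormCalculus.

Section PulledBackForm.
Context {R : realType} {n m : nat} (N : smoothManifold R n) (M : smoothManifold R m).
Variables (g J : mxfield M) (f : N -> M).
Hypotheses (g_metric : riemannian_metric g) (J_complex : almost_complex J)
  (gJ_hermitian : Defs.hermitian g J) (f_smooth : smooth_map f)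
  (gJ_closed : closed_form (fundamental_form g J)).
Implicit Types (c : chart R n N) (d : chart R m M).

Definition kform d y (u v : 'rV[R]_m) := inner (g d y) u (v *m J d y).

Definition pform c d x (u v : 'rV[R]_n) :=
  kform d (locrep f c d x) (u *m jacobian (locrep f c d) x) (v *m jacobian (locrep f c d) x).

Lemma kform_linearl d y a u v w : kform d y (a *: u + v) w = a * kform d y u w + kform d y v w.
Proof. exact: innerDl. Qed.

Lemma kform_linearr d y a u v w : kform d y w (a *: u + v) = a * kform d y w u + kform d y w v.
Proof. by rewrite /kform mulmxDl -scalemxAl innerDr. Qed.

Lemma pform_linearl c d x a u v w : pform c d x (a *: u + v) w = a * pform c d x u w + pform c d x v w.
Proof. by rewrite /pform mulmxDl -scalemxAl kform_linearl. Qed.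

Lemma pform_linearr c d x a u v w : pform c d x w (a *: u + v) = a * pform c d x w u + pform c d x w v.
Proof. by rewrite /pform mulmxDl -scalemxAl kform_linearr. Qed.

(** g(u, J v) = g(J u, J J v) = - g(J u, v), and [g] is symmetric. *)
Lemma kform_antisym d y u v : atlas d -> cim d y -> kform d y u v = - kform d y v u.
Proof.
move=> ad dy; have [_ _ gT _] := g_metric; have [_ _ JJ] := J_complex.
rewrite /kform -(gJ_hermitian ad dy) -mulmxA JJ // mulmxN mulmx1.
rewrite (inner_sym _ _ (gT d ad y dy)) -[- v]addr0 -scaleN1r innerDl mulN1r.
by have -> : inner (g d y) 0 (u *m J d y) = 0; [rewrite /inner !mul0mx mxE|rewrite addr0].
Qed.

Lemma kform_smooth d k u v : atlas d -> Ck_on k (cim d) (fun y => kform d y u v).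
Proof.
move=> ad; have [gs _ _ _] := g_metric; have [Js _ _] := J_complex.
have od := @cim_open _ _ _ d.
have gij i j : Ck_on k (cim d) (fun y => g d y i j) by exact: ((Ck_mxP _ _ od).1 (gs d ad k)).
have Jij i j : Ck_on k (cim d) (fun y => J d y i j) by exact: ((Ck_mxP _ _ od).1 (Js d ad k)).
rewrite (_ : (fun y => _) = (fun y => \sum_j (\sum_i u 0 i * g d y i j) *
    (\sum_l v 0 l * J d y l j))); last first.
  apply/funext => y; rewrite /kform /inner mxE; apply: eq_bigr => j _.
  by rewrite [X in X * _]mxE [X in _ * X]mxE [X in _ * X]mxE.
apply: Ck_sum => // j _; apply: Ck_mul => //; apply: Ck_sum => // i _.
  by apply: Ck_mul => //; exact: Ck_cst.
by apply: Ck_mul => //; exact: Ck_cst.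
Qed.

Lemma smooth_locrep c d : atlas c -> atlas d -> smooth_on (locdom f c d) (locrep f c d).
Proof. by have [_ h] := f_smooth; exact: h. Qed.

Lemma open_locdom_f c d : open (locdom f c d).
Proof. by have [h _] := f_smooth; exact: open_locdom. Qed.

Lemma locrep_diff c d x : atlas c -> atlas d -> locdom f c d x -> differentiable (locrep f c d) x.
Proof. by move=> ac ad lx; have [h _] := Ck_onSP (smooth_locrep ac ad 1); exact: h. Qed.

Lemma pform_smooth c d k u v : atlas c -> atlas d ->
  Ck_on k (locdom f c d) (fun x => pform c d x u v).
Proof.
move=> ac ad; have ol := @open_locdom_f c d; have sl := smooth_locrep ac ad.
pose F := jacobian (locrep f c d).
have uF (w : 'rV[R]_n) i : Ck_on k (locdom f c d) (fun x => (w *m F x) 0 i).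
  rewrite (_ : (fun x => _) = (fun x => \sum_l w 0 l * F x l i)); last first.
    by apply/funext => x; rewrite mxE.
  apply: Ck_sum => // l _; apply: Ck_mul => //; first exact: Ck_cst.
  exact: Ck_jacobian.
rewrite (_ : (fun x => _) = (fun x => \sum_i \sum_j (u *m F x) 0 i * (v *m F x) 0 j *
    kform d (locrep f c d x) (delta_mx 0 i) (delta_mx 0 j))); last first.
  apply/funext => x; rewrite /pform (@bilinear_expand _ _ (kform d _)) //.
    by move=> *; exact: kform_linearl.
  by move=> *; exact: kform_linearr.
apply: Ck_sum => // i _; apply: Ck_sum => // j _; apply: Ck_mul => //; first exact: Ck_mul.
apply: (Ck_comp ol (sl k) (kform_smooth k _ _ ad)) => x; exact: locrep_cim.
Qed.

Lemma pform_antisym c d x u v : atlas d -> locdom f c d x -> pform c d x u v = - pform c d x v u.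
Proof. by move=> ad lx; apply: kform_antisym => //; exact: locrep_cim. Qed.

(** The Jacobians of f in two charts of M differ by that of the transition map, under which [g] and
    [J] transform as tensors. *)
Lemma pform_indep c d d' x u v : atlas c -> atlas d -> atlas d' ->
  locdom f c d x -> locdom f c d' x -> pform c d x u v = pform c d' x u v.
Proof.
move=> ac ad ad' lx lx'; have [_ gt _ _] := g_metric; have [_ Jt _] := J_complex.
pose y := locrep f c d x.
have [cx dx] : cim c x /\ cdom d (f (cinv c x)) by move: lx; rewrite locdomE.
have [_ d'x] : cim c x /\ cdom d' (f (cinv c x)) by move: lx'; rewrite locdomE.
have oy : overlap d d' y by exact: overlap_cmap.
have tE z : locdom f c d z -> locrep f c d' z = transition d d' (locrep f c d z).
  by rewrite locdomE => -[_ dz]; rewrite /locrep transition_cmap.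
have nb : \near x, transition d d' (locrep f c d x) = locrep f c d' x.
  by apply: filterS (open_nbhs_nbhs (conj (@open_locdom_f c d) lx)) => z /tE.
have dl := locrep_diff ac ad lx.
have dt : differentiable (transition d d') y.
  by have [h _] := Ck_onSP (transition_smooth ad ad' 1); exact: h.
have Jac : jacobian (locrep f c d') x = jacobian (locrep f c d) x *m jacobian (transition d d') y.
  rewrite -(jacobian_comp dl dt); apply/esym; apply: near_eq_jacobian nb _.
  exact: (differentiable_comp dl dt).
rewrite /pform /kform Jac (tE x lx) -/y !mulmxA.
by rewrite -[v *m _ *m _ *m _]mulmxA -(Jt _ _ ad ad' _ oy) mulmxA (gt _ _ ad ad' _ oy).
Qed.

Lemma pform_transition c c' d x u v : atlas c -> atlas c' -> atlas d ->
  overlap c c' x -> locdom f c d x -> pform c d x u v =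
  pform c' d (transition c c' x) (u *m jacobian (transition c c') x) (v *m jacobian (transition c c') x).
Proof.
move=> ac ac' ad ox lx.
have [cx dx] : cim c x /\ cdom d (f (cinv c x)) by move: lx; rewrite locdomE.
have tE z : overlap c c' z -> locrep f c' d (transition c c' z) = locrep f c d z.
  by move=> oz; rewrite /locrep cinv_transition.
have lx' : locdom f c' d (transition c c' x).
  rewrite locdomE /= cinv_transition //; split => //.
  exact: locrep_cim.
have nb : \near x, locrep f c' d (transition c c' x) = locrep f c d x.
  by apply: filterS (open_nbhs_nbhs (conj (@open_overlap _ _ _ c c') ox)) => z /tE.
have dl := locrep_diff ac' ad lx'.
have dt : differentiable (transition c c') x.
  by have [h _] := Ck_onSP (transition_smooth ac ac' 1); exact: h.
have Jac : jacobian (locrep f c d) x =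
    jacobian (transition c c') x *m jacobian (locrep f c' d) (transition c c' x).
  rewrite -(jacobian_comp dt dl); apply/esym; apply: near_eq_jacobian nb _.
  exact: (differentiable_comp dt dl).
by rewrite /pform Jac tE // !mulmxA.
Qed.

(** The first power turns a bilinear form into a form on lists, the shape to which [dseq_pull]
    applies. *)
Lemma wpow1 (V : lmodType R) (B : V -> V -> R) u v : wpow B 1 [:: u; v] = B u v.
Proof. by rewrite /wpow /= /seq_one /=; ring. Qed.

Lemma wpow_kform_regular d l : atlas d -> regular_on (cim d) (fun y => wpow (kform d y) l).
Proof.
move=> ad; split => y dy.
    apply: iter_wedge2_linear; last exact: seq_one_linear.
      by move=> *; exact: kform_linearl.
    by move=> *; exact: kform_linearr.
  by apply: iter_wedge2_antisym; [move=> *; exact: kform_antisym|exact: seq_one_antisym].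
move=> s; have := @Ck_iter_wedge2 _ _ 1 l (cim d) (kform d) (fun _ => @seq_one _ _) s
  (@cim_open _ _ _ d) (fun u v => kform_smooth 1 u v ad) (fun t => Ck_cst 1 (cim d) _).
by move=> /Ck_onSP[h _]; exact: h.
Qed.

Lemma dseq3 (V : normedModType R) (A : V -> seq V -> R) y u v w :
  dseq A y [:: u; v; w] = 'D_u (fun z => A z [:: v; w]) y -
    'D_v (fun z => A z [:: u; w]) y + 'D_w (fun z => A z [:: u; v]) y.
Proof.
rewrite /=; move: ('D_u _ y) ('D_v _ y) ('D_w _ y) => a b c.
by rewrite subr0 opprB addrA addrAC.
Qed.

Lemma kform_closed d y u v w : atlas d -> cim d y ->
  dseq (fun z => wpow (kform d z) 1) y [:: u; v; w] = 0.
Proof.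
move=> ad dy; have := gJ_closed ad dy (of_rows 3 [:: u; v; w]).
have E : fundamental_form g J d = fun z (A : 'M[R]_(2, m)) => wpow (kform d z) 1 (rows A).
  apply/funext => z; apply/funext => A.
  have -> : rows A = [:: row 0 A; row 1 A].
    rewrite 2!rows_cons (size0nil (size_rows _)); congr [:: _; _].
    by rewrite row_rowsub; congr row; apply: val_inj.
  by rewrite wpow1.
by rewrite E (dext_dseq (fun z => wpow (kform d z) 1)) of_rowsK.
Qed.

Lemma pform_closed c d x u v w : atlas c -> atlas d -> locdom f c d x ->
  'D_u (fun z => pform c d z v w) x - 'D_v (fun z => pform c d z u w) x +
  'D_w (fun z => pform c d z u v) x = 0.
Proof.
move=> ac ad lx; have ol := @open_locdom_f c d.
have l2 : Ck_on 2 (locdom f c d) (locrep f c d) by exact: smooth_locrep.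
have cimL z : locdom f c d z -> cim d (locrep f c d z) by exact: locrep_cim.
have := dseq_pull ol (@cim_open _ _ _ d) l2 cimL lx [:: u; v; w] (wpow_kform_regular 1 ad).
rewrite (kform_closed _ _ _ ad (cimL _ lx)) dseq3 => <-.
have E u' v' : (\near x, pull (locrep f c d) (fun y => wpow (kform d y) 1) x [:: u'; v'] =
    pform c d x u' v').
  apply: filterS (open_nbhs_nbhs (conj ol lx)) => z lz.
  have -> : pull (locrep f c d) (fun y => wpow (kform d y) 1) z [:: u'; v'] =
    wpow (kform d (locrep f c d z)) 1 [:: 'D_u' (locrep f c d) z; 'D_v' (locrep f c d) z] by [].
  by rewrite wpow1 /pform !(deriveEjacobian _ (locrep_diff ac ad lz)).
have D u' v' w' := near_eq_derive u' (E v' w').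
by congr (_ - _ + _); apply/esym; [exact: (D u v w)|exact: (D v u w)|exact: (D w u v)].
Qed.

End PulledBackForm.

(** * Powers of the pulled-back form and the contradiction *)

Section PowersOfTheFundamentalForm.
Context {R : realType} {n m : nat} (N : smoothManifold R n) (M : smoothManifold R m).
Variables (g J : mxfield M) (f : N -> M).
Hypotheses (g_metric : riemannian_metric g) (J_complex : almost_complex J)
  (gJ_hermitian : Defs.hermitian g J) (f_smooth : smooth_map f)
  (gJ_closed : closed_form (fundamental_form g J)).
Implicit Types (c : chart R n N) (d : chart R m M).

Definition chart_at (p : M) := projT1 (cid2 (atlas_cover p)).

Lemma atlas_chart_at p : atlas (chart_at p).
Proof. by rewrite /chart_at; case: cid2. Qed.

Lemma cdom_chart_at p : cdom (chart_at p) p.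
Proof. by rewrite /chart_at; case: cid2. Qed.

(* The expression of f^* omega in the chart c. *)
Definition Omega c x := pform g J f c (chart_at (f (cinv c x))) x.

Lemma locdom_chart_at c x : cim c x -> locdom f c (chart_at (f (cinv c x))) x.
Proof. by move=> cx; rewrite locdomE; split => //; exact: cdom_chart_at. Qed.

Lemma OmegaE c d x u v : atlas c -> atlas d -> locdom f c d x ->
  Omega c x u v = pform g J f c d x u v.
Proof.
move=> ac ad lx; have cx : cim c x by move: lx; rewrite locdomE => -[].
have a := atlas_chart_at (f (cinv c x)).
exact: (pform_indep g_metric J_complex f_smooth u v ac a ad (locdom_chart_at cx) lx).
Qed.

(** At each point [Omega] uses a chart of M chosen for the image point, without any continuity. By
    [OmegaE] that chart may be frozen near [x], which is how regularity and derivatives of [Omega]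
    are obtained. *)
Lemma near_Omega c x u v : atlas c -> cim c x ->
  \forall z \near x, pform g J f c (chart_at (f (cinv c x))) z u v = Omega c z u v.
Proof.
move=> ac cx; have lx := locdom_chart_at cx.
have nb := open_nbhs_nbhs (conj (@open_locdom_f _ _ _ _ _ _ f_smooth c (chart_at (f (cinv c x)))) lx).
apply: filterS nb => z lz; apply/esym; exact: (OmegaE _ _ ac (atlas_chart_at _) lz).
Qed.

Lemma Omega_linearl c x a u v w : Omega c x (a *: u + v) w = a * Omega c x u w + Omega c x v w.
Proof. exact: pform_linearl. Qed.

Lemma Omega_linearr c x a u v w : Omega c x w (a *: u + v) = a * Omega c x w u + Omega c x w v.
Proof. exact: pform_linearr. Qed.

Lemma Omega_antisym c x u v : cim c x -> Omega c x u v = - Omega c x v u.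
Proof.
move=> cx; have lx := locdom_chart_at cx.
exact: (pform_antisym g_metric J_complex gJ_hermitian u v (atlas_chart_at _) lx).
Qed.

Lemma Omega_smooth c k u v : atlas c -> Ck_on k (cim c) (fun x => Omega c x u v).
Proof.
move=> ac; apply: Ck_on_cover => x cx; set d := chart_at (f (cinv c x)).
exists (fun z => pform g J f c d z u v); split; first exact: near_Omega.
have ad : atlas d by exact: atlas_chart_at.
have /Ck_onP h := pform_smooth g_metric J_complex f_smooth k u v ac ad.
exact: h (locdom_chart_at cx).
Qed.

Lemma Omega_closed c x u v w : atlas c -> cim c x ->
  'D_u (fun z => Omega c z v w) x - 'D_v (fun z => Omega c z u w) x +
  'D_w (fun z => Omega c z u v) x = 0.
Proof.
move=> ac cx; set d := chart_at (f (cinv c x)).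
have D u' v' w' := near_eq_derive u' (near_Omega v' w' ac cx).
have := pform_closed g_metric J_complex gJ_hermitian f_smooth gJ_closed u v w ac
  (atlas_chart_at _) (locdom_chart_at cx).
by rewrite (D u v w) (D v u w) (D w u v).
Qed.

Lemma Omega_transition c c' x u v : atlas c -> atlas c' -> overlap c c' x ->
  Omega c x u v = Omega c' (transition c c' x) (u *m jacobian (transition c c') x)
    (v *m jacobian (transition c c') x).
Proof.
move=> ac ac' ox; have cx : cim c x by move: ox; rewrite overlapE => -[].
rewrite /Omega cinv_transition //.
exact: (pform_transition g J f_smooth u v ac ac' (atlas_chart_at _) ox (locdom_chart_at cx)).
Qed.

(** Let t = f_* w be the tangential part of J f_* u. Since J f_* u - t is orthogonal to the tangent
    space, Omega(w, u) = g(t, J f_* u) = g(t, t). If this were 0, the angle would be acos 0 = pi /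
    2. *)
Lemma Omega_nondegenerate theta c x u : slant_with_angle g J f theta -> theta != pi / 2 ->
  atlas c -> cim c x -> u != 0 -> exists v, Omega c x u v != 0.
Proof.
move=> slant th ac cx u0; have [cp cE] := cinvP cx.
set d := chart_at (f (cinv c x)).
have ad : atlas d by exact: atlas_chart_at.
have := slant (cinv c x) c d ac ad cp (cdom_chart_at _) u u0; rewrite cE /=.
set y := cmap d (f (cinv c x)); set F := jacobian _ _.
move=> [t [/submxP[w tE] orth thE]].
have dy : cim d y by apply: cim_cmap; exact: cdom_chart_at.
have [_ _ gT _] := g_metric.
have t0 : inner (g d y) t t != 0.
  apply: contraNneq th => tt; rewrite thE /inorm tt sqrtr0 mul0r.
  by rewrite acos0.
exists w; rewrite (Omega_antisym _ _ cx) oppr_eq0.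
rewrite (OmegaE _ _ ac ad (locdom_chart_at cx)) /pform /kform.
rewrite -/F -[locrep f c d x]/y (inner_sym _ _ (gT d ad y dy)).
have /(orth _) : (w *m F <= F)%MS by exact: submxMl.
rewrite -tE -[u *m F *m _ - t]addrC -scaleN1r innerDl mulN1r.
by move/eqP; rewrite addrC subr_eq0 => /eqP ->.
Qed.

Lemma wpow_Omega_form l c x : cim c x ->
  seq_linear (wpow (Omega c x) l) /\ seq_antisym (wpow (Omega c x) l).
Proof.
move=> cx; split.
  by apply: iter_wedge2_linear; [exact: Omega_linearl|exact: Omega_linearr|exact: seq_one_linear].
by apply: iter_wedge2_antisym; [move=> *; exact: Omega_antisym|exact: seq_one_antisym].
Qed.

Lemma iter_Omega_transition l c c' x a a' s : atlas c -> atlas c' -> overlap c c' x ->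
  (forall s, a s = a' [seq v *m jacobian (transition c c') x | v <- s]) ->
  iter l (wedge2 (Omega c x)) a s = iter l (wedge2 (Omega c' (transition c c' x))) a'
    [seq v *m jacobian (transition c c') x | v <- s].
Proof.
move=> ac ac' ox aa'.
refine (etrans _ (@iter_wedge2_map R _ _ (fun v : 'rV[R]_n => v *m jacobian (transition c c') x)
  (Omega c' (transition c c' x)) a' l s)).
elim: l s => [|l IH] s /=; first exact: aa'.
by apply: eq_wedge2 => // u v; exact: Omega_transition.
Qed.

Definition Omega_power l : preform N (2 * l) := fun c x A => wpow (Omega c x) l (rows A).
Arguments Omega_power : clear implicits.

Lemma Omega_power_form l : is_form (Omega_power l).
Proof.
split.
    move=> c ac x cx; have [h1 h2] := wpow_Omega_form l cx.
    by split; [exact: multilinear_rowsP|exact: alternating_rowsP].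
  move=> c ac A k; apply: Ck_iter_wedge2; first exact: cim_open.
    by move=> u v; exact: Omega_smooth.
  by move=> t; exact: Ck_cst.
move=> c d ac ad x ox A; rewrite /Omega_power rows_mulmx.
by apply: iter_Omega_transition => // -[].
Qed.

Lemma dseq_iter_Omega l c x (a : 'rV[R]_n -> seq 'rV[R]_n -> R) s : atlas c -> cim c x ->
  (forall t, Ck_on 1 (cim c) (fun z => a z t)) ->
  dseq (fun z => iter l (wedge2 (Omega c z)) (a z)) x s =
  iter l (wedge2 (Omega c x)) (dseq a x) s.
Proof.
move=> ac cx ha.
apply: (dseq_iter_wedge2 _ _ (@cim_open _ _ _ c) cx _ ha).
  by move=> u v; exact: Omega_smooth.
by move=> u v w; exact: Omega_closed.
Qed.

Lemma iter_wedge2_0 (V : lmodType R) (B : V -> V -> R) l s : iter l (wedge2 B) (fun=> 0) s = 0.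
Proof.
elim: l s => //= l IH s; rewrite -[RHS](wedge20r B s); exact: eq_wedge2.
Qed.

(** As Omega is closed, d(Omega^l /\ 1) = Omega^l /\ d1, and d1 = 0. *)
Lemma Omega_power_closed l : closed_form (Omega_power l).
Proof.
move=> c ac x cx A; rewrite /Omega_power (dext_dseq (fun z => wpow (Omega c z) l)).
rewrite (dseq_iter_Omega _ _ ac cx) => [|t]; last exact: Ck_cst.
rewrite -[RHS](iter_wedge2_0 (Omega c x) l (rows A)).
move: (rows A) => s {A}; elim: l s => [|l IH] s /=; last exact: eq_wedge2.
by case: s => //= v s; rewrite derive_cst (_ : dseq _ _ _ = 0) ?subr0 // -[RHS](dseq0 x s); apply: eq_dseq.
Qed.

Hypothesis Omega_nondeg : forall c, atlas c -> forall x, cim c x ->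
  forall u, u != 0 -> exists v, Omega c x u v != 0.

(** A list on which the power is nonzero exists by [wpow_nonzero], has n elements by homogeneity,
    and its value is a determinant times the value on the canonical basis. *)
Lemma top_power_neq0 l c x : n = (2 * l)%N -> atlas c -> cim c x ->
  wpow (Omega c x) l (rows (1%:M : 'M[R]_n)) != 0.
Proof.
move=> nE ac cx.
have [s s0] := @wpow_nonzero R n (Omega c x) (fun a u v w => Omega_linearr c x a u v w)
  (fun a u v w => Omega_linearl c x a u v w) (Omega_nondeg ac cx) l (eq_leq (esym nE)).
have ss : size s = n.
  by apply/eqP; apply: contraNT s0 => ss; rewrite (@wpow_homog _ _ _ l) // -nE.
rewrite -(of_rowsK ss) in s0.
have [h1 h2] := wpow_Omega_form l cx.
have E := @top_form_det R n (fun A => wpow (Omega c x) l (rows A)) (of_rows n s)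
  (multilinear_rowsP h1) (alternating_rowsP h2).
by apply: contraNneq s0 => e; rewrite E e mulr0.
Qed.

Lemma exact_form_seq p (W : preform N p) : (0 < p)%N -> exact_form W ->
  exists a : chart R n N -> 'rV[R]_n -> seq 'rV[R]_n -> R, form_family a /\
    forall c, atlas c -> forall x, cim c x ->
      seq_homog p (dseq (a c) x) /\ forall A, W c x A = dseq (a c) x (rows A).
Proof.
case: p W => // q W _ [h [h1 h2 h3] hE].
exists (fun c x => form_of (h c x)); split.
  split.
      move=> c ac x cx; have [l1 l2] := h1 c ac x cx.
      by split; [exact: form_of_linear|exact: form_of_antisym].
    move=> c ac s; rewrite /form_of; case: eqP => _; last exact: Ck_cst.
    exact: h2.
  move=> c d ac ad x ox s; rewrite /form_of size_map; case: eqP => // sq.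
  rewrite (h3 c d ac ad x ox); congr (h d _ _).
  apply/row_matrixP => i; rewrite row_mul !rowK (nth_map 0) ?sq //.
move=> c ac x cx; split; first by apply: dseq_homog => z; exact: form_of_homog.
by move=> A; rewrite (hE c ac x cx) dext_form_of.
Qed.

Lemma exact_power_contradiction i l : n = (2 * l)%N -> (0 < i <= l)%N ->
  compact [set: N] -> [set: N] !=set0 -> ~ exact_form (Omega_power i).
Proof.
move=> nE /andP[i0 il] cN N0 ex.
have [||a [fa aE]] := @exact_form_seq (2 * i) (Omega_power i); [by rewrite muln_gt0|exact: ex|].
have [h1 h2 h3] := fa.
(* The primitive Omega^(l - i) /\ a of Omega^l. *)
pose b c x := iter (l - i) (wedge2 (Omega c x)) (a c x).
have fb : form_family b.
  split.
      move=> c ac x cx; have [l1 l2] := h1 c ac x cx; split.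
        by apply: iter_wedge2_linear; [exact: Omega_linearl|exact: Omega_linearr|].
      by apply: iter_wedge2_antisym => // *; exact: Omega_antisym.
    move=> c ac s; apply: Ck_iter_wedge2; first exact: cim_open.
      by move=> u v; exact: Omega_smooth.
    by move=> t; exact: h2.
  move=> c d ac ad x ox s; apply: iter_Omega_transition => // t.
  exact: h3.
apply: (no_exact_volume_form _ cN N0 fb); first by rewrite nE muln_gt0 (leq_trans i0 il).
move=> c ac x cx; rewrite /top (dseq_iter_Omega _ _ ac cx); last first.
  by move=> t; apply: Ck_onS; exact: h2.
have [hom dE] := aE c ac x cx.
(* Exactness is known for matrices with 2 i rows only; on lists of other lengths both sides vanish
   by homogeneity. *)
have aW s : dseq (a c) x s = wpow (Omega c x) i s.
  have [ss|ss] := eqVneq (size s) (2 * i)%N; last by rewrite hom // wpow_homog.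
  by rewrite -(of_rowsK ss) -dE.
suff -> : iter (l - i) (wedge2 (Omega c x)) (dseq (a c) x) (rows 1%:M) =
    wpow (Omega c x) l (rows (1%:M : 'M[R]_n)) by exact: top_power_neq0.
rewrite -[in RHS](subnK il) /wpow iterD -/(wpow _ i).
elim: (l - i)%N (rows _) => [|j IH] s /=; first exact: aW.
exact: eq_wedge2.
Qed.

End PowersOfTheFundamentalForm.

End Preliminaries.

Theorem theorem3 (R : realType) (k : nat) (N : smoothManifold R (2 * k)%N)
  (N_compact : compact [set: N]) (N_nonempty : [set: N] !=set0)
  (i : nat) (hi : (1 <= i <= k)%N)
  (hH : deRham_trivial N (2 * i)%N) :
  forall (m : nat) (M : smoothManifold R (m + m)%N) (g J : mxfield M),
    kaehlerian g J ->
    ~ exists f : N -> M, immersion f /\ proper_slant g J f.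
Proof.
move=> m M g J [g_metric [J_complex _] gJ_hermitian gJ_closed].
move=> [f [[f_smooth _] [theta [slant _ th]]]].
apply: (@exact_power_contradiction R _ _ N M g J f g_metric J_complex gJ_hermitian f_smooth
  gJ_closed _ i k erefl hi N_compact N_nonempty).
  by move=> c ac x cx u; exact: (Omega_nondegenerate g_metric J_complex gJ_hermitian f_smooth slant th ac cx).
apply: hH; first exact: Omega_power_form.
exact: Omega_power_closed.
Qed.
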